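(* Let $c>0$, $T>0$, $-\frac13<\lambda<0$ and $0<\beta<1-\frac{4\lambda+2}{\sqrt{(2\lambda+3)(8\lambda+3)}}$. Let $\psi(x,t)=-\log(1+ct)-\log(1+x+ct)$ and $\varphi=e^{\lambda\psi}$. There exist constants $C>0$ and $S_0\ge1$, depending on $c,T,\lambda,\beta$, such that for every $$v\in C\bigl([0,T];H^2(0,\infty)\bigr)\cap C^1\bigl([0,T];H^1(0,\infty)\bigr)\cap C^2\bigl([0,T];L^2(0,\infty)\bigr)$$ with $v=0$ in a neighborhood of $t=0$ and of $t=T$, and every $s\le -S_0$, $$\begin{aligned} &\int_{Q}e^{2s\varphi}\left((-s)^3\varphi^3|v|^2+(-s)(|v_t|^2+|v_x|^2)\right)dx\,dt \le C\int_{Q}e^{2s\varphi}|\square v|^2\,dx\,dt\\ &\quad +C\int_0^T e^{2s\varphi(0,t)}\left((-s)^3\varphi(0,t)^3|v(0,t)|^2+(-s)\varphi(0,t)\bigl(|v_t(0,t)|^2+|v_x(0,t)|^2\bigr)\right)dt. \end{aligned}$$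
   Context: All functions are real-valued. $Q=(0,\infty)\times(0,T)$ with variables $(x,t)$. The wave operator is $\square v=v_{tt}-c^2v_{xx}$ with constant wave speed $c>0$. Explicitly $\varphi(x,t)=(1+ct)^{-\lambda}(1+x+ct)^{-\lambda}\ge 1$. The parameter $s$ is negative. *)

(* Defs.v *)
From HB Require Import structures.
From mathcomp Require Import all_boot all_order all_algebra.
From mathcomp Require Import all_classical all_reals all_analysis.

Set Implicit Arguments.
Unset Strict Implicit.
Unset Printing Implicit Defensive.
Import Order.TTheory GRing.Theory Num.Theory.
Import numFieldNormedType.Exports.

Local Open Scope classical_set_scope.
Local Open Scope ring_scope.

(* A function on (0, oo) is represented by a total function R -> R whose
   values outside (0, oo) are irrelevant; elements of L^2(0, oo) and of the
   Sobolev spaces below are such functions up to a.e. equality on (0, oo).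
   A curve t |-> u(t) with values in such a space is u : R -> R -> R, the time
   being the first argument: u t x stands for u(x, t). *)

Definition halfline (R : realType) : set R := `]0, +oo[.

Definition ae_eq_half (R : realType) (f g : R -> R) : Prop :=
  {ae @lebesgue_measure R, forall x, halfline x -> f x = g x}.

Definition inL2 (R : realType) (f : R -> R) : Prop :=
  (f \_ (@halfline R)) \in Lfun (@lebesgue_measure R) 2%:E.

Definition L2norm (R : realType) (f : R -> R) : \bar R :=
  'N[@lebesgue_measure R]_2%:E[EFin \o (f \_ (@halfline R))].

Definition test_function (R : realType) (p : R -> R) : Prop :=
  (forall (n : nat) (x : R), derivable (p^`(n))%classic x 1) /\
  exists a b : R, 0 < a /\ forall x, x \notin `[a, b] -> p x = 0.

(* g is an L^2(0, oo) weak derivative of f. *)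
Definition weak_deriv (R : realType) (f g : R -> R) : Prop :=
  inL2 g /\
  forall p : R -> R, test_function p ->
    \int[@lebesgue_measure R]_(x in @halfline R) (f x * (p^`())%classic x) =
    - \int[@lebesgue_measure R]_(x in @halfline R) (g x * p x).

(* H^k(0, oo), with H^0 = L^2. *)
Fixpoint Hk (R : realType) (k : nat) (f : R -> R) : Prop :=
  inL2 f /\
  match k with
  | 0 => True
  | k'.+1 => exists g : R -> R, weak_deriv f g /\ Hk k' g
  end.

(* A chosen weak derivative, if there is one. *)
Definition wderiv (R : realType) (f : R -> R) : R -> R :=
  get [set g | weak_deriv f g].

(* Meaningful for f in H^k(0, oo) only; the choices made in wderiv are
   irrelevant since weak derivatives are unique up to a.e. equality. *)
Definition Hk_norm (R : realType) (k : nat) (f : R -> R) : \bar R :=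
  ((\sum_(j < k.+1) L2norm (iter j (@wderiv R) f) `^ 2) `^ 2^-1)%E.

(* u in C([0, T]; H^k). *)
Definition curve_continuous (R : realType) (T : R) (k : nat)
    (u : R -> R -> R) : Prop :=
  forall t : R, t \in `[0, T] ->
    Hk k (u t) /\
    Hk_norm k (fun x => u r x - u t x) @[r --> within `[0, T] (nbhs t)]
      --> 0%E.

(* u is differentiable on [0, T] with values in H^k, with derivative w
   (one-sided at t = 0 and t = T). *)
Definition curve_deriv (R : realType) (T : R) (k : nat)
    (u w : R -> R -> R) : Prop :=
  forall t : R, t \in `[0, T] ->
    Hk k (u t) /\ Hk k (w t) /\
    Hk_norm k (fun x => (u r x - u t x) / (r - t) - w t x)
      @[r --> within `[0, T] (t^')] --> 0%E.

(* u in C^m([0, T]; H^k). *)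
Fixpoint curve_C (R : realType) (T : R) (m k : nat)
    (u : R -> R -> R) : Prop :=
  curve_continuous T k u /\
  match m with
  | 0 => True
  | m'.+1 => exists w, curve_deriv T k u w /\ curve_C T m' k w
  end.

(* Value at x = 0 of the representative of f that is continuous on [0, oo). *)
Definition trace0 (R : realType) (f : R -> R) : R :=
  get [set l | exists g : R -> R,
    [/\ {within `[0, +oo[, continuous g}, ae_eq_half f g & g 0 = l]].

(* Points of Q are pairs (x, t), whereas curves take the time first. *)
Definition Q (R : realType) (T : R) : set (R * R) :=
  @halfline R `*` `]0, T[.

(* Integral over Q with respect to dx dt. *)
Definition intQ (R : realType) (T : R) (F : R -> R -> R) : \bar R :=
  (\int[@lebesgue_measure R \x @lebesgue_measure R]_(z in Q T)
     (F z.1 z.2)%:E)%E.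

Definition measurableQ (R : realType) (T : R) (u : R -> R -> R) : Prop :=
  measurable_fun (Q T) (fun z : R * R => u z.2 z.1).

Definition vanishes_near_ends (R : realType) (T : R)
    (u : R -> R -> R) : Prop :=
  exists2 d : R, 0 < d &
    forall t, t \in `[0, T] -> t < d \/ T - d < t ->
      ae_eq_half (u t) (cst 0).

Definition psi (R : realType) (c x t : R) : R :=
  - ln (1 + c * t) - ln (1 + x + c * t).

Definition phi (R : realType) (c lambda x t : R) : R :=
  expR (lambda * psi c x t).

(* Main.v *)
Require Import Defs.
From HB Require Import structures.
From mathcomp Require Import all_boot all_order all_algebra.
From mathcomp Require Import all_classical all_reals all_analysis.
From mathcomp Require Import measurable_realfun ring lra.

(** The estimate is an energy estimate in the time direction. Write
    $\sigma = -s$, $W = e^{2s\varphi}$, $\kappa = -\lambda c / (1 + cT)$ and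
    consider
    $$E(t) = \frac12 \int_0^\infty W (v_t^2 + c^2 v_x^2)\,dx
       + \frac{\kappa^2}{8} \sigma^2 \int_0^\infty W \varphi^2 v^2\,dx.$$
    As $v$ vanishes near $t = 0$ and $t = T$, the integral of $E'$ over $(0, T)$
    is zero. In $E'$ the term with $v_x v_{tx}$ is integrated by parts in $x$.
    What remains is the integral of $W \square v\, v_t$, a boundary term
    $-c^2 W v_x v_t$ at $x = 0$, and the terms in which a derivative falls on a
    weight. These have a sign: $\varphi$ is increasing in time, and
    $\varphi_t \ge c\varphi_x + \kappa\varphi$ ([rate_gap]), while $W$
    decreases with $\varphi$. The first integral of $E$ thus yields a negative
    form of size $\kappa\sigma\varphi$ in $(v_t, v_x)$, the second one a
    negative term of order $\sigma^3\varphi^3 v^2$, and both absorb the products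
    $\square v\, v_t$ and $v v_t$ ([carleman_density]). At each time this gives
    $$a A + E' \le \kappa^{-1} \int W |\square v|^2\,dx
       + \frac{c^2}{2} B,$$
    with $A$ the left side of the estimate before integration in time, $B$ the
    boundary integrand, and $a > 0$ independent of $s \le -2$
    ([energy_inequality]). Integrating over $(0, T)$ proves the claim.

    Most of the work is to justify this for curves in Sobolev spaces. The
    energy is differentiated in time with quotients that converge in $L^2$
    ([energy_derivative]), the weights being bounded with two bounded
    derivatives in time. The integration by parts on the half line needs
    absolutely continuous representatives, whose values at 0 are the traces;
    they come from the lemma of du Bois-Reymond ([weak_deriv_primitive]), and the
    product rule for them comes from Fubini's theorem ([primitiveM],
    [weighted_integration_by_parts]). Finally the
    traces are not known to be measurable in time, and the inequality is
    integrated through a measurable lower bound of the boundary term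
    ([integrate_inequality]). *)

Set Implicit Arguments.
Unset Strict Implicit.
Unset Printing Implicit Defensive.
Import Order.TTheory GRing.Theory Num.Theory.
Import numFieldNormedType.Exports.

Local Open Scope classical_set_scope.
Local Open Scope ring_scope.

(** * Square integrable functions on the half line *)

Section squareIntegrable.
Context {R : realType}.
Implicit Types (f g P : R -> R) (a b M : R).
Local Notation mu := (@lebesgue_measure R).
Local Notation H := (@halfline R).

Lemma measurable_halfline : measurable (H : set (measurableTypeR R)).
Proof. exact: measurable_itv. Qed.
Hint Resolve measurable_halfline : core.

Lemma integrable_scale D f a : measurable (D : set (measurableTypeR R)) ->
  mu.-integrable D (EFin \o f) -> mu.-integrable D (EFin \o (fun x => a * f x)).
Proof. by move=> mD fi; exact: (integrableZl mD a fi). Qed.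

Lemma integrable_add D f g : measurable (D : set (measurableTypeR R)) ->
  mu.-integrable D (EFin \o f) -> mu.-integrable D (EFin \o g) ->
  mu.-integrable D (EFin \o (fun x => f x + g x)).
Proof. by move=> mD fi gi; exact: (integrableD mD fi gi). Qed.

Lemma integrable_sub D f g : measurable (D : set (measurableTypeR R)) ->
  mu.-integrable D (EFin \o f) -> mu.-integrable D (EFin \o g) ->
  mu.-integrable D (EFin \o (fun x => f x - g x)).
Proof. by move=> mD fi gi; exact: (integrableB mD fi gi). Qed.

Lemma inL2P f : inL2 f <->
  measurable_fun H f /\ mu.-integrable H (EFin \o (fun x => f x ^+ 2)).
Proof.
rewrite /inL2; split.
- move=> fL; split.
    apply/(measurable_restrictT _ _).2 => //.
    by move: fL; rewrite inE => /andP[/[!inE]].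
  have := Lfun2_integrable_sqr fL.
  move=> iT; apply/(integrable_mkcond _ measurable_halfline).
  suff -> : (EFin \o (fun x => f x ^+ 2)) \_ H =
      EFin \o (fun x => (f \_ H) x ^+ 2) by exact: iT.
  apply/funext => x /=.
  by rewrite /patch; case: ifPn => // _; rewrite expr0n.
- move=> [mf intf]; rewrite inE; apply/andP; split.
    by rewrite inE /=; exact/(measurable_restrictT _ _).1.
  rewrite inE /= /finite_norm unlock /Lnorm /=.
  apply: poweR_lty.
  move/integrableP : intf => [_].
  rewrite integral_mkcond; apply: le_lt_trans.
  rewrite le_eqVlt; apply/orP; left; apply/eqP; apply: eq_integral => x _.
  rewrite /patch /=; case: ifPn => _ /=.
    by rewrite powR_mulrn// real_normK ?num_real// ger0_norm// sqr_ge0.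
  by rewrite normr0 powR0 ?pnatr_eq0.
Qed.

Lemma inL2_measurable f : inL2 f -> measurable_fun H f.
Proof. by move=> /inL2P[]. Qed.

Definition sqint f : R := \int[mu]_(x in H) (f x ^+ 2).

Lemma sqint_ge0 f : 0 <= sqint f.
Proof. by apply: Rintegral_ge0 => x _; exact: sqr_ge0. Qed.

Lemma integrable_dominated f g : measurable_fun H f ->
  mu.-integrable H (EFin \o g) -> (forall x, H x -> `|f x| <= g x) ->
  mu.-integrable H (EFin \o f).
Proof.
move=> mf ig fg; apply: le_integrable ig => //.
  exact/measurable_EFinP.
by move=> x Hx /=; rewrite lee_fin (le_trans (fg _ Hx))// ler_norm.
Qed.

Lemma integrable_sqrD f g a b : inL2 f -> inL2 g ->
  mu.-integrable H (EFin \o (fun x => a * f x ^+ 2 + b * g x ^+ 2)).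
Proof.
move=> /inL2P[_ intf] /inL2P[_ intg].
by apply: integrable_add => //; apply: integrable_scale.
Qed.

Lemma inL2_lin f g a b : inL2 f -> inL2 g -> inL2 (fun x => a * f x + b * g x).
Proof.
move=> fL gL; apply/inL2P; have mf := inL2_measurable fL.
have mg := inL2_measurable gL.
have mh : measurable_fun H (fun x => a * f x + b * g x).
  by apply: measurable_funD; apply: measurable_funM => //; exact: measurable_cst.
split => //; apply: (@integrable_dominated _ (fun x => (2 * a ^+2) * f x ^+ 2 + (2 * b^+2) * g x ^+ 2)) => //.
- exact: measurable_funX.
- exact: integrable_sqrD.
- move=> x _; rewrite ger0_norm ?sqr_ge0//.
  have := sqr_ge0 (a * f x - b * g x); nra.
Qed.

Lemma inL2D f g : inL2 f -> inL2 g -> inL2 (fun x => f x + g x).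
Proof.
move=> fL gL; have := inL2_lin 1 1 fL gL; congr inL2.
by apply/funext => x; rewrite !mul1r.
Qed.

Lemma inL2B f g : inL2 f -> inL2 g -> inL2 (fun x => f x - g x).
Proof.
move=> fL gL; have := inL2_lin 1 (-1) fL gL; congr inL2.
by apply/funext => x; rewrite mul1r mulN1r.
Qed.

Lemma integrable_mul P f g M : measurable_fun H P ->
  (forall x, H x -> `|P x| <= M) -> inL2 f -> inL2 g ->
  mu.-integrable H (EFin \o (fun x => P x * f x * g x)).
Proof.
move=> mP PM fL gL; have mf := inL2_measurable fL.
have mg := inL2_measurable gL.
apply: (@integrable_dominated _ (fun x => M * f x ^+ 2 + M * g x ^+ 2)).
- by apply: measurable_funM => //; exact: measurable_funM.
- exact: integrable_sqrD.
- move=> x Hx; rewrite !normrM -mulrDr -mulrA.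
  apply: ler_pM => //; first exact: PM.
  rewrite -(real_normK (num_real (f x))) -(real_normK (num_real (g x))).
  have := sqr_ge0 (`|f x| - `|g x|); have := normr_ge0 (f x); have := normr_ge0 (g x); nra.
Qed.

Lemma sqint_le_lin f g a b : inL2 f -> inL2 g ->
  sqint (fun x => a * f x + b * g x) <= 2 * a ^+ 2 * sqint f + 2 * b ^+ 2 * sqint g.
Proof.
move=> fL gL; rewrite /sqint.
have /inL2P[_ if_] := fL. have /inL2P[_ ig] := gL.
rewrite -RintegralZl// -[X in _ + X]RintegralZl// -RintegralD//.
- apply: le_Rintegral => //.
  + by have /inL2P[] := inL2_lin a b fL gL.
  + exact: (integrable_sqrD (2 * a ^+2) (2 * b ^+2)).
  + by move=> x _; have := sqr_ge0 (a * f x - b * g x); nra.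
- exact: integrable_scale.
- exact: integrable_scale.
Qed.

(** When the weights converge uniformly and both factors converge in $L^2$,
    Young's inequality with parameter [e] bounds the change of the integral by a
    multiple of [e]. The derivatives of the energies in time, and the continuity
    of these derivatives, all reduce to this. *)
Lemma cvg_weighted_product (F : set_system R) {FF : Filter F}
    (P f g : R -> R -> R) (P0 f0 g0 : R -> R) (M : R) :
  (\forall r \near F, measurable_fun H (P r)) -> measurable_fun H P0 ->
  (forall x, H x -> `|P0 x| <= M) ->
  (forall e, 0 < e -> \forall r \near F, forall x, H x -> `|P r x - P0 x| <= e) ->
  (\forall r \near F, inL2 (f r)) -> inL2 f0 ->
  sqint (fun x => f r x - f0 x) @[r --> F] --> 0 ->
  (\forall r \near F, inL2 (g r)) -> inL2 g0 ->
  sqint (fun x => g r x - g0 x) @[r --> F] --> 0 ->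
  (\int[mu]_(x in H) (P r x * f r x * g r x)) @[r --> F] -->
  (\int[mu]_(x in H) (P0 x * f0 x * g0 x)).
Proof.
move=> mP mP0 PM cP fL f0L cf gL g0L cg.
have M0 : 0 <= M.
  have : H 1 by rewrite /halfline /= in_itv /= ltr01.
  by move=> /PM; apply: le_trans.
(* [e * K] will bound the difference of the two integrals. *)
pose K := 4 * (M + 1) * (sqint f0 + sqint g0 + 1).
have K0 : 0 < K.
  rewrite /K; have := sqint_ge0 f0; have := sqint_ge0 g0; nra.
apply/cvgrPdist_le => eps eps0.
pose e := Num.min 1 (eps / K).
have e0 : 0 < e by rewrite lt_min ltr01 divr_gt0.
have e1 : e <= 1 by rewrite ge_min lexx.
have eK : e * K <= eps by rewrite -ler_pdivlMr// ge_min lexx orbT.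
have e20 : 0 < e ^+ 2 by rewrite exprn_gt0.
move/cvgrPdist_le : cf => /(_ _ e20) cf.
move/cvgrPdist_le : cg => /(_ _ e20) cg.
have cPe := cP _ e0.
near=> r.
have mPr : measurable_fun H (P r) by near: r.
have frL : inL2 (f r) by near: r.
have grL : inL2 (g r) by near: r.
have Pre : forall x, H x -> `|P r x - P0 x| <= e by near: r.
have : `|0 - sqint (fun x => f r x - f0 x)| <= e ^+ 2 by near: r.
rewrite sub0r normrN ger0_norm ?sqint_ge0// => fre.
have : `|0 - sqint (fun x => g r x - g0 x)| <= e ^+ 2 by near: r.
rewrite sub0r normrN ger0_norm ?sqint_ge0// => gre.
have PrM : forall x, H x -> `|P r x| <= M + 1.
  move=> x Hx; rewrite -[P r x](subrK (P0 x)) addrC (le_trans (ler_normD _ _))//.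
  by rewrite lerD ?PM// (le_trans (Pre _ Hx)).
have aL : inL2 (fun x => f r x - f0 x) by exact: inL2B.
have bL : inL2 (fun x => g r x - g0 x) by exact: inL2B.
have i0 := integrable_mul mP0 PM f0L g0L.
have ir := integrable_mul mPr PrM frL grL.
rewrite -RintegralB//.
apply: le_trans (le_normr_Rintegral _ _) _ => //; first exact: integrable_sub.
apply: (@le_trans _ _ (\int[mu]_(x in H) ((M + 1) * ((e * f0 x ^+ 2 + e * g0 x ^+ 2) +
   (e^-1 * (f r x - f0 x) ^+ 2 + e^-1 * (g r x - g0 x) ^+ 2))))).
  apply: le_Rintegral => //.
  - by apply: integrable_norm; exact: integrable_sub.
  - apply: integrable_scale => //; apply: integrable_add => //.
      exact: (integrable_sqrD e e f0L g0L).
    exact: (integrable_sqrD e^-1 e^-1 aL bL).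
  - move=> x Hx /=.
    have -> : P0 x * f0 x * g0 x - P r x * f r x * g r x =
      (P0 x - P r x) * (f0 x * g0 x) - P r x * ((f r x - f0 x) * g0 x + f0 x * (g r x - g0 x)
          + (f r x - f0 x) * (g r x - g0 x)) by ring.
    set a := f r x - f0 x; set b := g r x - g0 x.
    have AB (y z c : R) : 0 < c -> `|y * z| <= 2^-1 * (c * y ^+ 2 + c^-1 * z ^+ 2).
      move=> c0; rewrite normrM -(real_normK (num_real y)) -(real_normK (num_real z)).
      have : 0 <= c^-1 * (c * `|y| - `|z|) ^+ 2.
        by rewrite mulr_ge0 ?sqr_ge0// invr_ge0 ltW.
      have -> : c^-1 * (c * `|y| - `|z|) ^+ 2 = c * `|y| ^+ 2 - 2 * (`|y| * `|z|) + c^-1 * `|z|^+2.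
        by field; rewrite gt_eqF.
      lra.
    have h1 : `|f0 x * g0 x| <= 2^-1 * (f0 x ^+ 2 + g0 x ^+ 2).
      by have := AB (f0 x) (g0 x) 1 ltr01; rewrite invr1 !mul1r.
    have h2 : `|a * g0 x| <= 2^-1 * (e * g0 x ^+ 2 + e^-1 * a ^+ 2).
      by rewrite mulrC; exact: AB.
    have h3 := AB (f0 x) b e e0.
    have h4 : `|a * b| <= 2^-1 * (a ^+ 2 + b ^+ 2).
      by have := AB a b 1 ltr01; rewrite invr1 !mul1r.
    have ie1 : 1 <= e^-1 by rewrite invf_ge1.
    have h5 : `|a * g0 x + f0 x * b + a * b| <=
       2^-1 * (e * g0 x ^+ 2 + e^-1 * a ^+ 2) + 2^-1 * (e * f0 x ^+ 2 + e^-1 * b ^+ 2) + 2^-1 * (a ^+ 2 + b ^+ 2).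
      by apply: le_trans (ler_normD _ _) _; apply: lerD => //;
        apply: le_trans (ler_normD _ _) _; apply: lerD.
    apply: le_trans (ler_normB _ _) _; rewrite !normrM.
    have h6 : `|P0 x - P r x| * `|f0 x * g0 x| <= e * (2^-1 * (f0 x ^+ 2 + g0 x ^+ 2)).
      by apply: ler_pM => //; rewrite distrC Pre.
    rewrite -normrM.
    have h7 : `|P r x| * `|a * g0 x + f0 x * b + a * b| <= (M+1) * (2^-1 * (e * g0 x ^+ 2 + e^-1 * a ^+ 2) + 2^-1 * (e * f0 x ^+ 2 + e^-1 * b ^+ 2) + 2^-1 * (a ^+ 2 + b ^+ 2)).
      by apply: ler_pM => //; exact: PrM.
    rewrite -normrM in h7 *.
    have := sqr_ge0 a; have := sqr_ge0 b; have := sqr_ge0 (f0 x); have := sqr_ge0 (g0 x).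
    move: h6 h7; rewrite -!normrM.
    set A := a ^+ 2; set B := b ^+ 2; set C := f0 x ^+ 2; set D := g0 x ^+ 2.
    move=> h6 h7 D0 C0 B0 A0.
    apply: (le_trans (lerD h6 h7)).
    have t1 : A <= e^-1 * A by rewrite ler_peMl.
    have t2 : B <= e^-1 * B by rewrite ler_peMl.
    have t3 : e * (2^-1 * (C + D)) <= (M + 1) * (e * (2^-1 * (C + D))).
      by rewrite ler_peMl ?lerDr// mulr_ge0 ?(ltW e0)// mulr_ge0// addr_ge0.
    apply: (le_trans (lerD t3 (lexx _))).
    rewrite -mulrDr; apply: ler_wpM2l; first by rewrite addr_ge0.
    lra.
rewrite RintegralZl//; last first.
  apply: integrable_add => //; [exact: (integrable_sqrD e e f0L g0L)|
    exact: (integrable_sqrD e^-1 e^-1 aL bL)].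
have /inL2P[_ i1] := f0L. have /inL2P[_ i2] := g0L.
have /inL2P[_ i3] := aL. have /inL2P[_ i4] := bL.
rewrite RintegralD//; last 2 first.
- exact: (integrable_sqrD e e f0L g0L).
- exact: (integrable_sqrD e^-1 e^-1 aL bL).
rewrite !RintegralD//; try (by apply: integrable_scale).
rewrite !RintegralZl// -/(sqint f0) -/(sqint g0).
rewrite -/(sqint (fun x => f r x - f0 x)) -/(sqint (fun x => g r x - g0 x)).
have ee : e^-1 * e ^+ 2 = e by rewrite expr2 mulKf// gt_eqF.
have u1 : e^-1 * sqint (fun x => f r x - f0 x) <= e.
  by rewrite -[leRHS]ee ler_wpM2l// invr_ge0 ltW.
have u2 : e^-1 * sqint (fun x => g r x - g0 x) <= e.
  by rewrite -[leRHS]ee ler_wpM2l// invr_ge0 ltW.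
apply: le_trans eK; rewrite /K.
have -> : e * (4 * (M + 1) * (sqint f0 + sqint g0 + 1)) = (M + 1) * (4 * e * (sqint f0 + sqint g0 + 1)) by ring.
apply: ler_wpM2l; first by rewrite addr_ge0.
have := sqint_ge0 f0; have := sqint_ge0 g0; nra.
Unshelve. all: by end_near. Qed.

End squareIntegrable.

(** * Difference quotients on an interval *)

Section withinLimits.
Context {R : realType}.
Implicit Types (S : set R) (f E : R -> R) (l t d : R).

Lemma cvg_withinP S f l t : f r @[r --> within S (nbhs t)] --> l <->
  forall e, 0 < e -> exists2 d, 0 < d &
    forall r, S r -> `|r - t| < d -> `|f r - l| <= e.
Proof.
split.
  move=> /cvgrPdist_le cf e e0; have := cf _ e0.
  rewrite near_withinE near_simpl => /nbhs_ballP[d /= d0 fd]; exists d => // r Sr rt.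
  by rewrite distrC; apply: fd => //; rewrite /ball /= distrC.
move=> h; apply/cvgrPdist_le => e e0; have [d d0 hd] := h _ e0.
rewrite near_withinE near_simpl; apply/nbhs_ballP; exists d => // r /= rt Sr.
by rewrite distrC; apply: hd => //; rewrite distrC.
Qed.

Lemma cvg_within_dnbhsP S f l t : f r @[r --> within S t^'] --> l <->
  forall e, 0 < e -> exists2 d, 0 < d &
    forall r, S r -> r != t -> `|r - t| < d -> `|f r - l| <= e.
Proof.
split.
  move=> /cvgrPdist_le cf e e0; have := cf _ e0.
  rewrite near_withinE /dnbhs near_withinE near_simpl => /nbhs_ballP[d /= d0 fd]; exists d => // r Sr rt rd.
  by rewrite distrC; apply: fd => //; rewrite /ball /= distrC.
move=> h; apply/cvgrPdist_le => e e0; have [d d0 hd] := h _ e0.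
rewrite near_withinE /dnbhs near_withinE near_simpl; apply/nbhs_ballP; exists d => // r /= rd rt Sr.
by rewrite distrC; apply: hd => //; rewrite distrC.
Qed.

Lemma near_withinW S t (Q : R -> Prop) : (forall r, S r -> Q r) ->
  \forall r \near within S (nbhs t), Q r.
Proof. by move=> SQ; rewrite near_withinE near_simpl; apply/nbhs_ballP; exists 1 => //= r _; exact: SQ. Qed.

Lemma near_within_dnbhsW S t (Q : R -> Prop) : (forall r, S r -> r != t -> Q r) ->
  \forall r \near within S t^', Q r.
Proof.
move=> SQ; rewrite near_withinE /dnbhs near_withinE near_simpl; apply/nbhs_ballP; exists 1 => //= r _ rt Sr.
exact: SQ.
Qed.

Lemma near_within_ball S t d (Q : R -> Prop) : 0 < d ->
  (forall r, S r -> `|r - t| <= d -> Q r) ->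
  \forall r \near within S (nbhs t), Q r.
Proof.
move=> d0 SQ; rewrite near_withinE near_simpl; apply/nbhs_ballP; exists d => //= r rd Sr.
by apply: SQ => //; rewrite distrC ltW.
Qed.

Lemma near_within_dball S t d (Q : R -> Prop) : 0 < d ->
  (forall r, S r -> r != t -> `|r - t| <= d -> Q r) ->
  \forall r \near within S t^', Q r.
Proof.
move=> d0 SQ; rewrite near_withinE /dnbhs near_withinE near_simpl; apply/nbhs_ballP; exists d => //= r rd rt Sr.
by apply: SQ => //; rewrite distrC ltW.
Qed.

Lemma difference_quotient_continuous S E l t : S t ->
  (E r - E t) / (r - t) @[r --> within S t^'] --> l ->
  E r @[r --> within S (nbhs t)] --> E t.
Proof.
move=> St /cvg_within_dnbhsP h; apply/cvg_withinP => e e0.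
have [d d0 hd] := h _ ltr01.
have k0 : 0 < 1 + `|l| by rewrite ltr_pwDl.
exists (Num.min d (e / (1 + `|l|))).
  by rewrite lt_min d0 divr_gt0.
move=> r Sr; rewrite lt_min => /andP[rd re].
have [->|rt] := eqVneq r t; first by rewrite subrr normr0 ltW.
have := hd _ Sr rt rd; set q := _ / _ => qd.
have q1 : `|q| <= 1 + `|l|.
  by rewrite -[q](subrK l) (le_trans (ler_normD _ _))// lerD2r.
have -> : E r - E t = (r - t) * q by rewrite /q mulrC divfK// subr_eq0.
rewrite normrM -(divfK (lt0r_neq0 k0) e).
by apply: ler_pM => //; exact: ltW.
Qed.

(** One-sided quotients at the two end points make [E] continuous there;
    inside the interval the quotients are two-sided, so the classical theorem for
    a derivative continuous up to the boundary applies. *)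
Lemma FTC_within (E D : R -> R) (T : R) : 0 < T ->
  (forall t, t \in `[0, T] -> (E r - E t) / (r - t) @[r --> within `[0, T] t^'] --> D t) ->
  (forall t, t \in `[0, T] -> D r @[r --> within `[0, T] (nbhs t)] --> D t) ->
  (@lebesgue_measure R).-integrable `[0, T] (EFin \o D) /\
  \int[@lebesgue_measure R]_(t in `[0, T]) D t = E T - E 0.
Proof.
move=> T0 dE cD.
have cD' : {within `[0, T], continuous D}.
  by apply/subspace_continuousP => t tT; apply: cD.
have iD : (@lebesgue_measure R).-integrable `[0, T] (EFin \o D).
  by apply: continuous_compact_integrable => //; exact: segment_compact.
split => //.
have cE t : t \in `[0, T] -> E r @[r --> within `[0, T] (nbhs t)] --> E t.
  by move=> tT; apply: difference_quotient_continuous (dE _ tT).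
have cE' : {within `[0, T], continuous E}.
  by apply/subspace_continuousP => t tT; apply: cE.
have [_ E0 ET] := (continuous_within_itvP E T0).1 cE'.
have dE' t : t \in `]0, T[ -> h^-1 *: (E (h *: 1 + t) - E t) @[h --> 0^'] --> D t.
  move=> tT; have tT' : t \in `[0, T] by apply: subset_itv_oo_cc.
  have /cvg_within_dnbhsP h := dE _ tT'.
  apply/cvgrPdist_le => e e0; have [d d0 hd] := h _ e0.
  near=> k.
  have k0 : k != 0 by near: k; exact: nbhs_dnbhs_neq.
  have kd : `|k| < d by near: k; exact: dnbhs0_lt.
  have kt : `|k| < t by near: k; apply: dnbhs0_lt; rewrite (itvP tT).
  have kT : `|k| < T - t by near: k; apply: dnbhs0_lt; rewrite subr_gt0 (itvP tT).
  have := hd (k + t); rewrite addrK; move=> /(_ _ _ kd); rewrite distrC.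
  rewrite [k *: 1](_ : _ = k); last by rewrite /GRing.scale /= mulr1.
  rewrite [_ *: _](_ : _ = (E (k + t) - E t) / k); last by rewrite /GRing.scale /= mulrC.
  apply.
    rewrite /= in_itv /=; move: kt kT; rewrite !ltr_norml => /andP[? ?] /andP[? ?].
    by apply/andP; split; lra.
  by apply: contra_neq k0 => /(canRL (addrK _)) ->; rewrite subrr.
have dEt t : t \in `]0, T[ -> derivable E t 1.
  by move=> tT; apply/cvg_ex; exists (D t); apply: dE'.
rewrite /Rintegral (continuous_FTC2 T0 cD' (F := E)) //.
move=> t tT; rewrite derive1E; apply: cvg_lim => //; exact: dE'.
Unshelve. all: by end_near. Qed.

End withinLimits.

(** * Weighted energies of square integrable curves *)

Section squareIntegrableCurves.
Context {R : realType}.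
Local Notation mu := (@lebesgue_measure R).
Local Notation H := (@halfline R).
Variable T : R.
Implicit Types (f w P Pt : R -> R -> R) (r t x : R).

Definition L2continuous w := forall t, t \in `[0, T] ->
  inL2 (w t) /\
  sqint (fun x => w r x - w t x) @[r --> within `[0, T] (nbhs t)] --> 0.

Definition L2deriv f w := forall t, t \in `[0, T] ->
  [/\ inL2 (f t), inL2 (w t) &
  sqint (fun x => (f r x - f t x) / (r - t) - w t x)
    @[r --> within `[0, T] t^'] --> 0].

Lemma L2deriv_continuous f w : L2deriv f w -> L2continuous f.
Proof.
move=> fw t tT; have [fL wL /cvg_within_dnbhsP h] := fw _ tT; split => //.
apply/cvg_withinP => e e0.
have [d d0 hd] := h _ ltr01.
pose K := 2 * (1 + sqint (w t)).
have K0 : 0 < K by rewrite mulr_gt0// ltr_pwDl// sqint_ge0.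
exists (Num.min d (Num.min 1 (e / K))); first by rewrite !lt_min d0 ltr01 divr_gt0.
move=> r Sr; rewrite !lt_min => /and3P[rd r1 re].
rewrite subr0.
have [->|rt] := eqVneq r t.
  rewrite /sqint; under eq_Rintegral do rewrite subrr expr0n.
  by rewrite Rintegral_cst ?mul0r ?normr0 ?ltW//; exact: measurable_halfline.
have rT : r \in `[0, T] by [].
have [frL _ _] := fw _ rT.
have := hd _ Sr rt rd; rewrite subr0 !ger0_norm ?sqint_ge0//.
set q := fun x => _ => hq.
have qL : inL2 q.
  have := inL2_lin (r - t)^-1 (- 1) (inL2B frL fL) wL; congr inL2.
  by apply/funext => x; rewrite mulN1r mulrC.
have -> : (fun x => f r x - f t x) = (fun x => (r - t) * q x + (r - t) * w t x).
  by apply/funext => x; rewrite -mulrDr subrK mulrC divfK// subr_eq0.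
apply: le_trans (sqint_le_lin _ _ qL wL) _.
have : (r - t) ^+ 2 <= e / K.
  rewrite -real_normK ?num_real// expr2 (le_trans _ (ltW re))//.
  by rewrite ger_pMl ?ltW// normr_gt0 subr_eq0.
rewrite ler_pdivlMr// => h1; apply: le_trans h1; rewrite /K.
have := sqint_ge0 (w t); have := sqr_ge0 (r - t); nra.
Qed.

(** All bounds are uniform in [x], so that an energy with weight [P] can be
    differentiated in time for a curve that is differentiable in $L^2$ only. *)
Definition C11_weight (M : R) P Pt := forall t, t \in `[0, T] ->
  [/\ measurable_fun H (P t), measurable_fun H (Pt t),
   (forall x, H x -> `|P t x| <= M),
   (forall x, H x -> `|Pt t x| <= M) &
   forall r x, r \in `[0, T] -> H x ->
   [/\ `|P r x - P t x| <= M * `|r - t|,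
       `|Pt r x - Pt t x| <= M * `|r - t| &
       `|P r x - P t x - (r - t) * Pt t x| <= M * (r - t) ^+ 2]].

Definition energy P f t := \int[mu]_(x in H) (P t x * f t x * f t x).

Definition energy' P Pt f w t :=
  \int[mu]_(x in H) (P t x * w t x * (f t x + f t x)) +
  \int[mu]_(x in H) (Pt t x * f t x * f t x).

Lemma C11_weight_ge0 M P Pt t : t \in `[0, T] -> C11_weight M P Pt -> 0 <= M.
Proof.
move=> tT /(_ _ tT)[_ _ + _ _] => /(_ 1).
by rewrite /halfline /= in_itv /= ltr01 => /(_ isT); apply: le_trans.
Qed.

(** By $f(r)^2 - f(t)^2 = (f(r) - f(t)) (f(r) + f(t))$ the quotient of the
    energy is the sum of an integral of $P(r)$ times the quotient of $f$ times
    $f(r) + f(t)$, and of an integral of the quotient of $P$ times $f(t)^2$. Both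
    converge as weighted products. *)
Lemma energy_derivative M P Pt f w t : C11_weight M P Pt -> L2deriv f w ->
  t \in `[0, T] ->
  (energy P f r - energy P f t) / (r - t) @[r --> within `[0, T] t^'] -->
  energy' P Pt f w t.
Proof.
move=> PM fw tT; have [fL wL qw] := fw _ tT.
have M0 := C11_weight_ge0 tT PM.
have [mP mPt bP bPt lip] := PM _ tT.
have [_ /cvg_withinP fc] := L2deriv_continuous fw tT.
pose q r x := (f r x - f t x) / (r - t).
have qL r : r \in `[0, T] -> inL2 (q r).
  move=> rT; have [frL _ _] := fw _ rT.
  have := inL2_lin (r - t)^-1 0 (inL2B frL fL) wL; congr inL2.
  by apply/funext => x; rewrite mul0r addr0 mulrC.
have c1 : \int[mu]_(x in H) (P r x * q r x * (f r x + f t x)) @[r --> within `[0, T] t^'] -->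
    \int[mu]_(x in H) (P t x * w t x * (f t x + f t x)).
  apply: (@cvg_weighted_product _ _ _ _ _ (fun r x => f r x + f t x) _ _ _ M) => //.
  - by apply: near_within_dnbhsW => r rT _; have [] := PM _ rT.
  - move=> e e0; apply: (@near_within_dball _ _ _ (e / (M + 1))).
      by rewrite divr_gt0// ltr_wpDl.
    move=> r rT _ re x Hx; have [h _ _] := lip r x rT Hx.
    apply: le_trans h _; apply: (@le_trans _ _ (M * (e / (M + 1)))).
      exact: ler_wpM2l.
    by rewrite mulrCA ger_pMr// ler_pdivrMr ?ltr_wpDl// mul1r lerDl.
  - by apply: near_within_dnbhsW => r rT _; exact: qL.
  - by apply: near_within_dnbhsW => r rT _; apply: inL2D => //; have [] := fw _ rT.
  - exact: inL2D.
  - apply/cvg_within_dnbhsP => e e0; have [d d0 hd] := fc _ e0.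
    exists d => // r Sr _ rd; have := hd r Sr rd.
    rewrite (_ : (fun x => f r x + f t x - (f t x + f t x)) = (fun x => f r x - f t x))//.
    by apply/funext => x; ring.
have c2 : \int[mu]_(x in H) (((P r x - P t x) / (r - t)) * f t x * f t x) @[r --> within `[0, T] t^'] -->
    \int[mu]_(x in H) (Pt t x * f t x * f t x).
  apply: (@cvg_weighted_product _ _ _ (fun r x => (P r x - P t x) / (r - t)) (fun=> f t) (fun=> f t) _ _ _ M) => //.
  - apply: near_within_dnbhsW => r rT _; have [mPr _ _ _ _] := PM _ rT.
    by apply: measurable_funM => //; exact: measurable_funB.
  - move=> e e0; apply: (@near_within_dball _ _ _ (e / (M + 1))).
      by rewrite divr_gt0// ltr_wpDl.
    move=> r rT rt re x Hx; have [_ _ h] := lip r x rT Hx.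
    have rt0 : 0 < `|r - t| by rewrite normr_gt0 subr_eq0.
    rewrite -(ler_pM2r rt0) -normrM mulrBl divfK ?subr_eq0// (mulrC (Pt _ _)).
    apply: le_trans h _; rewrite -real_normK ?num_real// expr2 mulrA ler_pM2r//.
    apply: (@le_trans _ _ (M * (e / (M + 1)))); first exact: ler_wpM2l.
    by rewrite mulrCA ger_pMr// ler_pdivrMr ?ltr_wpDl// mul1r lerDl.
  - exact: near_within_dnbhsW.
  - apply/cvg_within_dnbhsP => e e0; exists 1 => // r _ _ _.
    rewrite /sqint; under eq_Rintegral do rewrite subrr expr0n.
    by rewrite Rintegral_cst ?mul0r ?subr0 ?normr0 ?ltW//; exact: measurable_halfline.
  - exact: near_within_dnbhsW.
  - apply/cvg_within_dnbhsP => e e0; exists 1 => // r _ _ _.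
    rewrite /sqint; under eq_Rintegral do rewrite subrr expr0n.
    by rewrite Rintegral_cst ?mul0r ?subr0 ?normr0 ?ltW//; exact: measurable_halfline.
rewrite /energy'; apply: cvg_trans (cvgD c1 c2); apply: near_eq_cvg.
apply: near_within_dnbhsW => r rT rt.
have rt0 : r - t != 0 by rewrite subr_eq0.
have [frL _ _] := fw _ rT.
have [mPr _ bPr _ _] := PM _ rT.
have mH := @measurable_halfline R.
have i1 : mu.-integrable H (EFin \o (fun x => P r x * q r x * (f r x + f t x))).
  by apply: (integrable_mul mPr bPr) => //; [exact: qL|exact: inL2D].
have i2 : mu.-integrable H (EFin \o (fun x => (P r x - P t x) / (r - t) * f t x * f t x)).
  apply: (@integrable_mul _ _ _ _ M) => //.
    by apply: measurable_funM => //; exact: measurable_funB.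
  move=> x Hx; have [h _ _] := lip r x rT Hx.
  by rewrite normrM normfV ler_pdivrMr// normr_gt0.
have i3 := integrable_mul mPr bPr frL frL.
have i4 := integrable_mul mP bP fL fL.
rewrite -[LHS](@RintegralD _ _ _ mu H _ _ mH i1 i2).
rewrite /energy -(@RintegralB _ _ _ mu H _ _ mH i3 i4) mulrC -RintegralZl//; last exact: integrable_sub.
by apply: eq_Rintegral => x _; rewrite /q; field.
Qed.

Lemma energy'_continuous M P Pt f w t : C11_weight M P Pt -> L2deriv f w ->
  L2continuous w -> t \in `[0, T] ->
  energy' P Pt f w r @[r --> within `[0, T] (nbhs t)] --> energy' P Pt f w t.
Proof.
move=> PM fw wc tT; have [fL _ _] := fw _ tT; have [wL wct] := wc _ tT.
have M0 := C11_weight_ge0 tT PM.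
have [mP mPt bP bPt lip] := PM _ tT.
have [_ fc] := L2deriv_continuous fw tT.
have small e : 0 < e -> M * (e / (M + 1)) <= e.
  by move=> e0; rewrite mulrCA ger_pMr// ler_pdivrMr ?ltr_wpDl// mul1r lerDl.
apply: cvgD.
  apply: (@cvg_weighted_product _ _ _ _ _ (fun r x => f r x + f r x) _ _ _ M) => //.
  - by apply: near_withinW => r rT; have [] := PM _ rT.
  - move=> e e0; apply: (@near_within_ball _ _ _ (e / (M + 1))).
      by rewrite divr_gt0// ltr_wpDl.
    move=> r rT re x Hx; have [h _ _] := lip r x rT Hx.
    by apply: le_trans h _; apply: le_trans (small _ e0); exact: ler_wpM2l.
  - by apply: near_withinW => r rT; have [] := wc _ rT.
  - by apply: near_withinW => r rT; have [? _ _] := fw _ rT; exact: inL2D.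
  - exact: inL2D.
  - have /cvg_withinP fc' := fc; apply/cvg_withinP => e e0.
    have [|d d0 hd] := fc' (e / 4); first by rewrite divr_gt0.
    exists d => // r Sr rd; have := hd r Sr rd.
    have rT : r \in `[0, T] by [].
    rewrite !subr0 !ger0_norm ?sqint_ge0// => h.
    have [frL _ _] := fw _ rT.
    have -> : (fun x => f r x + f r x - (f t x + f t x)) =
       (fun x => 1 * (f r x - f t x) + 1 * (f r x - f t x)).
      by apply/funext => x; ring.
    apply: le_trans (sqint_le_lin _ _ (inL2B frL fL) (inL2B frL fL)) _.
    lra.
apply: (@cvg_weighted_product _ _ _ _ _ f _ _ _ M) => //.
- by apply: near_withinW => r rT; have [] := PM _ rT.
- move=> e e0; apply: (@near_within_ball _ _ _ (e / (M + 1))).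
    by rewrite divr_gt0// ltr_wpDl.
  move=> r rT re x Hx; have [_ h _] := lip r x rT Hx.
  by apply: le_trans h _; apply: le_trans (small _ e0); exact: ler_wpM2l.
- by apply: near_withinW => r rT; have [] := fw _ rT.
- by apply: near_withinW => r rT; have [] := fw _ rT.
Qed.

End squareIntegrableCurves.

(** * Smooth functions flat at the ends of their support *)

Section smoothFunctions.
Context {R : realType}.
Implicit Types (f g : R -> R) (a b x y : R) (P Q : {poly R}).

(** This gives the derivative of a flat function at the points where it is
    extended by zero, where the formula for the derivative is of no use. *)
Lemma is_derive_quadratic f x (C d : R) : 0 < d ->
  (forall y, `|y - x| < d -> `|f y| <= C * (y - x) ^+ 2) ->
  is_derive x 1 f 0.
Proof.
move=> d0 fC.
have f0 : f x = 0.
  apply/eqP; rewrite -normr_le0 (le_trans (fC x _)) ?subrr ?normr0//.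
  by rewrite expr0n mulr0.
suff h : k^-1 *: (f (k *: 1 + x) - f x) @[k --> 0^'] --> (0 : R).
  by apply: DeriveDef; [apply/cvg_ex; exists 0|apply: cvg_lim].
apply/cvgrPdist_le => e e0; near=> k.
have k0 : k != 0 by near: k; exact: nbhs_dnbhs_neq.
have kd : `|k| < d by near: k; exact: dnbhs0_lt.
have ke : `|k| <= e / (`|C| + 1).
  by near: k; apply: dnbhs0_le; rewrite divr_gt0// ltr_wpDl.
rewrite [k *: 1](_ : _ = k); last by rewrite /GRing.scale /= mulr1.
rewrite [_ *: _](_ : _ = f (k + x) / k); last by rewrite /GRing.scale /= f0 subr0 mulrC.
rewrite sub0r normrN normrM normfV ler_pdivrMr ?normr_gt0//.
have := fC (k + x); rewrite addrK => /(_ kd) h; apply: (le_trans h).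
rewrite -real_normK ?num_real// expr2 mulrA ler_pM2r ?normr_gt0//.
apply: (@le_trans _ _ ((`|C| + 1) * `|k|)).
  by apply: ler_wpM2r => //; rewrite (le_trans (ler_norm _))// lerDl.
by rewrite mulrC -ler_pdivlMr// ltr_wpDl.
Unshelve. all: by end_near. Qed.

Lemma expRN_le (k : nat) y : 0 <= y -> y ^+ k * expR (- y) <= k`!%:R.
Proof.
move=> y0; rewrite expRN ler_pdivrMr ?expR_gt0// mulrC -ler_pdivrMr ?ltr0n ?fact_gt0//.
case: k => [|k].
  by rewrite expr0 fact0 divr1 (le_trans _ (expR_ge1Dx _))// lerDl.
have := expR_ge1Dxn k y0; apply: le_trans; by rewrite lerDr.
Qed.

(** The functions $P Q^{-m} e^{-1/Q}$, extended by zero to $Q \le 0$. For a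
    fixed $Q$ this family is closed under differentiation, so that one derivative
    formula gives smoothness of every order. *)
Definition flat P Q (m : nat) x : R :=
  if 0 < Q.[x] then P.[x] * (Q.[x])^-1 ^+ m * expR (- (Q.[x])^-1) else 0.

(** The exponential absorbs $m + 2$ powers of $1/Q$, which leaves a factor
    $Q^2$. *)
Lemma flat_le P Q m x : `|flat P Q m x| <= (m.+2)`!%:R * `|P.[x]| * Q.[x] ^+ 2.
Proof.
rewrite /flat; case: ifPn => [q0|_]; last first.
  by rewrite normr0 mulr_ge0 ?sqr_ge0// mulr_ge0 ?ler0n.
rewrite !normrM normrX normfV (gtr0_norm q0) (gtr0_norm (expR_gt0 _)).
rewrite (mulrC _`!%:R) -!mulrA ler_wpM2l//.
have V0 : 0 <= (Q.[x])^-1 by rewrite invr_ge0 ltW.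
have q20 : 0 < Q.[x] ^+ 2 by rewrite exprn_gt0.
have h : (Q.[x])^-1 ^+ m.+2 * expR (- (Q.[x])^-1) * Q.[x] ^+ 2 <= (m.+2)`!%:R * Q.[x] ^+ 2.
  by rewrite ler_pM2r// expRN_le.
apply: le_trans h.
rewrite !exprS; set V := (Q.[x])^-1; set E := expR _.
have VQ : V * Q.[x] = 1 by rewrite /V mulVf// gt_eqF.
rewrite le_eqVlt; apply/orP; left; apply/eqP.
transitivity ((V * Q.[x]) ^+ 2 * (V ^+ m * E)); last by rewrite expr0; ring.
by rewrite VQ expr1n mul1r.
Qed.

Lemma horner_bounded P x : exists2 C, 0 <= C & forall y, `|y - x| < 1 -> `|P.[y]| <= C.
Proof.
have := @continuous_horner R P.
move=> cP.
have : compact `[x - 1, x + 1] by exact: segment_compact.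
move=> /(@continuous_compact _ _ (horner P) `[x - 1, x + 1]) => /(_ _)/compact_bounded.
case; first by apply: continuous_subspaceT.
move=> M [_ hM]; exists (`|M| + 1) => [|y yx]; first by rewrite addr_ge0.
apply: (hM (`|M| + 1)); first by rewrite (le_lt_trans (ler_norm _))// ltrDl.
exists y => //=; rewrite in_itv /=; move: yx; rewrite ltr_norml => /andP[? ?].
by apply/andP; split; lra.
Qed.

(** Where $Q(x) \le 0$, the positive part of $Q$ near $x$ is at most
    $|Q(y) - Q(x)| = O(|y - x|)$, hence the function is $O((y - x)^2)$ and its
    derivative vanishes. Elsewhere this is the usual computation. *)
Lemma is_derive_flat P Q m x :
  is_derive x 1 (flat P Q m)
   (flat (P^`() * Q ^+ 2 - m%:R *: (P * Q^`() * Q) + P * Q^`())%R Q m.+2 x).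
Proof.
have [q0|q0] := ltP 0 Q.[x]; last first.
  rewrite {2}/flat ltNge q0 /=.
  have [C C0 PC] := horner_bounded P x.
  have /factor_theorem[S QS] : root (Q - (Q.[x])%:P) x.
    by rewrite /root hornerD hornerN hornerC subrr.
  have [D D0 SD] := horner_bounded S x.
  apply: (@is_derive_quadratic _ _ ((m.+2)`!%:R * C * D ^+ 2) 1) => // y yx.
  have [qy|qy] := ltP 0 Q.[y]; last first.
    by rewrite /flat ltNge qy /= normr0 mulr_ge0 ?sqr_ge0// mulr_ge0 ?sqr_ge0// mulr_ge0 ?ler0n.
  apply: (le_trans (flat_le _ _ _ _)).
  rewrite -[leRHS]mulrA -exprMn; apply: ler_pM.
  - by rewrite mulr_ge0.
  - exact: sqr_ge0.
  - by rewrite ler_wpM2l// PC.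
  rewrite -[leRHS]real_normK ?num_real// ler_sqr ?nnegrE//; last exact: ltW.
  have := congr1 (fun p => p.[y]) QS.
  rewrite hornerD hornerN hornerC hornerM hornerXsubC => E.
  have : Q.[y] <= Q.[y] - Q.[x] by rewrite lerDl oppr_ge0.
  move=> /le_trans; apply; rewrite E (le_trans (ler_norm _))// !normrM.
  by rewrite ler_wpM2r// (ger0_norm D0); exact: SD.
have q1 : Q.[x] != 0 by rewrite gt_eqF.
pose V := fun y => (Q.[y])^-1.
have dV : is_derive x 1 V (- Q.[x] ^- 2 *: Q^`().[x]).
  by apply: is_deriveV => //; exact: is_derive_poly.
have dVm := is_deriveX m dV.
have dE : is_derive x 1 (expR \o (- V)) (expR (- V x) * - (- Q.[x] ^- 2 *: Q^`().[x])).
  exact: is_derive1_comp.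
have dPV := is_deriveM (is_deriveM (is_derive_poly P x) dVm) dE.
have nq : \forall y \near x, 0 < Q.[y].
  have /cvgrPdist_lt := @continuous_horner R Q x => /(_ _ q0).
  apply: filterS => y; rewrite ltr_norml => /andP[_]; lra.
apply: (near_eq_is_derive (f := ((horner P * V ^+ m) * (expR \o (- V))))).
  near=> y; rewrite /flat ifT; last by near: y.
  by rewrite /= !fctE /V.
apply: (is_derive_eq dPV).
rewrite /flat q0 !hornerE !fctE /= /GRing.scale /= -/(V x).
rewrite -exprVn -/(V x).
set E := expR (- V x).
have VQ : V x * Q.[x] = 1 by rewrite /V mulVf.
case: m dVm dPV => [|m] _ _.
  rewrite /= expr0 mulr0n !mul0r !mulr0 subr0 !mulr1 ?mul1r.
  transitivity ((V x * Q.[x]) ^+ 2 * P^`().[x] * E + P.[x] * Q^`().[x] * V x ^+ 2 * E).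
    by rewrite VQ; ring.
  ring.
rewrite /=.
transitivity ((V x * Q.[x]) ^+ 2 * P^`().[x] * V x ^+ m.+1 * E + P.[x] * Q^`().[x] * V x ^+ m.+3 * E
  - (V x * Q.[x]) * m.+1%:R * P.[x] * Q^`().[x] * V x ^+ m.+2 * E).
  by rewrite VQ !exprS; ring.
transitivity ((P^`().[x] * Q.[x] * Q.[x] - m.+1%:R * P.[x] * Q^`().[x] * Q.[x] +
   P.[x] * Q^`().[x]) * V x ^+ m.+3 * E); last by rewrite exprS mulrA.
by rewrite !exprS; ring.
Unshelve. all: by end_near. Qed.

Definition smooth f := forall (n : nat) x, derivable (f^`(n))%classic x 1.

Lemma smooth_flat P Q m : smooth (flat P Q m).
Proof.
move=> n; elim: n P m => [|n IH] P m x.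
  by rewrite derive1n0; have [] := is_derive_flat P Q m x.
rewrite derive1Sn.
have -> : ((flat P Q m)^`())%classic = flat (P^`() * Q ^+ 2 - m%:R *: (P * Q^`() * Q) + P * Q^`())%R Q m.+2.
  apply/funext => y; rewrite derive1E.
  by have [_] := is_derive_flat P Q m y.
exact: IH.
Qed.

Lemma smooth_derive f : smooth f -> smooth (f^`())%classic.
Proof. by move=> sf n x; rewrite -derive1Sn; exact: sf. Qed.

Lemma smooth_lin f g a b : smooth f -> smooth g -> smooth (fun x => a * f x + b * g x).
Proof.
move=> + + n; elim: n f g => [|n IH] f g sf sg x.
  rewrite derive1n0; have := sf 0%N x; have := sg 0%N x; rewrite !derive1n0 => dg df.
  move: df dg => /derivableP df /derivableP dg.
  by have [] := is_deriveD (is_deriveZ a df) (is_deriveZ b dg).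
rewrite derive1Sn.
have -> : ((fun x => a * f x + b * g x)^`())%classic = (fun x => a * (f^`())%classic x + b * (g^`())%classic x).
  apply/funext => y; rewrite !derive1E.
  have := sf 0%N y; have := sg 0%N y; rewrite !derive1n0 => /derivableP dg /derivableP df.
  have d1 := is_deriveD (is_deriveZ a df) (is_deriveZ b dg).
  by have [_ <-] := d1.
by apply: IH; exact: smooth_derive.
Qed.

Lemma smooth_continuous f : smooth f -> continuous f.
Proof.
move=> sf x; apply/differentiable_continuous/derivable1_diffP.
by have := sf 0%N x; rewrite derive1n0.
Qed.

End smoothFunctions.

(** * Absolutely continuous functions on the half line *)

Section primitives.
Context {R : realType}.
Local Notation mu := (@lebesgue_measure R).
Local Notation H := (@halfline R).
Implicit Types (f g F G : R -> R) (x y : R).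

Let mitv (i : interval R) : measurable ([set` i] : set (measurableTypeR R)).
Proof. exact: measurable_itv. Qed.
Hint Resolve mitv : core.

Lemma Rintegral_below_above f x : mu.-integrable setT (EFin \o f) ->
  \int[mu]_y f y = \int[mu]_(y in `]-oo, x]) f y + \int[mu]_(y in `[x, +oo[) f y.
Proof.
move=> fi.
have fiS A : measurable (A : set (measurableTypeR R)) -> mu.-integrable A (EFin \o f).
  by move=> mA; apply: integrableS fi.
rewrite -Rintegral_itv_bndo_bndc; last exact: fiS.
rewrite -Rintegral_setU//.
- congr Rintegral; apply/seteqP; split => // y _ /=.
  by rewrite !in_itv /= andbT; case: ltP => _; [left|right].
- by apply: fiS; exact: measurableU.
- apply/disj_setPRL => y /=; rewrite !in_itv /= andbT => xy.
  by apply/negP; rewrite -leNgt.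
Qed.

(** The plane is split along the diagonal: each of the two terms integrates
    $f(x) g(y)$ over one of the half planes. *)
Lemma Fubini_primitives f g :
  mu.-integrable setT (EFin \o f) -> mu.-integrable setT (EFin \o g) ->
  [/\ mu.-integrable setT (EFin \o (fun x => f x * \int[mu]_(y in `]-oo, x]) g y)),
      mu.-integrable setT (EFin \o (fun y => g y * \int[mu]_(x in `]-oo, y]) f x)) &
   \int[mu]_x (f x * \int[mu]_(y in `]-oo, x]) g y) +
   \int[mu]_y (g y * \int[mu]_(x in `]-oo, y]) f x) =
   (\int[mu]_x f x) * (\int[mu]_y g y)].
Proof.
move=> fi gi.
have fiS A : measurable (A : set (measurableTypeR R)) -> mu.-integrable A (EFin \o f).
  by move=> mA; apply: integrableS fi.
have giS A : measurable (A : set (measurableTypeR R)) -> mu.-integrable A (EFin \o g).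
  by move=> mA; apply: integrableS gi.
have mf : measurable_fun setT f by apply/measurable_EFinP; exact: measurable_int fi.
have mg : measurable_fun setT g by apply/measurable_EFinP; exact: measurable_int gi.
pose h (z : R * R) := (if z.2 <= z.1 then f z.1 * g z.2 else 0)%:E.
have mh : measurable_fun setT h.
  apply/measurable_EFinP; apply: measurable_fun_ifT => //.
    by apply: measurable_fun_ler; [exact: measurable_snd|exact: measurable_fst].
  by apply: measurable_funM;
    [apply: (measurableT_comp mf)|apply: (measurableT_comp mg)].
have FE x : (\int[mu]_y h (x, y) = (f x * \int[mu]_(y in `]-oo, x]) g y)%:E)%E.
  transitivity (\int[mu]_(y in `]-oo, x]) ((f x)%:E * (g y)%:E))%E.
    rewrite [RHS]integral_mkcond; apply: eq_integral => y _.
    rewrite /h /= patchE /=; case: ifPn => yx.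
      by rewrite mem_set//= in_itv.
    by rewrite memNset//= in_itv /= (negbTE yx).
  rewrite integralZl//; last exact: giS.
  by rewrite EFinM /Rintegral fineK//; apply: integrable_fin_num => //; exact: giS.
have GE y : (\int[mu]_x h (x, y) = (g y * \int[mu]_(x in `[y, +oo[) f x)%:E)%E.
  transitivity (\int[mu]_(x in `[y, +oo[) ((g y)%:E * (f x)%:E))%E.
    rewrite [RHS]integral_mkcond; apply: eq_integral => x _.
    rewrite /h /= patchE /=; case: ifPn => yx.
      by rewrite mem_set//= ?in_itv /= ?yx// mulrC.
    by rewrite memNset//= in_itv /= (negbTE yx).
  rewrite integralZl//; last exact: fiS.
  by rewrite EFinM /Rintegral fineK//; apply: integrable_fin_num => //; exact: fiS.
have ih : (mu \x mu)%E.-integrable setT h.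
  apply/integrable12ltyP => //.
  apply: (@le_lt_trans _ _ (\int[mu]_x (`|f x|%:E * \int[mu]_y `|(g y)%:E|)))%E.
    apply: ge0_le_integral => //.
    - by move=> x _; exact: integral_ge0.
    - apply: (@measurable_fun_fubini_tonelli_F _ _ _ _ _ mu (abse \o h)) => //.
        exact: measurableT_comp.
      by move=> z; exact: abse_ge0.
    - apply: emeasurable_funM => //.
      by apply/measurable_EFinP; exact: measurableT_comp.
    - move=> x _; rewrite -ge0_integralZl//; last exact/measurableT_comp/measurable_EFinP.
      apply: ge0_le_integral => //.
      + apply: measurableT_comp => //.
        by apply: (measurableT_comp mh); exact: measurable_pair1.
      + apply: emeasurable_funM => //.
        by apply: measurableT_comp => //; exact/measurable_EFinP.
      + move=> y _; rewrite /h /=; case: ifPn => _; rewrite lee_fin ?normrM//.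
        by rewrite normr0 mulr_ge0.
  have [_ fy] := integrableP _ _ _ fi; have [_ gy] := integrableP _ _ _ gi.
  rewrite ge0_integralZr//.
  - by apply: lte_mul_pinfty => //; [exact: integral_ge0|rewrite ge0_fin_numE//; exact: integral_ge0].
  - by apply/measurable_EFinP; exact: measurableT_comp.
  - exact: integral_ge0.
have eF : fubini_F mu h = EFin \o (fun x => f x * \int[mu]_(y in `]-oo, x]) g y).
  by apply/funext => x; rewrite /fubini_F FE.
have eG : fubini_G mu h = EFin \o (fun y => g y * \int[mu]_(x in `[y, +oo[) f x).
  by apply/funext => x; rewrite /fubini_G GE.
have iF : mu.-integrable setT (EFin \o (fun x => f x * \int[mu]_(y in `]-oo, x]) g y)).
  by rewrite -eF; exact: (integrable_fubini_F ih).
have mG : measurable_fun setT (EFin \o (fun y => g y * \int[mu]_(x in `[y, +oo[) f x)).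
  by rewrite -eG; exact: (measurable_fubini_G ih).
have iG : mu.-integrable setT (EFin \o (fun y => g y * \int[mu]_(x in `[y, +oo[) f x)).
  have ig' : mu.-integrable setT (EFin \o (fun y => (\int[mu]_x `|f x|) * `|g y|)).
    by apply: integrable_scale => //; exact: integrable_norm.
  apply: le_integrable ig' => //.
  move=> y _ /=; rewrite lee_fin !normrM normr_id mulrC ler_wpM2r//.
  apply: le_trans (le_normr_Rintegral _ (fiS _ _)) _ => //.
  apply: le_trans (ler_norm _); rewrite /Rintegral fine_le//.
  - by apply: integrable_fin_num => //; exact: (integrable_norm (fiS _ (mitv _))).
  - by apply: integrable_fin_num => //; exact: (integrable_norm fi).
  - apply: ge0_subset_integral => //.
    by apply/measurable_EFinP; exact: measurableT_comp.
have E : (fun y => g y * \int[mu]_(x in `]-oo, y]) f x) =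
   (fun y => (\int[mu]_x f x) * g y - g y * \int[mu]_(x in `[y, +oo[) f x).
  by apply/funext => y; rewrite (Rintegral_below_above y fi); ring.
have i2 : mu.-integrable setT (EFin \o (fun y => (\int[mu]_x f x) * g y)).
  exact: integrable_scale.
split => //; first by rewrite E; apply: integrable_sub.
rewrite E RintegralB// RintegralZl//.
have FF : \int[mu]_x (f x * \int[mu]_(y in `]-oo, x]) g y) =
    \int[mu]_y (g y * \int[mu]_(x in `[y, +oo[) f x).
  have : (\int[mu]_x fubini_F mu h x = \int[mu]_y fubini_G mu h y)%E := Fubini ih.
  by rewrite eF eG /Rintegral => ->.
by rewrite FF addrC subrK.
Qed.

(** Absolute continuity in integral form, which avoids derivatives that exist
    almost everywhere only. *)
Definition primitive f F := forall x, 0 <= x ->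
  mu.-integrable `]0, x] (EFin \o f) /\ F x = F 0 + \int[mu]_(y in `]0, x]) f y.

(** The product rule for absolutely continuous functions. It follows from
    splitting a square along its diagonal, with [f] and [g] cut off outside
    $(0, b]$. *)
Lemma primitiveM f g F G : primitive f F -> primitive g G ->
  primitive (fun x => f x * G x + g x * F x) (fun x => F x * G x).
Proof.
move=> fF gG b b0; have [fi Fb] := fF _ b0; have [gi Gb] := gG _ b0.
have fiT : mu.-integrable setT (EFin \o (f \_ `]0, b])).
  by rewrite -restrict_EFin; apply/(integrable_mkcond _ (mitv _)).
have giT : mu.-integrable setT (EFin \o (g \_ `]0, b])).
  by rewrite -restrict_EFin; apply/(integrable_mkcond _ (mitv _)).
have [i1 i2 e12] := Fubini_primitives fiT giT.
have below k x : x \in `]0, b] -> \int[mu]_(y in `]-oo, x]) (k \_ `]0, b]) y =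
    \int[mu]_(y in `]0, x]) k y.
  move=> xb; rewrite Rintegral_mkcond [RHS]Rintegral_mkcond; congr Rintegral.
  apply/funext => y; rewrite !patchE /= !mem_setE !in_itv /=.
  case: (leP y x) => yx; last by rewrite andbF.
  by rewrite (le_trans yx) ?(itvP xb)//; case: ifP.
have on k K x : primitive k K -> x \in `]0, b] ->
    \int[mu]_(y in `]-oo, x]) (k \_ `]0, b]) y = K x - K 0.
  move=> kK xb; rewrite below//; have [|_ ->] := kK x; first by rewrite (itvP xb).
  by rewrite addrAC subrr add0r.
have e1 : (fun x => (f \_ `]0, b]) x * \int[mu]_(y in `]-oo, x]) (g \_ `]0, b]) y) =
    (fun x => f x * (G x - G 0)) \_ `]0, b].
  apply/funext => x; rewrite !patchE; case: ifPn => [|_]; last by rewrite mul0r.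
  by rewrite inE => xb; rewrite (on _ _ _ gG).
have e2 : (fun x => (g \_ `]0, b]) x * \int[mu]_(y in `]-oo, x]) (f \_ `]0, b]) y) =
    (fun x => g x * (F x - F 0)) \_ `]0, b].
  apply/funext => x; rewrite !patchE; case: ifPn => [|_]; last by rewrite mul0r.
  by rewrite inE => xb; rewrite (on _ _ _ fF).
rewrite e1 -restrict_EFin in i1; rewrite e2 -restrict_EFin in i2.
move/(integrable_mkcond _ (mitv _)) : i1 => i1.
move/(integrable_mkcond _ (mitv _)) : i2 => i2.
rewrite e1 e2 -!Rintegral_mkcond in e12.
have i3 : mu.-integrable `]0, b] (EFin \o (fun x => G 0 * f x)) by exact: integrable_scale.
have i4 : mu.-integrable `]0, b] (EFin \o (fun x => F 0 * g x)) by exact: integrable_scale.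
have E : (fun x => f x * G x + g x * F x) = (fun x => (f x * (G x - G 0) + G 0 * f x) +
   (g x * (F x - F 0) + F 0 * g x)) by apply/funext => x; ring.
have i13 := integrable_add (mitv _) i1 i3.
have i24 := integrable_add (mitv _) i2 i4.
split; first by rewrite E; exact: integrable_add.
rewrite E RintegralD// RintegralD// [X in _ + (_ + X)]RintegralD// !RintegralZl//.
have Gb' : \int[mu]_(x in `]0, b]) g x = G b - G 0 by rewrite Gb; ring.
have Fb' : \int[mu]_(x in `]0, b]) f x = F b - F 0 by rewrite Fb; ring.
rewrite Gb' Fb' in e12 *.
transitivity (F 0 * G 0 + ((F b - F 0) * (G b - G 0) + G 0 * (F b - F 0) + F 0 * (G b - G 0))); first by ring.
by rewrite -e12; ring.
Qed.

Definition locally_integrable0 f :=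
  forall x, 0 <= x -> mu.-integrable `]0, x] (EFin \o f).

Lemma primitive_integral f : locally_integrable0 f ->
  primitive f (fun x => \int[mu]_(y in `]0, x]) f y).
Proof.
move=> fi x x0; split; first exact: fi.
have -> : `]0, 0]%classic = set0 :> set R.
  apply/seteqP; split=> // y /=; rewrite in_itv /= => /andP[/lt_le_trans h /h].
  by rewrite ltxx.
by rewrite Rintegral_set0 add0r.
Qed.

Lemma continuous_locally_integrable f : {within `[0, +oo[, continuous f} ->
  locally_integrable0 f.
Proof.
move=> cf x x0.
have : mu.-integrable `[0, x] (EFin \o f).
  apply: continuous_compact_integrable; first exact: segment_compact.
  by apply: continuous_subspaceW cf => y /=; rewrite !in_itv /= andbT => /andP[].
by apply: integrableS => // y /=; rewrite !in_itv /= => /andP[/ltW -> ->].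
Qed.

Lemma inL2_locally_integrable f : inL2 f -> locally_integrable0 f.
Proof.
move=> /inL2P[mf fi] x x0.
have sub : `]0, x] `<=` H.
  by move=> y; rewrite /halfline /= !in_itv /= andbT => /andP[].
have mH := @measurable_halfline R.
have i1 : mu.-integrable `]0, x] (EFin \o (cst 1 : R -> R)).
  by apply: continuous_locally_integrable => //; exact: continuous_subspaceT (@cst_continuous _ _ _).
have i2 : mu.-integrable `]0, x] (EFin \o (fun x => f x ^+ 2)) by exact: integrableS fi.
apply: le_integrable (integrable_add (mitv _) i1 i2) => //.
  by apply/measurable_EFinP; exact: measurable_funS mf.
move=> y _ /=; rewrite lee_fin [leRHS]ger0_norm ?addr_ge0 ?sqr_ge0//.
rewrite -[f y ^+ 2]real_normK ?num_real//.
by have := sqr_ge0 (`|f y| - 1); have := normr_ge0 (f y); nra.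
Qed.

Lemma primitive_derive f F :
  (forall x, 0 <= x -> is_derive x 1 F (f x)) ->
  (forall x, 0 <= x -> {for x, continuous f}) -> primitive f F.
Proof.
move=> dF cf x; rewrite le_eqVlt => /predU1P[<-|x0].
  have -> : `]0, 0]%classic = set0 :> set R.
    apply/seteqP; split=> // y /=; rewrite in_itv /= => /andP[/lt_le_trans h /h].
    by rewrite ltxx.
  by rewrite Rintegral_set0 addr0; split => //; exact: integrable_set0.
have cF y : 0 <= y -> {for y, continuous F}.
  move=> y0; apply/differentiable_continuous/derivable1_diffP.
  by have [] := dF _ y0.
have cf' : {within `[0, x], continuous f}.
  apply/continuous_in_subspaceT => y; rewrite inE /= in_itv /= => /andP[y0 _].
  exact: cf.
have fi : mu.-integrable `[0, x] (EFin \o f).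
  by apply: continuous_compact_integrable => //; exact: segment_compact.
have fi' : mu.-integrable `]0, x] (EFin \o f).
  by apply: integrableS fi => // y /=; rewrite !in_itv /= => /andP[/ltW -> ->].
split => //.
rewrite Rintegral_itv_obnd_cbnd// /Rintegral (continuous_FTC2 x0 cf' (F := F)).
- by rewrite -EFinB /= addrC subrK.
- split.
  + by move=> y; rewrite in_itv /= => /andP[/ltW y0 _]; have [] := dF _ y0.
  + by apply: cvg_at_right_filter; exact: cF.
  + by apply: cvg_at_left_filter; apply: cF; exact: ltW.
- move=> y; rewrite in_itv /= => /andP[/ltW y0 _]; rewrite derive1E.
  by have [_] := dF _ y0.
Qed.

Lemma primitive_continuous f F : primitive f F -> {within `[0, +oo[, continuous F}.
Proof.
move=> fF; apply/subspace_continuousP => x; rewrite /= in_itv /= andbT => x0.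
have x10 : 0 <= x + 1 by rewrite addr_ge0.
have [fi _] := fF _ x10.
have fi' : mu.-integrable `[0, x + 1] (EFin \o f).
  have /integrableP[mf ifin] := fi.
  apply/integrableP; split; last first.
    rewrite -integral_itv_obnd_cbnd//; exact: measurableT_comp.
  exact/emeasurable_fun_itv_obnd_cbndP.
have /subspace_continuousP/(_ x) := parameterized_integral_continuous x10 fi'.
rewrite /= in_itv /= x0 lerDl ler01 => /(_ isT) /cvg_withinP c.
apply/cvg_withinP => e e0; have [d d0 hd] := c _ e0.
exists (Num.min d 1); first by rewrite lt_min d0 ltr01.
move=> r /=; rewrite in_itv /= andbT => r0; rewrite lt_min => /andP[rd r1].
have rx1 : r <= x + 1 by move: r1; rewrite ltr_norml => /andP[_]; lra.
have val y : 0 <= y -> y <= x + 1 -> F y = F 0 + parameterized_integral mu 0 y f.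
  move=> y0 yx; have [_ ->] := fF _ y0; congr (_ + _).
  rewrite /parameterized_integral -Rintegral_itv_obnd_cbnd//.
  apply: integrableS fi' => // z /=; rewrite !in_itv /= => /andP[z0 zy].
  by rewrite (ltW z0) (le_trans zy).
rewrite -[from_subspace _ F x]/(F x) (val r)// (val x)// ?lerDl//.
rewrite opprD addrACA subrr add0r; apply: hd => //=.
by rewrite in_itv /= r0.
Qed.

Lemma integrable_tail f e : mu.-integrable H (EFin \o f) -> 0 < e ->
  exists n : nat, \int[mu]_(y in H `&` `]n%:R, +oo[) `|f y| <= e.
Proof.
move=> fi e0.
have mH := @measurable_halfline R.
have ai : mu.-integrable H (EFin \o (fun y => `|f y|)) by exact: integrable_norm.
pose f_ n := (EFin \o (fun y => `|f y|)) \_ `]n%:R, +oo[.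
have mf_ n : measurable_fun H (f_ n).
  apply/(measurable_restrict _ (mitv _) mH).
  by apply: measurable_funS (measurable_int _ ai) => //; apply: subIsetl.
have f_0 x : H x -> f_ n x @[n --> \oo] --> (0%E : \bar R).
  move=> Hx; apply: cvg_near_cst; near=> n.
  rewrite /f_ patchE memNset//.
  rewrite /= in_itv /= andbT; apply/negP; rewrite -leNgt.
  by near: n; exact: nbhs_infty_ger.
have f_le n x : H x -> (`|f_ n x| <= (EFin \o (fun y => `|f y|%R)) x)%E.
  move=> Hx; rewrite /f_ patchE; case: ifPn => _ /=.
    by rewrite normr_id.
  by rewrite normr0 lee_fin.
have fin x : H x -> (EFin \o (fun y => `|f y|)) x \is a fin_num by [].
have := @dominated_cvg _ _ _ mu H mH f_ (cst 0%E) (EFin \o (fun y => `|f y|)) mf_ f_0 fin ai f_le.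
rewrite integral0 => c.
have /fine_cvgP[_ /cvgrPdist_le /(_ _ e0)[n _ /(_ n (leqnn n))]] := c.
rewrite sub0r normrN => h; exists n.
rewrite Rintegral_mkcondr /Rintegral.
have -> : (\int[mu]_(x in H) ((fun y => `|f y|) \_ `]n%:R, +oo[ x)%:E = \int[mu]_(x in H) f_ n x)%E.
  by apply: eq_integral => x _; rewrite /f_ !patchE; case: ifPn.
exact: le_trans (ler_norm _) h.
Unshelve. all: by end_near. Qed.

(** [F] tends at infinity to $L = F(0) + \int f$, because the tails of the
    integral of [f] are small. If $L \neq 0$, then $|F| \ge |L|/2$ on a half line
    of infinite measure, and [F] is not integrable. *)
Lemma primitive_integrable f F : primitive f F ->
  mu.-integrable H (EFin \o f) -> mu.-integrable H (EFin \o F) ->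
  F 0 = - \int[mu]_(y in H) f y.
Proof.
move=> fF fi Fi.
have mH := @measurable_halfline R.
apply/eqP; rewrite -addr_eq0; apply: contraT => L0.
set L := F 0 + _ in L0.
have l0 : 0 < `|L| / 2 by rewrite divr_gt0// normr_gt0.
have [n hn] := integrable_tail fi l0.
pose A := H `&` `]n%:R, +oo[.
have mA : measurable (A : set (measurableTypeR R)) by exact: measurableI.
have AE : A = `]n%:R, +oo[%classic.
  apply/seteqP; split=> x /=; rewrite /A /halfline /= ?in_itv /= ?andbT; first by case.
  by move=> nx; split => //; rewrite (le_lt_trans _ nx).
have large x : A x -> `|L| / 2 <= `|F x|.
  move=> Ax; have [Hx nx] := Ax.
  rewrite /halfline /= in_itv /= andbT in Hx.
  have [_ Fx] := fF _ (ltW Hx).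
  have spl : \int[mu]_(y in H) f y = \int[mu]_(y in `]0, x]) f y + \int[mu]_(y in `]x, +oo[) f y.
    rewrite -Rintegral_setU//.
    - congr Rintegral; apply/seteqP; split => y; rewrite /halfline /= !in_itv /= !andbT.
        by move=> ->; case: leP => _; [left|right].
      by case=> [/andP[]//|]; exact: lt_trans.
    - apply: integrableS fi => //; first exact: measurableU.
      move=> y /=; rewrite /halfline /= !in_itv /= !andbT.
      by case=> [/andP[]//|]; exact: lt_trans.
    - apply/disj_setPRL => y /=; rewrite !in_itv /= andbT => xy.
      by apply/negP; rewrite negb_and -ltNge xy orbT.
  have tl : `|\int[mu]_(y in `]x, +oo[) f y| <= `|L| / 2.
    have fix_ : mu.-integrable `]x, +oo[ (EFin \o f).
      apply: integrableS fi => //.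
      by move=> y /=; rewrite /halfline /= !in_itv /= !andbT; exact: lt_trans.
    apply: le_trans (le_normr_Rintegral _ fix_) _ => //.
    apply: le_trans hn.
    rewrite /Rintegral fine_le//.
    - by apply: integrable_fin_num => //; exact: (integrable_norm fix_).
    - apply: integrable_fin_num => //; apply: (@integrable_norm _ _ _ mu _ f).
      by apply: integrableS fi => //; exact: subIsetl.
    apply: ge0_subset_integral => //.
    - apply/measurable_EFinP/measurableT_comp => //; apply/measurable_EFinP.
      by apply: measurable_funS (measurable_int _ fi) => //; exact: subIsetl.
    - move=> y; rewrite -/A AE /= !in_itv /= !andbT; apply: lt_trans.
      by move: nx; rewrite /= in_itv /= andbT.
  have -> : F x = L - \int[mu]_(y in `]x, +oo[) f y by rewrite /L spl Fx; ring.
  apply: le_trans (lerB_dist _ _).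
  move: tl; set I := `|\int[_]_(_ in _) _|; move: I => I; set K := `|L|; move: K => K; lra.
have iA : mu.-integrable A (EFin \o cst (`|L| / 2)).
  apply: (@le_integrable _ _ _ mu A mA _ (EFin \o F)).
  - by apply/measurable_EFinP; exact: measurable_cst.
  - by move=> x Ax; rewrite /= lee_fin ger0_norm ?(ltW l0)//; exact: large.
  - by apply: integrableS Fi => //; exact: subIsetl.
have muA : mu A = +oo%E by rewrite AE lebesgue_measure_itv /= ltry addye.
have e1 : (\int[mu]_(x in A) (EFin \o cst (`|L| / 2)%R) x = (`|L| / 2)%:E * mu A)%E.
  exact: (@integral_cst _ _ _ mu A mA (`|L| / 2)%:E).
have := integrable_lty mA iA; rewrite e1 muA.
by rewrite gt0_muley ?lte_fin// ltxx.
Qed.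

End primitives.

(** * The du Bois-Reymond lemma *)

Section duBoisReymond.
Context {R : realType}.
Local Notation mu := (@lebesgue_measure R).
Local Notation H := (@halfline R).
Implicit Types (f g h p F G : R -> R) (a b x y : R).

Let mitv (i : interval R) : measurable ([set` i] : set (measurableTypeR R)).
Proof. exact: measurable_itv. Qed.
Hint Resolve mitv : core.
Let mH := @measurable_halfline R.

(** The exponent is $-1/((n + 1)(x - a)(b - x))$ on $(a, b)$: as [n] grows,
    these test functions increase to the indicator of $(a, b)$. *)
Definition bumpfun a b (n : nat) : R -> R :=
  flat 1 (n.+1%:R *: (('X - a%:P) * (b%:P - 'X))) 0.

Lemma bumpE a b n x : bumpfun a b n x =
  if 0 < n.+1%:R * ((x - a) * (b - x))
  then expR (- (n.+1%:R * ((x - a) * (b - x)))^-1) else 0.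
Proof. by rewrite /bumpfun /flat !hornerE /= ?mul1r. Qed.

Lemma bump_in a b x n : a < b ->
  (0 < n.+1%:R * ((x - a) * (b - x))) = (a < x < b).
Proof.
move=> ab; rewrite pmulr_rgt0 ?ltr0n//.
apply/idP/idP => [h|/andP[ax xb]]; last by rewrite mulr_gt0 ?subr_gt0.
by apply/andP; split; rewrite ltNge; apply/negP => k; nra.
Qed.

Lemma bump_ge0 a b n x : 0 <= bumpfun a b n x.
Proof. by rewrite bumpE; case: ifP => // _; exact: expR_ge0. Qed.

Lemma bump_le1 a b n x : bumpfun a b n x <= 1.
Proof.
rewrite bumpE; case: ifP => // h; rewrite -[leRHS]expR0 ler_expR oppr_le0 invr_ge0.
exact: ltW.
Qed.

Lemma bump_out a b n x : a < b -> x \notin `]a, b[ -> bumpfun a b n x = 0.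
Proof. by move=> ab; rewrite in_itv /= bumpE bump_in// => /negbTE ->. Qed.

Lemma smooth_bump a b n : smooth (bumpfun a b n).
Proof. exact: smooth_flat. Qed.

Lemma measurable_smooth g : smooth g -> measurable_fun setT g.
Proof. by move=> sg; apply: continuous_measurable_fun; exact: smooth_continuous. Qed.

Lemma test_bump a b n : 0 < a -> a < b -> test_function (bumpfun a b n).
Proof.
move=> a0 ab; split; first exact: smooth_bump.
exists a, b; split => // x; rewrite in_itv /= => h; apply: bump_out => //.
by rewrite in_itv /=; apply: contra h => /andP[/ltW -> /ltW ->].
Qed.

Lemma cvg_bump a b x : a < b ->
  bumpfun a b n x @[n --> \oo] --> (\1_(`]a, b[%classic) x : R).
Proof.
move=> ab; rewrite indicE; case: (boolP (x \in `]a, b[)) => xab; last first.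
  rewrite memNset; last by move=> /=; exact/negP.
  by apply: cvg_near_cst; apply: nearW => n; rewrite bump_out.
rewrite mem_set//=.
have axb : a < x < b by move: xab; rewrite in_itv.
pose q := (x - a) * (b - x).
have q0 : 0 < q by move: axb => /andP[? ?]; rewrite mulr_gt0// subr_gt0.
have -> : (fun n => bumpfun a b n x) = (fun n => expR (- (n.+1%:R^-1 * q^-1))).
  by apply/funext => n; rewrite bumpE bump_in// axb -/q invfM.
have l0 : - (n.+1%:R^-1 * q^-1) @[n --> \oo] --> (- (0 * q^-1) : R).
  by apply: cvgN; apply: cvgMl; exact: cvg_harmonic.
rewrite mul0r oppr0 in l0.
have := cvg_comp (fun n : nat => - (n.+1%:R^-1 * q^-1)) expR l0 (@continuous_expR R 0).
by rewrite expR0.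
Qed.

Lemma integrable_compact_mul h p a b M : locally_integrable0 h ->
  measurable_fun setT p -> (forall x, `|p x| <= M) ->
  (forall x, b < x -> p x = 0) -> 0 <= b ->
  mu.-integrable H (EFin \o (fun x => h x * p x)) /\
  \int[mu]_(x in H) (h x * p x) = \int[mu]_(x in `]0, b]) (h x * p x).
Proof.
move=> hi mp pM p0 b0.
have sub : `]0, b] `<=` H.
  by move=> y; rewrite /halfline /= !in_itv /= andbT => /andP[].
have E : (fun x => h x * p x) \_ H = (fun x => h x * p x) \_ `]0, b].
  apply/funext => x; rewrite !patchE; case: ifPn => xH; last first.
    by rewrite memNset// => xb; move: xH; rewrite mem_set//; exact: sub.
  case: ifPn => // xb; rewrite p0 ?mulr0//.
  rewrite ltNge; apply: contra xb => xb; rewrite mem_set//=.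
  by move: xH; rewrite inE /halfline /= !in_itv /= andbT => ->.
have ib : mu.-integrable `]0, b] (EFin \o (fun x => h x * p x)).
  have i1 : mu.-integrable `]0, b] (EFin \o (fun x => M * `|h x|)).
    by apply: integrable_scale => //; apply: integrable_norm; exact: hi.
  apply: le_integrable i1 => //.
    apply/measurable_EFinP/measurable_funM; last exact: measurable_funS mp.
    by apply/measurable_EFinP; exact: measurable_int (hi _ b0).
  move=> x _ /=; rewrite lee_fin (le_trans _ (ler_norm _))// normrM mulrC.
  by rewrite ler_wpM2r.
split; last by rewrite Rintegral_mkcond E -Rintegral_mkcond.
apply/(integrable_mkcond _ mH); rewrite restrict_EFin E -restrict_EFin.
exact/(integrable_mkcond _ (mitv _)).
Qed.

(** The integral of [h] up to [x] does not depend on [x]; by Lebesgue's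
    differentiation theorem its derivative is [h] almost everywhere. *)
Lemma ae_zero_of_intervals h : locally_integrable0 h ->
  (forall a b, 0 < a -> a < b -> \int[mu]_(x in `]a, b]) h x = 0) ->
  ae_eq_half h (cst 0).
Proof.
move=> hi h0.
suff hN (N : nat) : {ae mu, forall x, 0 < x < N%:R -> h x = 0}.
  have := ae_foralln hN; apply: filterS.
  move=> x hx; rewrite /halfline /= in_itv /= andbT => x0.
  by apply: (hx (Num.truncn x).+1); rewrite x0 truncnS_gt.
have hNi := hi _ (ler0n R N).
have hTi : mu.-integrable setT (EFin \o (h \_ `]0, N%:R])).
  by rewrite -restrict_EFin; exact/(integrable_mkcond _ (mitv _)).
have hTl : locally_integrable setT (h \_ `]0, N%:R]) by exact: integrable_locally.
have hTy y : mu.-integrable [set` Interval (BRight 0) (BRight y)] (EFin \o (h \_ `]0, N%:R])).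
  exact: integrableS hTi.
have := FTC1 hTy hTl; apply: filterS; first exact: (ae_filter_ringOfSetsType mu).
move=> x hx /andP[x0 xN].
have [|_] := hx; first by rewrite lte_fin.
rewrite patchE mem_set; last by rewrite /= in_itv /= x0 ltW.
move=> <-.
have x20 : 0 < x / 2 by rewrite divr_gt0.
rewrite derive1E.
rewrite -(near_eq_derive (f := cst (\int[mu]_(t in `]0, x / 2]) (h \_ `]0, N%:R]) t))).
  by rewrite derive_cst.
have n1 : \forall y \near x, x / 2 < y.
  by apply: lt_nbhsr; rewrite ltr_pdivrMr// ltr_pMr// ltr1n.
have n2 : \forall y \near x, y < N%:R by exact: lt_nbhsl.
apply: filterS2 n1 n2 => y y2 yN /=.
have hTiS A : measurable (A : set (measurableTypeR R)) -> mu.-integrable A (EFin \o (h \_ `]0, N%:R])).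
  by move=> mA; apply: integrableS hTi.
apply/eqP; rewrite eq_sym -subr_eq0 Rintegral_itvB//; last by rewrite bnd_simp ltW.
rewrite -[X in _ == X](h0 (x / 2) y)//; apply/eqP; apply: eq_Rintegral => z.
rewrite inE /= in_itv /= => /andP[z2 zy].
  by rewrite patchE mem_set//= in_itv /= (lt_trans x20)//= (le_trans zy)// ltW.
by rewrite bnd_simp ltW.
Qed.

(** Bumps converge boundedly to indicators of intervals, so dominated
    convergence reduces the claim to vanishing integrals over intervals. *)
Lemma ae_zero_of_bumps h : locally_integrable0 h ->
  (forall a b n, 0 < a -> a < b -> \int[mu]_(x in H) (h x * bumpfun a b n x) = 0) ->
  ae_eq_half h (cst 0).
Proof.
move=> hi h0; apply: ae_zero_of_intervals => // a b a0 ab.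
have b0 : 0 <= b by rewrite ltW// (lt_trans a0).
have hib := hi _ b0.
have mhb : measurable_fun `]0, b] h by apply/measurable_EFinP; exact: measurable_int hib.
have sub : `]a, b[ `<=` `]0, b].
  by move=> x /=; rewrite !in_itv /= => /andP[/(lt_trans a0) -> /ltW ->].
have mb n : measurable_fun setT (bumpfun a b n) by apply: measurable_smooth; exact: smooth_bump.
have bb n x : `|bumpfun a b n x| <= 1 by rewrite ger0_norm ?bump_ge0// bump_le1.
have bz n x : b < x -> bumpfun a b n x = 0.
  by move=> bx; rewrite bump_out// in_itv /= negb_and -(leNgt b) (ltW bx) orbT.
pose f_ n x := (h x * bumpfun a b n x)%:E.
have mf_ n : measurable_fun `]0, b] (f_ n).
  by apply/measurable_EFinP/measurable_funM => //; exact: measurable_funS (mb n).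
have f_f x : `]0, b]%classic x -> f_ n x @[n --> \oo] --> (h x * \1_(`]a, b[%classic) x)%:E.
  move=> _; apply: cvg_EFin; first exact: nearW.
  by apply: cvgMr; exact: cvg_bump.
have fin x : `]0, b]%classic x -> (EFin \o (fun x => `|h x|%R)) x \is a fin_num by [].
have nhi : mu.-integrable `]0, b] (EFin \o (fun x => `|h x|%R)) by exact: integrable_norm.
have f_le n x : `]0, b]%classic x -> (`|f_ n x| <= (EFin \o (fun x => `|h x|%R)) x)%E.
  by move=> _; rewrite /f_ /= lee_fin normrM ler_piMr.
have := dominated_cvg (mitv _) mf_ f_f fin nhi f_le.
have -> : (fun n => \int[mu]_(x in `]0%R, b]) f_ n x)%E = cst 0%E.
  apply/funext => n.
  have [i1 e1] := @integrable_compact_mul h _ a b 1 hi (mb n) (bb n) (bz n) b0.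
  have := h0 a b n a0 ab; rewrite e1 /Rintegral => e2.
  rewrite -[LHS]fineK ?e2//; apply: integrable_fin_num => //.
  by apply: integrableS i1 => // y; rewrite /halfline /= !in_itv /= andbT => /andP[].
move=> /(cvg_unique _ (cvg_cst _)) => /(_ (@ereal_hausdorff _)) e3.
have hab : mu.-integrable `]a, b[ (EFin \o h) by exact: integrableS hib.
rewrite -Rintegral_itv_bndo_bndc//.
rewrite /Rintegral (_ : (\int[mu]_(x in `]a, b[) (h x)%:E)%E = 0%E)//.
transitivity (\int[mu]_(x in `]0%R, b]) (h x * \1_(`]a, b[%classic) x)%:E)%E; last exact: esym e3.
rewrite integral_mkcond [RHS]integral_mkcond; apply: eq_integral => x _.
rewrite !patchE indicE; case: ifPn => xab.
  by rewrite mem_set ?mulr1//; apply: sub; rewrite inE in xab.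
by rewrite mulr0; case: ifP.
Qed.

(** The primitive that starts at the left of the support is constant to the
    right of it, with value the total integral, which is zero. *)
Lemma test_function_primitive g a b : 0 < a -> a <= b -> smooth g ->
  (forall x, x \notin `[a, b] -> g x = 0) -> \int[mu]_(x in H) g x = 0 ->
  exists2 p, test_function p & (p^`())%classic = g.
Proof.
move=> a0 ab sg g0 ig0.
have cg := smooth_continuous sg.
have gab : g \_ `[a, b] = g.
  apply/funext => x; rewrite patchE; case: ifPn => //; rewrite mem_setE => h.
  by rewrite g0.
have gi : mu.-integrable setT (EFin \o g).
  rewrite -gab -restrict_EFin; apply/(integrable_mkcond _ (mitv _)).
  apply: continuous_compact_integrable; first exact: segment_compact.
  exact: continuous_subspaceT.
pose p x := \int[mu]_(t in `]-oo, x]) g t.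
have dp x : derivable p x 1 /\ (p^`())%classic x = g x.
  apply: (@continuous_FTC1 R g -oo%O x (x + 1)); rewrite ?ltrDl//.
  - by apply: integrableS gi.
  - by rewrite ltNyr.
  - exact: cg.
have p'g : (p^`())%classic = g by apply/funext => x; have [] := dp x.
exists p => //; split.
  case=> [|n] x; first by rewrite derive1n0; have [] := dp x.
  by rewrite derive1Sn p'g; exact: sg.
exists a, b; split => // x; rewrite in_itv /= negb_and -!ltNge => /orP[xa|bx].
  rewrite /p; transitivity (\int[mu]_(t in `]-oo, x]) (cst 0 t)).
    apply: eq_Rintegral => t; rewrite inE /= in_itv /= => tx.
    by apply: g0; rewrite in_itv /= negb_and -ltNge (le_lt_trans tx).
  by rewrite Rintegral_cst// mul0r.
rewrite -ig0 /p Rintegral_mkcond [RHS]Rintegral_mkcond; congr Rintegral.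
apply/funext => t; rewrite !patchE; case: ifPn => tx; case: ifPn => tH //.
  apply: g0; rewrite in_itv /= negb_and -!ltNge; apply/orP; left.
  move: tH; rewrite notin_setE /halfline /= in_itv /= andbT => /negP.
  by rewrite -leNgt => /le_lt_trans; apply.
apply/esym/g0; rewrite in_itv /= negb_and -!ltNge; apply/orP; right.
move: tx; rewrite notin_setE /= in_itv /= => /negP.
by rewrite -ltNge; exact: lt_trans.
Qed.

(** What is used of a test function below: the function and its derivative
    are bounded, measurable and vanish far away. *)
Lemma test_function_bounded p : test_function p ->
  exists b M, [/\ 0 <= b, measurable_fun setT p /\ measurable_fun setT (p^`())%classic,
   forall x, `|p x| <= M /\ `|(p^`())%classic x| <= M,
   forall x, b <= x -> p x = 0 &
   forall x, b < x -> (p^`())%classic x = 0].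
Proof.
move=> [sp [a [b [a0 p0]]]].
have bnd g : smooth g -> (forall x, x \notin `[a, b] -> g x = 0) -> exists M, forall x, `|g x| <= M.
  move=> sg g0.
  have cg := smooth_continuous sg.
  have /compact_bounded[M [_ hM]] : compact (g @` `[a, b]).
    by apply: continuous_compact; [exact: continuous_subspaceT|exact: segment_compact].
  exists (`|M| + 1) => x; case: (boolP (x \in `[a, b])) => xab.
    by apply: (hM (`|M| + 1)); [rewrite (le_lt_trans (ler_norm _))// ltrDl|exists x].
  by rewrite g0// normr0 addr_ge0.
have sp' : smooth (p^`())%classic by exact: smooth_derive.
have p'0 x : x \notin `[a, b] -> (p^`())%classic x = 0.
  rewrite in_itv /= negb_and -!ltNge => xab; rewrite derive1E.
  rewrite -(near_eq_derive (f := cst 0)) ?derive_cst//.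
  case/orP: xab => xab.
    have : \forall y \near x, y < a by exact: lt_nbhsl.
    apply: filterS => y ya; apply/esym/p0.
    by rewrite in_itv /= negb_and -ltNge ya.
  have : \forall y \near x, b < y by exact: lt_nbhsr.
  apply: filterS => y ya; apply/esym/p0.
  by rewrite in_itv /= negb_and -!ltNge ya orbT.
have [M1 h1] := bnd _ sp p0; have [M2 h2] := bnd _ sp' p'0.
exists (Num.max 0 (b + 1)), (Num.max M1 M2); split.
- by rewrite le_max lexx.
- by split; exact: measurable_smooth.
- by move=> x; rewrite !le_max h1 h2 orbT.
- move=> x; rewrite ge_max => /andP[_ bx]; apply: p0; rewrite in_itv /= negb_and -!ltNge.
  by apply/orP; right; rewrite (lt_le_trans _ bx)// ltrDl.
- move=> x; rewrite gt_max => /andP[_ bx]; apply: p'0; rewrite in_itv /= negb_and -!ltNge.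
  by apply/orP; right; rewrite (lt_trans _ bx)// ltrDl.
Qed.

(** A form of the lemma of du Bois-Reymond. Let $h = f - G$ with
    $G(x) = \int_0^x g$. The product rule for [G] and a test function shows that
    $h$ is orthogonal to derivatives of test functions. A bump minus a multiple of
    a fixed bump has integral zero, so it is such a derivative; hence $h$ minus a
    constant $K$ is orthogonal to all bumps, and is zero. *)
Theorem weak_deriv_primitive f g : inL2 f -> weak_deriv f g ->
  exists2 F, primitive g F & ae_eq_half f F.
Proof.
move=> fL [gL fg].
have fl := inL2_locally_integrable fL; have gl := inL2_locally_integrable gL.
pose G x := \int[mu]_(y in `]0, x]) g y.
have gG : primitive g G by exact: primitive_integral.
have Gl : locally_integrable0 G.
  by apply: continuous_locally_integrable; exact: primitive_continuous gG.
pose h x := f x - G x.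
have hl : locally_integrable0 h.
  by move=> x x0; apply: integrable_sub => //; [exact: fl|exact: Gl].
have key p : test_function p -> \int[mu]_(x in H) (h x * (p^`())%classic x) = 0.
  move=> tp; have [b [M [b0 [mp mp'] pM pb p'b]]] := test_function_bounded tp.
  have pb' x : b < x -> p x = 0 by move/ltW; exact: pb.
  have pM1 x : `|p x| <= M by have [] := pM x.
  have pM2 x : `|(p^`())%classic x| <= M by have [] := pM x.
  have [i1 e1] := integrable_compact_mul b fl mp' pM2 p'b b0.
  have [i2 e2] := integrable_compact_mul b gl mp pM1 pb' b0.
  have [i3 e3] := integrable_compact_mul b Gl mp' pM2 p'b b0.
  have pp : primitive (p^`())%classic p.
    apply: primitive_derive => x _; last first.
      by apply: smooth_continuous; apply: smooth_derive; have [] := tp.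
    have [sp _] := tp; have := sp 0%N x; rewrite derive1n0 => /derivableP.
    by rewrite derive1E.
  have [i4] := primitiveM gG pp b0; rewrite pb//.
  have -> : G 0 = 0.
    by have [_] := gG _ (lexx 0); rewrite -/(G 0); lra.
  rewrite mulr0 mul0r add0r => e4.
  have sub : `]0, b] `<=` H.
    by move=> y; rewrite /halfline /= !in_itv /= andbT => /andP[].
  have i2b : mu.-integrable `]0, b] (EFin \o (fun x => g x * p x)) by exact: integrableS i2.
  have i3b : mu.-integrable `]0, b] (EFin \o (fun x => G x * (p^`())%classic x)) by exact: integrableS i3.
  have e5 : \int[mu]_(x in `]0, b]) (g x * p x) + \int[mu]_(x in `]0, b]) (G x * (p^`())%classic x) = 0.
    rewrite -RintegralD// [RHS]e4; apply: eq_Rintegral => x _.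
    by rewrite (mulrC (G x)).
  have -> : (fun x => h x * (p^`())%classic x) = (fun x => f x * (p^`())%classic x - G x * (p^`())%classic x).
    by apply/funext => x; rewrite /h mulrBl.
  rewrite RintegralB// (fg _ tp) e2 e3.
  by rewrite -opprD e5 oppr0.
have two1 : (1 : R) < 2 by rewrite ltr1n.
have ib a b n : 0 < a -> a < b -> mu.-integrable H (EFin \o bumpfun a b n) /\
    mu.-integrable H (EFin \o (fun x => h x * bumpfun a b n x)).
  move=> a0 ab.
  have b0 : 0 <= b by rewrite ltW// (lt_trans a0).
  have mb : measurable_fun setT (bumpfun a b n) by apply: measurable_smooth; exact: smooth_bump.
  have bb x : `|bumpfun a b n x| <= 1 by rewrite ger0_norm ?bump_ge0// bump_le1.
  have bz x : b < x -> bumpfun a b n x = 0.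
    by move=> bx; rewrite bump_out// in_itv /= negb_and -(leNgt b) (ltW bx) orbT.
  have l1 : locally_integrable0 (cst 1 : R -> R).
    by apply: continuous_locally_integrable; exact: continuous_subspaceT (@cst_continuous _ _ _).
  have [i1 _] := @integrable_compact_mul (cst 1) _ a b 1 l1 mb bb bz b0.
  have [i2 _] := @integrable_compact_mul h _ a b 1 hl mb bb bz b0.
  by split => //; move: i1; under eq_fun do rewrite /= mul1r.
pose c a b n := \int[mu]_(x in H) bumpfun a b n x.
have c0 : 0 < c 1 2 0%N.
  rewrite lt_neqAle eq_sym; apply/andP; split; last first.
    by apply: Rintegral_ge0 => x _; exact: bump_ge0.
  (* On [5/4, 7/4] the exponent is at least -16, because (x - 1)(2 - x) is
     at least 1/16 there. *)
  have e0 : 0 < expR (- (16 : R)) / 2 by rewrite divr_gt0// expR_gt0.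
  rewrite gt_eqF//; apply: lt_le_trans e0 _.
  have [i1 _] := ib 1 2 0%N ltr01 two1.
  have mbmp : measurable_fun setT (bumpfun 1 2 0) by apply: measurable_smooth; exact: smooth_bump.
  pose J : set R := `[5/4, 7/4]%classic.
  have mJ : measurable (J : set (measurableTypeR R)) by exact: measurable_itv.
  rewrite -lee_fin /c /Rintegral fineK; last by apply: integrable_fin_num => //.
  apply: (@le_trans _ _ (\int[mu]_(x in J) (bumpfun 1 2 0 x)%:E)%E); last first.
    apply: ge0_subset_integral => //.
    - by apply/measurable_EFinP; apply: measurable_funS mbmp.
    - by move=> x _; rewrite lee_fin bump_ge0.
    - by move=> x; rewrite /J /halfline /= !in_itv /= andbT => /andP[x1 _]; lra.
  apply: (@le_trans _ _ (\int[mu]_(x in J) (expR (- (16 : R)))%:E)%E).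
    rewrite integral_cst//= /J lebesgue_measure_itv /= lte_fin ifT; last lra.
    by rewrite -EFinB -EFinM lee_fin; rewrite le_eqVlt; apply/orP; left; apply/eqP; field.
  apply: ge0_le_integral => //.
  - by apply/measurable_EFinP; apply: measurable_funS mbmp.
  move=> x; rewrite /J /= in_itv /= => /andP[x1 x2].
  have x12 : 1 < x < 2 by apply/andP; split; lra.
  rewrite lee_fin bumpE bump_in// x12 ler_expR lerN2 mul1r.
  rewrite -[leRHS]invrK lef_pV2 ?posrE ?invr_gt0//; nra.
pose K := \int[mu]_(x in H) (h x * bumpfun 1 2 0 x) / c 1 2 0%N.
exists (fun x => G x + K).
  move=> x x0; have [gi Gx] := gG _ x0; split => //.
  by rewrite Gx; ring.
have kl : locally_integrable0 (fun x => h x - K).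
  move=> x x0; apply: integrable_sub => //; first exact: hl.
  by apply: (continuous_locally_integrable _ x0); exact: continuous_subspaceT (@cst_continuous _ _ _).
suff : ae_eq_half (fun x => h x - K) (cst 0).
  apply: filterS; first exact: (ae_filter_ringOfSetsType mu).
  by move=> x /= hx /hx; rewrite /h => /eqP; rewrite subr_eq0 subr_eq addrC => /eqP.
apply: ae_zero_of_bumps => // a b n a0 ab.
have [i1 i2] := ib a b n a0 ab; have [j1 j2] := ib 1 2 0%N ltr01 two1.
pose r := c a b n / c 1 2 0%N.
pose gn x := 1 * bumpfun a b n x + (- r) * bumpfun 1 2 0 x.
have -> : (fun x => (h x - K) * bumpfun a b n x) = (fun x => h x * bumpfun a b n x - K * bumpfun a b n x).
  by apply/funext => x; rewrite mulrBl.
have iK : mu.-integrable H (EFin \o (fun x => K * bumpfun a b n x)) by exact: integrable_scale.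
rewrite RintegralB// RintegralZl// -/(c a b n).
have irj : mu.-integrable H (EFin \o (fun x => r * bumpfun 1 2 0 x)) by exact: integrable_scale.
have irj2 : mu.-integrable H (EFin \o (fun x => r * (h x * bumpfun 1 2 0 x))) by exact: integrable_scale.
have [p tp pE] : exists2 p, test_function p & (p^`())%classic = gn.
  apply: (@test_function_primitive _ (Num.min a 1) (Num.max b 2)).
  - by rewrite lt_min a0 ltr01.
  - by rewrite le_max !ge_min (ltW ab).
  - by apply: smooth_lin; exact: smooth_bump.
  - move=> x; rewrite in_itv /= negb_and -!ltNge lt_min gt_max /gn => hx.
    by case/orP: hx => /andP[h1 h2]; rewrite !bump_out// ?mulr0 ?addr0//
      in_itv /= negb_and -!leNgt ?(ltW h1) ?(ltW h2) ?orbT.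
  - rewrite /gn.
    have -> : (fun x => 1 * bumpfun a b n x + (- r) * bumpfun 1 2 0 x) = (fun x => bumpfun a b n x - r * bumpfun 1 2 0 x).
      by apply/funext => x; rewrite mul1r mulNr.
    rewrite RintegralB// RintegralZl// -/(c a b n) -/(c 1 2 0%N) /r divfK ?subrr//.
    by rewrite gt_eqF.
have := key _ tp; rewrite pE /gn.
have -> : (fun x => h x * (1 * bumpfun a b n x + (- r) * bumpfun 1 2 0 x)) =
   (fun x => h x * bumpfun a b n x - r * (h x * bumpfun 1 2 0 x)).
  by apply/funext => x; ring.
rewrite RintegralB// RintegralZl// => <-; congr (_ - _).
rewrite /K /r.
by move: (\int[mu]_(x in H) (h x * bumpfun 1 2 0 x)) (c a b n) (c 1 2 0%N) => I A B; ring.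
Qed.

End duBoisReymond.

(** * Weak derivatives, traces and integration by parts *)

Section aeEquality.
Context {R : realType}.
Local Notation mu := (@lebesgue_measure R).
Local Notation H := (@halfline R).
Implicit Types (f g h p F G : R -> R) (a b x y : R).

Let mitv (i : interval R) : measurable ([set` i] : set (measurableTypeR R)).
Proof. exact: measurable_itv. Qed.
Hint Resolve mitv : core.
Let mH := @measurable_halfline R.

Lemma ae_half_filter (P Q : R -> Prop) : {ae mu, forall x, P x} ->
  (forall x, P x -> Q x) -> {ae mu, forall x, Q x}.
Proof. by move=> hP PQ; move: hP; apply: filterS; first exact: (ae_filter_ringOfSetsType mu). Qed.

Lemma ae_half_filter2 (P1 P2 Q : R -> Prop) : {ae mu, forall x, P1 x} ->
  {ae mu, forall x, P2 x} ->
  (forall x, P1 x -> P2 x -> Q x) -> {ae mu, forall x, Q x}.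
Proof.
move=> h1 h2 PQ; move: h1 h2; apply: filterS2; first exact: (ae_filter_ringOfSetsType mu).
exact: PQ.
Qed.

Lemma ae_eq_half_sym f g : ae_eq_half f g -> ae_eq_half g f.
Proof. by move=> fg; apply: ae_half_filter fg _ => x /= fg /fg. Qed.

Lemma ae_eq_half_trans f g h : ae_eq_half f g -> ae_eq_half g h -> ae_eq_half f h.
Proof.
by move=> fg gh; apply: ae_half_filter2 fg gh _ => x /= fg gh Hx; rewrite fg// gh.
Qed.

Lemma eq_Rintegral_half f g : measurable_fun H f -> measurable_fun H g ->
  ae_eq_half f g -> \int[mu]_(x in H) f x = \int[mu]_(x in H) g x.
Proof.
move=> mf mg fg; congr fine; apply: ae_eq_integral => //.
- exact/measurable_EFinP.
- exact/measurable_EFinP.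
- by apply: ae_half_filter fg _ => x /= fg Hx; rewrite fg.
Qed.

Lemma inL2_ae f g : inL2 f -> measurable_fun H g -> ae_eq_half f g -> inL2 g.
Proof.
move=> /inL2P[mf fi] mg fg; apply/inL2P; split => //.
apply/integrableP; split; first by apply/measurable_EFinP; exact: measurable_funX.
have /integrableP[_] := fi; apply: le_lt_trans.
rewrite le_eqVlt; apply/orP; left; apply/eqP.
apply: ae_eq_integral => //.
- by apply: measurableT_comp => //; apply/measurable_EFinP; exact: measurable_funX.
- by apply: measurableT_comp => //; apply/measurable_EFinP; exact: measurable_funX.
- by apply: ae_half_filter fg _ => x /= fg Hx; rewrite fg.
Qed.

Lemma sqint_eq0 f g : inL2 f -> inL2 g -> sqint (fun x => f x - g x) = 0 ->
  ae_eq_half f g.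
Proof.
move=> fL gL; have /inL2P[m i] := inL2B fL gL; rewrite /sqint /Rintegral => h.
have h0 : (\int[mu]_(x in H) `|((f x - g x) ^+ 2)%:E| = 0)%E.
  rewrite -[LHS]fineK; last first.
    apply: integrable_fin_num => //.
    exact: (integrable_norm i).
  under eq_integral do rewrite abse_EFin ger0_norm ?sqr_ge0//.
  by rewrite h.
have mm : measurable_fun H (fun x => ((f x - g x) ^+ 2)%:E).
  by apply/measurable_EFinP; exact: measurable_funX.
have ae := (@ae_eq_integral_abs _ _ _ mu H mH _ mm).1 h0.
apply: ae_half_filter ae _ => x /= hx Hx; have [] := hx Hx => /eqP.
by rewrite sqrf_eq0 subr_eq0 => /eqP.
Qed.

Lemma ae_sqint_eq0 f g : measurable_fun H f -> measurable_fun H g -> ae_eq_half f g ->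
  sqint (fun x => f x - g x) = 0.
Proof.
move=> mf mg fg; rewrite /sqint (@eq_Rintegral_half _ (cst 0)) ?Rintegral_cst ?mul0r//.
- by apply: measurable_funX; exact: measurable_funB.
- by apply: ae_half_filter fg _ => x /= fg Hx; rewrite fg// subrr expr0n.
Qed.

Lemma ae_eq_half_sqint f g f' g' : measurable_fun H f -> measurable_fun H g ->
  measurable_fun H f' -> measurable_fun H g' ->
  ae_eq_half f f' -> ae_eq_half g g' ->
  sqint (fun x => f x - g x) = sqint (fun x => f' x - g' x).
Proof.
move=> mf mg mf' mg' ff' gg'; apply: eq_Rintegral_half.
- by apply: measurable_funX; exact: measurable_funB.
- by apply: measurable_funX; exact: measurable_funB.
- by apply: ae_half_filter2 ff' gg' _ => x /= fx gx Hx; rewrite fx// gx.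
Qed.

Lemma integrable_test f p : inL2 f -> test_function p ->
  mu.-integrable H (EFin \o (fun x => f x * p x)) /\
  mu.-integrable H (EFin \o (fun x => f x * (p^`())%classic x)).
Proof.
move=> /inL2_locally_integrable fl tp.
have [b [M [b0 [mp mp'] pM pb p'b]]] := test_function_bounded tp.
have pb' x : b < x -> p x = 0 by move/ltW; exact: pb.
have pM1 x : `|p x| <= M by have [] := pM x.
have pM2 x : `|(p^`())%classic x| <= M by have [] := pM x.
by split; [have [] := integrable_compact_mul b fl mp pM1 pb' b0|
  have [] := integrable_compact_mul b fl mp' pM2 p'b b0].
Qed.

(** The difference of two weak derivatives is orthogonal to all bumps. *)
Lemma weak_deriv_unique f g1 g2 : weak_deriv f g1 -> weak_deriv f g2 ->
  ae_eq_half g1 g2.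
Proof.
move=> [g1L fg1] [g2L fg2].
have := inL2_locally_integrable (inL2B g1L g2L) => gl.
have : ae_eq_half (fun x => g1 x - g2 x) (cst 0).
  apply: ae_zero_of_bumps => // a b n a0 ab.
  have tp := test_bump n a0 ab.
  have [i1 _] := integrable_test g1L tp; have [i2 _] := integrable_test g2L tp.
  have -> : (fun x => (g1 x - g2 x) * bumpfun a b n x) = (fun x => g1 x * bumpfun a b n x - g2 x * bumpfun a b n x).
    by apply/funext => x; rewrite mulrBl.
  rewrite RintegralB//.
  have := fg1 _ tp; rewrite (fg2 _ tp) => /eqP; rewrite eqr_opp => /eqP ->.
  by rewrite subrr.
move=> ae; apply: ae_half_filter ae _ => x /= hx /hx /eqP.
by rewrite subr_eq0 => /eqP.
Qed.

Lemma weak_deriv_lin f1 f2 g1 g2 a b : inL2 f1 -> inL2 f2 ->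
  weak_deriv f1 g1 -> weak_deriv f2 g2 ->
  weak_deriv (fun x => a * f1 x + b * f2 x) (fun x => a * g1 x + b * g2 x).
Proof.
move=> f1L f2L [g1L fg1] [g2L fg2]; split; first exact: inL2_lin.
move=> p tp.
have [i1 j1] := integrable_test g1L tp; have [i2 j2] := integrable_test g2L tp.
have [i3 j3] := integrable_test f1L tp; have [i4 j4] := integrable_test f2L tp.
have E (u v q : R -> R) : (fun x => (a * u x + b * v x) * q x) = (fun x => a * (u x * q x) + b * (v x * q x)).
  by apply/funext => x; ring.
rewrite !E !RintegralD//; try exact: integrable_scale.
by rewrite !RintegralZl// fg1// fg2//; ring.
Qed.

Lemma weak_deriv_ae f f' g : inL2 f -> inL2 f' -> ae_eq_half f f' ->
  weak_deriv f g -> weak_deriv f' g.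
Proof.
move=> fL fL' ff' [gL fg]; split => // p tp; rewrite -fg//.
have [_ i] := integrable_test fL tp; have [_ i'] := integrable_test fL' tp.
apply: eq_Rintegral_half.
- by apply/measurable_EFinP; exact: measurable_int i'.
- by apply/measurable_EFinP; exact: measurable_int i.
- by apply: ae_half_filter ff' _ => x /= h /h ->.
Qed.

Lemma ae_half_exists (P : R -> Prop) d : 0 < d ->
  {ae mu, forall x, H x -> P x} -> exists x, [/\ 0 < x, x < d & P x].
Proof.
move=> d0 [N [mN N0 sub]]; apply: contrapT => hno.
have : `]0, d[ `<=` N.
  move=> x; rewrite /= in_itv /= => /andP[x0 xd]; apply: sub => /= hx.
  by apply: hno; exists x; split => //; apply: hx; rewrite /halfline /= in_itv /= x0.
have N0' : (mu N <= 0)%E by rewrite le_eqVlt; apply/orP; left; apply/eqP; exact: N0.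
move=> /(le_measure mu); rewrite !inE => /(_ (mitv _) mN) h.
have md : mu `]0, d[ = d%:E by rewrite lebesgue_measure_itv /= lte_fin d0 -EFinB subr0.
suff : (d%:E <= 0)%E by rewrite lee_fin leNgt d0.
by rewrite -md; exact: le_trans h N0'.
Qed.

(** Continuous functions that are equal almost everywhere are equal at points
    arbitrarily close to 0. *)
Lemma continuous_ae_eq0 F G : {within `[0, +oo[, continuous F} ->
  {within `[0, +oo[, continuous G} -> ae_eq_half F G -> F 0 = G 0.
Proof.
move=> cF cG FG; apply/eqP; rewrite -subr_eq0; apply: contraT => n0.
have e0 : 0 < `|F 0 - G 0| / 4 by rewrite divr_gt0// normr_gt0.
have in0 : (`[0, +oo[%classic : set R) 0 by rewrite /= in_itv /= lexx.
have /subspace_continuousP/(_ 0 in0)/cvg_withinP/(_ _ e0)[d1 d10 h1] := cF.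
have /subspace_continuousP/(_ 0 in0)/cvg_withinP/(_ _ e0)[d2 d20 h2] := cG.
have [|x [x0 xd fg]] := @ae_half_exists (fun x => F x = G x) (Num.min d1 d2) _ FG.
  by rewrite lt_min d10.
have xi : (`[0, +oo[%classic : set R) x by rewrite /= in_itv /= andbT ltW.
move: xd; rewrite lt_min => /andP[xd1 xd2].
have k1 : `|F x - F 0| <= `|F 0 - G 0| / 4 by apply: h1; rewrite ?subr0 ?gtr0_norm.
have k2 : `|G x - G 0| <= `|F 0 - G 0| / 4 by apply: h2; rewrite ?subr0 ?gtr0_norm.
have : `|F 0 - G 0| <= `|F x - F 0| + `|G x - G 0|.
  have -> : F 0 - G 0 = (G x - G 0) - (F x - F 0) by rewrite fg; ring.
  by rewrite [leRHS]addrC; exact: ler_normB.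
move: n0; rewrite -normr_gt0.
move: k1 k2; move: `|F 0 - G 0| `|_| `|_| => A B C; lra.
Qed.

(** The value at 0 chosen by [trace0] is the one of every continuous
    representative. *)
Lemma trace0E f F : {within `[0, +oo[, continuous F} -> ae_eq_half f F ->
  trace0 f = F 0.
Proof.
move=> cF fF; rewrite /trace0.
set S := [set l | _].
have [G [cG fG <-]] : S (get S) by apply: (@getPex _ S); exists (F 0), F.
apply: continuous_ae_eq0 => //.
by apply: ae_eq_half_trans fF; exact: ae_eq_half_sym.
Qed.

Lemma measurable_continuous_half F : {within `[0, +oo[, continuous F} ->
  measurable_fun H F.
Proof.
move=> cF.
have mF : measurable_fun (`[0, +oo[%classic : set R) F by exact: subspace_continuous_measurable_fun.
apply: measurable_funS mF => //.
by move=> x; rewrite /halfline /= !in_itv /= !andbT; exact: ltW.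
Qed.

(** With [F] and [G] the absolutely continuous representatives of [f] and
    [g], the product $W F G$ is integrable, and so is its derivative. Hence its
    value at 0 is minus the integral of its derivative. *)
Theorem weighted_integration_by_parts f f1 g g1 W W1 M :
  inL2 f -> weak_deriv f f1 -> inL2 g -> weak_deriv g g1 ->
  primitive W1 W -> measurable_fun H W -> measurable_fun H W1 ->
  (forall x, H x -> `|W x| <= M) -> (forall x, H x -> `|W1 x| <= M) ->
  \int[mu]_(x in H) (W x * f1 x * g x) + \int[mu]_(x in H) (W x * f x * g1 x) +
  \int[mu]_(x in H) (W1 x * f x * g x) = - (W 0 * trace0 f * trace0 g).
Proof.
move=> fL ff1 gL gg1 WW mW mW1 WM W1M.
have [F fF aF] := weak_deriv_primitive fL ff1.
have [G gG aG] := weak_deriv_primitive gL gg1.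
have [f1L _] := ff1; have [g1L _] := gg1.
have cF := primitive_continuous fF; have cG := primitive_continuous gG.
rewrite (trace0E cF aF) (trace0E cG aG).
have mF := measurable_continuous_half cF; have mG := measurable_continuous_half cG.
have FL := inL2_ae fL mF aF; have GL := inL2_ae gL mG aG.
have mf := inL2_measurable fL; have mg := inL2_measurable gL.
have mf1 := inL2_measurable f1L; have mg1 := inL2_measurable g1L.
have m3 (a b c : R -> R) : measurable_fun H a -> measurable_fun H b ->
    measurable_fun H c -> measurable_fun H (fun x => a x * b x * c x).
  by move=> ma mb mc; apply: measurable_funM => //; exact: measurable_funM.
have -> : \int[mu]_(x in H) (W x * f1 x * g x) = \int[mu]_(x in H) (W x * f1 x * G x).
  apply: eq_Rintegral_half; [exact: m3|exact: m3|].
  by apply: ae_half_filter aG _ => x /= h /h ->.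
have -> : \int[mu]_(x in H) (W x * f x * g1 x) = \int[mu]_(x in H) (W x * F x * g1 x).
  apply: eq_Rintegral_half; [exact: m3|exact: m3|].
  by apply: ae_half_filter aF _ => x /= h /h ->.
have -> : \int[mu]_(x in H) (W1 x * f x * g x) = \int[mu]_(x in H) (W1 x * F x * G x).
  apply: eq_Rintegral_half; [exact: m3|exact: m3|].
  by apply: ae_half_filter2 aF aG _ => x /= hf hg Hx; rewrite hf// hg.
have i1 := integrable_mul mW WM f1L GL.
have i2 := integrable_mul mW WM FL g1L.
have i3 := integrable_mul mW1 W1M FL GL.
have i4 := integrable_mul mW WM FL GL.
have i12 := integrable_add mH i1 i2; have i123 := integrable_add mH i12 i3.
rewrite -RintegralD// -RintegralD//.
have P := primitiveM (primitiveM fF gG) WW.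
rewrite [X in X = _](_ : _ = \int[mu]_(x in H) ((f1 x * G x + g1 x * F x) * W x + W1 x * (F x * G x))); last first.
  by apply: eq_Rintegral => x _; ring.
rewrite -[LHS]opprK -(primitive_integrable P) //.
- by congr (- _); ring.
- move: i123; congr (_.-integrable _ _); apply/funext => x /=; congr EFin; ring.
- move: i4; congr (_.-integrable _ _); apply/funext => x /=; congr EFin; ring.
Qed.

End aeEquality.

(** * The exponential weight *)

Section taylor.
Context {R : realType}.
Variables (T M : R).
Implicit Types (r t u a b : R).

Lemma derive_lipschitz (f f1 : R -> R) r t :
  (forall u, u \in `[0, T] -> is_derive u 1 f (f1 u)) ->
  (forall u, u \in `[0, T] -> `|f1 u| <= M) ->
  r \in `[0, T] -> t \in `[0, T] ->
  exists u, [/\ u \in `[0, T], f r - f t = (r - t) * f1 u & `|u - t| <= `|r - t|].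
Proof.
move=> df bf.
have main a b : a \in `[0, T] -> b \in `[0, T] -> a <= b ->
    exists2 u, u \in `[a, b] & f b - f a = f1 u * (b - a).
  rewrite !in_itv /= => /andP[a0 aT] /andP[b0 bT] ab.
  have cf : {within `[a, b], continuous f}; last first.
    have df' x : x \in `]a, b[ -> is_derive x 1 f (f1 x); last exact: (MVT_segment ab df' cf).
    rewrite in_itv /= => /andP[ax xb]; apply: df.
    by rewrite in_itv /= (le_trans a0 (ltW ax)) (le_trans (ltW xb) bT).
  apply/continuous_in_subspaceT => x; rewrite inE /= in_itv /= => /andP[ax xb].
  apply/differentiable_continuous/derivable1_diffP.
  suff dx : is_derive x 1 f (f1 x) by case: dx.
  by apply: df; rewrite in_itv /= (le_trans a0 ax) (le_trans xb bT).
move=> rT tT; have [rt|tr] := leP r t.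
  have [u uI e] := main _ _ rT tT rt; exists u; split.
  - move: uI rT tT; rewrite !in_itv /= => /andP[? ?] /andP[? ?] /andP[? ?].
    by apply/andP; split; lra.
  - by rewrite -opprB e; ring.
  - move: uI; rewrite in_itv /= => /andP[ru ut].
    by rewrite !ler0_norm ?subr_le0//; lra.
have [u uI e] := main _ _ tT rT (ltW tr); exists u; split.
- move: uI rT tT; rewrite !in_itv /= => /andP[? ?] /andP[? ?] /andP[? ?].
  by apply/andP; split; lra.
- by rewrite e mulrC.
- move: uI; rewrite in_itv /= => /andP[ru ut].
  by rewrite !ger0_norm ?subr_ge0//; lra.
Qed.

Lemma C2_taylor (f f1 f2 : R -> R) r t :
  (forall u, u \in `[0, T] -> is_derive u 1 f (f1 u)) ->
  (forall u, u \in `[0, T] -> is_derive u 1 f1 (f2 u)) ->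
  (forall u, u \in `[0, T] -> `|f1 u| <= M) ->
  (forall u, u \in `[0, T] -> `|f2 u| <= M) ->
  r \in `[0, T] -> t \in `[0, T] ->
  [/\ `|f r - f t| <= M * `|r - t|, `|f1 r - f1 t| <= M * `|r - t| &
      `|f r - f t - (r - t) * f1 t| <= M * (r - t) ^+ 2].
Proof.
move=> df df1 b1 b2 rT tT.
have M0 : 0 <= M by apply: le_trans (b1 _ tT).
have [u [uT e ut]] := derive_lipschitz df b1 rT tT.
have [v [vT e1 _]] := derive_lipschitz df1 b2 rT tT.
have [z [zT e2 _]] := derive_lipschitz df1 b2 uT tT.
split.
- by rewrite e normrM mulrC ler_wpM2r// b1.
- by rewrite e1 normrM mulrC ler_wpM2r// b2.
- rewrite e -mulrBr e2 !normrM -real_normK ?num_real// expr2 mulrA (mulrC M).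
  by rewrite -!mulrA ler_wpM2l//; apply: ler_pM => //; exact: b2.
Qed.

End taylor.

Lemma is_derive_ext (R : realType) (f g : R -> R) (x a b : R) :
  is_derive x 1 f a -> (forall y, f y = g y) -> a = b -> is_derive x 1 g b.
Proof. by move=> fa /funext <- <-. Qed.

Lemma is_derive_affine (R : realType) (g : R -> R) (x a b : R) :
  (forall y, g y = a + b * y) -> is_derive x 1 g b.
Proof.
move=> gE.
have d0 : is_derive x (1 : R) (cst a : R -> R) 0 by exact: is_derive_cst.
have d1 : is_derive x (1 : R) (id : R -> R) 1 by exact: is_derive_id.
apply: (is_derive_ext (is_deriveD d0 (is_deriveZ b d1))) => [y|].
  by rewrite gE.
by rewrite add0r /GRing.scale /= mulr1.
Qed.

Section weight.
Context {R : realType}.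
Local Notation mu := (@lebesgue_measure R).
Local Notation H := (@halfline R).
Variables (c lambda s T : R).
Implicit Types (x t y : R) (k : nat).
Hypotheses (hc : 0 < c) (hl : lambda < 0) (hs : 1 <= - (2 * s)).

Local Notation phi := (phi c lambda).

(** With $\varrho$ the logarithmic derivative of $\varphi$, differentiating
    $w_k = e^{2s\varphi}\varphi^k$ gives $\varrho (2 s w_{k+1} + k w_k)$. So all
    derivatives stay in the span of these weights, each of which is bounded. *)
Definition weight (k : nat) t x := expR (2 * s * phi x t) * phi x t ^+ k.

(** The logarithmic derivative of $\varphi$ in time; [rate_x] is the one in
    space. *)
Definition rate t x := - lambda * c * ((1 + c * t)^-1 + (1 + x + c * t)^-1).

Definition rate_t t x :=
  - lambda * c * (- c * (1 + c * t)^-1 ^+ 2 - c * (1 + x + c * t)^-1 ^+ 2).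

Definition rate_x t x := - lambda * (1 + x + c * t)^-1.

Definition weight_t (k : nat) t x :=
  rate t x * (2 * s * weight k.+1 t x + k%:R * weight k t x).

Definition weight_tt (k : nat) t x :=
  rate_t t x * (2 * s * weight k.+1 t x + k%:R * weight k t x) +
  rate t x * (2 * s * weight_t k.+1 t x + k%:R * weight_t k t x).

Lemma ct_ge0 t : 0 <= t -> 0 <= c * t.
Proof. by move=> t0; rewrite mulr_ge0// ltW. Qed.

Lemma base1_ge1 t : 0 <= t -> 1 <= 1 + c * t.
Proof. by move=> /ct_ge0; lra. Qed.

Lemma base2_ge1 x t : 0 <= x -> 0 <= t -> 1 <= 1 + x + c * t.
Proof. by move=> x0 /ct_ge0; lra. Qed.

Lemma inv_base1 t : 0 <= t -> 0 < (1 + c * t)^-1 <= 1.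
Proof.
move=> /base1_ge1 h; have h0 : 0 < 1 + c * t by apply: lt_le_trans h.
by rewrite invr_gt0 h0 invf_le1.
Qed.

Lemma inv_base2 x t : 0 <= x -> 0 <= t -> 0 < (1 + x + c * t)^-1 <= 1.
Proof.
move=> x0 t0; have h := base2_ge1 x0 t0.
have h0 : 0 < 1 + x + c * t by apply: lt_le_trans h.
by rewrite invr_gt0 h0 invf_le1.
Qed.

Lemma phi_ge1 x t : 0 <= x -> 0 <= t -> 1 <= phi x t.
Proof.
move=> x0 t0; rewrite /Defs.phi /psi -[leLHS]expR0 ler_expR.
have := ln_ge0 (base1_ge1 t0); have := ln_ge0 (base2_ge1 x0 t0).
by move: (ln _) (ln _) => a b b0 a0; rewrite -opprD mulrN -mulNr mulr_ge0 ?addr_ge0// oppr_ge0 ltW.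
Qed.

Lemma weight_ge0 k t x : 0 <= weight k t x.
Proof. by rewrite mulr_ge0 ?expR_ge0// exprn_ge0// expR_ge0. Qed.

(** As $2s \le -1$, the weight is at most $\varphi^k e^{-\varphi}$. *)
Lemma weight_le k t x : 0 <= x -> 0 <= t -> `|weight k t x| <= k`!%:R.
Proof.
move=> x0 t0; rewrite ger0_norm ?weight_ge0// /weight mulrC.
have p1 := phi_ge1 x0 t0; have p0 : 0 <= phi x t by apply: le_trans p1.
apply: le_trans (expRN_le k p0); rewrite ler_wpM2l ?exprn_ge0// ler_expR.
by move: hs p0; move: (phi x t) => p; nra.
Qed.

Lemma is_derive_phi_t x t : 0 <= x -> 0 <= t ->
  is_derive t 1 (phi x) (phi x t * rate t x).
Proof.
move=> x0 t0.
have b1 : 0 < 1 + c * t by apply: lt_le_trans (base1_ge1 t0).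
have b2 : 0 < 1 + x + c * t by apply: lt_le_trans (base2_ge1 x0 t0).
have d1 : is_derive t 1 (fun t => 1 + c * t) c by exact: (is_derive_affine _ (a := 1)).
have d2 : is_derive t 1 (fun t => 1 + x + c * t) c by exact: (is_derive_affine _ (a := 1 + x)).
have l1 := @is_derive1_comp R (@ln R) (fun t => 1 + c * t) t _ _ (is_derive1_ln b1) d1.
have l2 := @is_derive1_comp R (@ln R) (fun t => 1 + x + c * t) t _ _ (is_derive1_ln b2) d2.
have d3 := is_deriveZ lambda (is_deriveB (is_deriveN l1) l2).
have d4 := is_derive1_comp (is_derive_expR _) d3.
apply: (is_derive_ext d4) => //; rewrite /rate /Defs.phi /psi /= /GRing.scale /=.
rewrite !fctE /= /GRing.scale /=.
by move: (expR _) (_^-1) (_^-1) => e a b; ring.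
Qed.

Lemma is_derive_phi_x x t : 0 <= x -> 0 <= t ->
  is_derive x 1 (phi^~ t) (phi x t * rate_x t x).
Proof.
move=> x0 t0.
have b2 : 0 < 1 + x + c * t by apply: lt_le_trans (base2_ge1 x0 t0).
have d2 : is_derive x 1 (fun x => 1 + x + c * t) 1.
  by apply: (@is_derive_affine _ _ _ (1 + c * t)) => y; ring.
have d0 : is_derive x (1 : R) (cst (- ln (1 + c * t)) : R -> R) 0 by exact: is_derive_cst.
have l2 := @is_derive1_comp R (@ln R) (fun x => 1 + x + c * t) x _ _ (is_derive1_ln b2) d2.
have d3 := is_deriveZ lambda (is_deriveB d0 l2).
have d4 := is_derive1_comp (is_derive_expR _) d3.
apply: (is_derive_ext d4) => //; rewrite /rate_x /Defs.phi /psi /= /GRing.scale /=.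
rewrite !fctE /= /GRing.scale /=.
by move: (expR _) (_^-1) => e a; ring.
Qed.

Lemma is_derive_weight (f : R -> R) (k : nat) y (d : R) : is_derive y 1 f (f y * d) ->
  is_derive y 1 (fun y => expR (2 * s * f y) * f y ^+ k)
    (d * (2 * s * (expR (2 * s * f y) * f y ^+ k.+1) + k%:R * (expR (2 * s * f y) * f y ^+ k))).
Proof.
move=> df.
have dE := is_derive1_comp (is_derive_expR _) (is_deriveZ (2 * s) df).
have dX := is_deriveX k df.
apply: (is_derive_ext (is_deriveM dE dX)) => [y'|]; first by rewrite !fctE.
rewrite !fctE /= /GRing.scale /=.
move: (f y) (expR _) => p e; case: k {dX} => [|k]; first by rewrite expr0 mulr0n expr1; ring.
by rewrite [k.+1.-1]/= !(exprS p k.+1) (exprS p k); ring.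
Qed.

Lemma is_derive_weight_t k x t : 0 <= x -> 0 <= t ->
  is_derive t 1 (weight k ^~ x) (weight_t k t x).
Proof. by move=> x0 t0; exact: is_derive_weight (is_derive_phi_t x0 t0). Qed.

Lemma is_derive_weight_x k x t : 0 <= x -> 0 <= t ->
  is_derive x 1 (weight k t)
   (rate_x t x * (2 * s * weight k.+1 t x + k%:R * weight k t x)).
Proof. by move=> x0 t0; exact: is_derive_weight (is_derive_phi_x x0 t0). Qed.

Lemma is_derive_rate x t : 0 <= x -> 0 <= t ->
  is_derive t 1 (rate ^~ x) (rate_t t x).
Proof.
move=> x0 t0.
have b1 : 1 + c * t != 0 by rewrite gt_eqF//; apply: lt_le_trans (base1_ge1 t0).
have b2 : 1 + x + c * t != 0 by rewrite gt_eqF//; apply: lt_le_trans (base2_ge1 x0 t0).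
have d1 : is_derive t 1 (fun t => 1 + c * t) c by exact: (is_derive_affine _ (a := 1)).
have d2 : is_derive t 1 (fun t => 1 + x + c * t) c by exact: (is_derive_affine _ (a := 1 + x)).
have d3 := is_deriveZ (- lambda * c) (is_deriveD (@is_deriveV R (fun t => 1 + c * t) _ _ _ b1 d1)
  (@is_deriveV R (fun t => 1 + x + c * t) _ _ _ b2 d2)).
apply: (is_derive_ext d3) => //; rewrite /rate_t /GRing.scale /= -!exprVn.
by move: (_^-1) (_^-1) => a b; ring.
Qed.

Lemma is_derive_weight_tt k x t : 0 <= x -> 0 <= t ->
  is_derive t 1 (weight_t k ^~ x) (weight_tt k t x).
Proof.
move=> x0 t0.
have dr := is_derive_rate x0 t0.
have d1 := is_deriveZ (2 * s) (is_derive_weight_t k.+1 x0 t0).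
have d2 := is_deriveZ (k%:R : R) (is_derive_weight_t k x0 t0).
apply: (is_derive_ext (is_deriveM dr (is_deriveD d1 d2))) => //.
have sE (a b : R) : a *: b = a * b by [].
rewrite /weight_tt !fctE /= !sE.
by move: (weight_t _ _ _) (weight_t _ _ _) (weight _ _ _) (weight _ _ _) (rate _ _) (rate_t _ _) => *; ring.
Qed.

Lemma rate_bounds x t : 0 <= x -> 0 <= t -> 0 <= rate t x <= - lambda * c * 2.
Proof.
move=> x0 t0; have /andP[a0 a1] := inv_base1 t0; have /andP[b0 b1] := inv_base2 x0 t0.
have lc : 0 < - lambda * c by rewrite mulr_gt0// oppr_gt0.
rewrite /rate; move: (_^-1) (_^-1) a0 a1 b0 b1 lc => a b a0 a1 b0 b1.
by move: (- lambda * c) => L L0; apply/andP; split; nra.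
Qed.

Lemma rate_t_bound x t : 0 <= x -> 0 <= t -> `|rate_t t x| <= - lambda * c * (2 * c).
Proof.
move=> x0 t0; have /andP[a0 a1] := inv_base1 t0; have /andP[b0 b1] := inv_base2 x0 t0.
have lc : 0 < - lambda * c by rewrite mulr_gt0// oppr_gt0.
rewrite /rate_t normrM (gtr0_norm lc) ler_pM2l//.
move: (_^-1) (_^-1) a0 a1 b0 b1 => a b a0 a1 b0 b1.
have h1 : a ^+ 2 <= 1 by rewrite exprn_ile1// ltW.
have h2 : b ^+ 2 <= 1 by rewrite exprn_ile1// ltW.
have := sqr_ge0 a; have := sqr_ge0 b.
move: (a ^+ 2) (b ^+ 2) h1 h2 => A B h1 h2 B0 A0.
have -> : - c * B - c * A = - (c * (A + B)) by ring.
by rewrite normrN ger0_norm ?mulr_ge0 ?addr_ge0// ?(ltW hc)// (mulrC 2) ler_pM2l//; lra.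
Qed.

Definition bound0 (k : nat) : R := 2 * `|s| * (k.+1)`!%:R + k%:R * k`!%:R.

Lemma weight_t_le k x t : 0 <= x -> 0 <= t ->
  `|weight_t k t x| <= - lambda * c * 2 * bound0 k.
Proof.
move=> x0 t0; have /andP[r0 r1] := rate_bounds x0 t0.
rewrite /weight_t normrM; apply: ler_pM => //; first by rewrite ger0_norm.
apply: le_trans (ler_normD _ _) _; apply: lerD.
  by rewrite normrM [`|2 * s|]normrM (ger0_norm (ler0n _ 2)) ler_wpM2l ?mulr_ge0//; exact: weight_le.
by rewrite normrM (ger0_norm (ler0n _ k)) ler_wpM2l//; exact: weight_le.
Qed.

Lemma bound0_ge0 k : 0 <= bound0 k.
Proof. by rewrite addr_ge0// mulr_ge0// mulr_ge0. Qed.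

Definition bound (k : nat) : R :=
  k`!%:R + - lambda * c * 2 * bound0 k +
  (- lambda * c * (2 * c) * bound0 k +
  - lambda * c * 2 * (2 * `|s| * (- lambda * c * 2 * bound0 k.+1) + k%:R * (- lambda * c * 2 * bound0 k))).

Lemma weight_tt_le k x t : 0 <= x -> 0 <= t ->
  `|weight_tt k t x| <=
  (- lambda * c * (2 * c) * bound0 k +
  - lambda * c * 2 * (2 * `|s| * (- lambda * c * 2 * bound0 k.+1) + k%:R * (- lambda * c * 2 * bound0 k))).
Proof.
move=> x0 t0; have /andP[r0 r1] := rate_bounds x0 t0.
apply: le_trans (ler_normD _ _) _; apply: lerD.
  rewrite normrM; apply: ler_pM => //; first exact: rate_t_bound.
  apply: le_trans (ler_normD _ _) _; apply: lerD.
    by rewrite normrM [`|2 * s|]normrM (ger0_norm (ler0n _ 2)) ler_wpM2l ?mulr_ge0//; exact: weight_le.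
  by rewrite normrM (ger0_norm (ler0n _ k)) ler_wpM2l//; exact: weight_le.
rewrite normrM; apply: ler_pM => //; first by rewrite ger0_norm.
apply: le_trans (ler_normD _ _) _; apply: lerD.
  by rewrite normrM [`|2 * s|]normrM (ger0_norm (ler0n _ 2)) ler_wpM2l ?mulr_ge0//; exact: weight_t_le.
by rewrite normrM (ger0_norm (ler0n _ k)) ler_wpM2l//; exact: weight_t_le.
Qed.

Lemma continuous_inv_base x t : 0 <= x -> 0 <= t ->
  {for x, continuous (fun x => (1 + x + c * t)^-1)}.
Proof.
move=> x0 t0; apply: cvgV.
  by rewrite gt_eqF//; apply: lt_le_trans (base2_ge1 x0 t0).
by apply: cvgD; [apply: cvgD; [exact: cvg_cst|exact: cvg_id]|exact: cvg_cst].
Qed.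

Lemma continuous_weight_x k x t : 0 <= x -> 0 <= t -> {for x, continuous (weight k t)}.
Proof.
move=> x0 t0; apply/differentiable_continuous/derivable1_diffP.
by have [] := is_derive_weight_x k x0 t0.
Qed.

Lemma continuous_rate_x x t : 0 <= x -> 0 <= t -> {for x, continuous (rate t)}.
Proof.
move=> x0 t0; apply: cvgMr; apply: cvgD; first exact: cvg_cst.
exact: continuous_inv_base.
Qed.

Lemma measurable_half_continuous (f : R -> R) : (forall x, 0 <= x -> {for x, continuous f}) ->
  measurable_fun H f.
Proof.
move=> cf; apply: measurable_continuous_half; apply/continuous_in_subspaceT => x.
by rewrite inE /= in_itv /= andbT; exact: cf.
Qed.

Lemma halfline_ge0 (x : R) : H x -> 0 <= x.
Proof. by rewrite /halfline /= in_itv /= andbT; exact: ltW. Qed.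

Lemma measurable_weight k t : 0 <= t -> measurable_fun H (weight k t).
Proof. by move=> t0; apply: measurable_half_continuous => x x0; exact: continuous_weight_x. Qed.

(** The first and second derivatives in time are bounded uniformly in [x] and
    [t], so Taylor's formula gives all the estimates, with crude constants. *)
Lemma C11_weight_carleman k : C11_weight T (bound k) (weight k) (weight_t k).
Proof.
have b0 := bound0_ge0 k; have b1 := bound0_ge0 k.+1.
have lc : 0 < - lambda * c by rewrite mulr_gt0// oppr_gt0.
have l2 : 0 <= - lambda * c * 2 by rewrite mulr_ge0// ltW.
have l3 : 0 <= - lambda * c * (2 * c) by rewrite mulr_ge0 ?(ltW lc)// mulr_ge0// ltW.
have h1 : 0 <= - lambda * c * 2 * bound0 k by exact: mulr_ge0.
have h2 : 0 <= - lambda * c * (2 * c) * bound0 k +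
  - lambda * c * 2 * (2 * `|s| * (- lambda * c * 2 * bound0 k.+1) + k%:R * (- lambda * c * 2 * bound0 k)).
  apply: addr_ge0; first exact: mulr_ge0.
  by apply: mulr_ge0 => //; apply: addr_ge0; apply: mulr_ge0 => //; apply: mulr_ge0.
have h0 : (0 : R) <= k`!%:R by [].
have B0 x t : 0 <= x -> 0 <= t -> `|weight k t x| <= bound k.
  by move=> x0 t0; apply: le_trans (weight_le k x0 t0) _; rewrite /bound -addrA lerDl addr_ge0.
have B1 x t : 0 <= x -> 0 <= t -> `|weight_t k t x| <= bound k.
  move=> x0 t0; apply: le_trans (weight_t_le k x0 t0) _.
  by rewrite /bound -addrA addrCA lerDl addr_ge0.
have B2 x t : 0 <= x -> 0 <= t -> `|weight_tt k t x| <= bound k.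
  move=> x0 t0; apply: le_trans (weight_tt_le k x0 t0) _.
  by rewrite /bound [leRHS]addrC lerDl addr_ge0.
have T0 (u : R) : u \in `[0, T] -> 0 <= u by rewrite in_itv /= => /andP[].
move=> t tT; have t0 := T0 _ tT; split.
- exact: measurable_weight.
- apply: measurable_funM.
    by apply: measurable_half_continuous => x x0; exact: continuous_rate_x.
  apply: measurable_funD; apply: measurable_funM => //; exact: measurable_weight.
- by move=> x /halfline_ge0 x0; exact: B0.
- by move=> x /halfline_ge0 x0; exact: B1.
- move=> r x rT /halfline_ge0 x0.
  have d1 u : u \in `[0, T] -> is_derive u 1 (weight k ^~ x) (weight_t k u x).
    by move=> /T0 u0; exact: is_derive_weight_t.
  have d2 u : u \in `[0, T] -> is_derive u 1 (weight_t k ^~ x) (weight_tt k u x).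
    by move=> /T0 u0; exact: is_derive_weight_tt.
  have e1 u : u \in `[0, T] -> `|weight_t k u x| <= bound k by move=> /T0; exact: B1.
  have e2 u : u \in `[0, T] -> `|weight_tt k u x| <= bound k by move=> /T0; exact: B2.
  exact: (@C2_taylor R T (bound k) (weight k ^~ x) (weight_t k ^~ x) (weight_tt k ^~ x) r t d1 d2 e1 e2 rT tT).
Qed.

Definition weight_x t x := rate_x t x * (2 * s * weight 1 t x).

Lemma primitive_weight t : 0 <= t -> primitive (weight_x t) (weight 0 t).
Proof.
move=> t0; apply: primitive_derive => x x0.
  by apply: (is_derive_eq (is_derive_weight_x 0 x0 t0)); rewrite mul0r addr0.
apply: cvgM; last by apply: cvgMr; exact: continuous_weight_x.
by apply: cvgMr; exact: continuous_inv_base.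
Qed.

Lemma measurable_weight_x t : 0 <= t -> measurable_fun H (weight_x t).
Proof.
move=> t0; apply: measurable_half_continuous => x x0.
apply: cvgM; last by apply: cvgMr; exact: continuous_weight_x.
by apply: cvgMr; exact: continuous_inv_base.
Qed.

Lemma weight_x_le x t : 0 <= x -> 0 <= t -> `|weight_x t x| <= - lambda * (2 * `|s|).
Proof.
move=> x0 t0; have /andP[b0 b1] := inv_base2 x0 t0.
have w1 : `|weight 1 t x| <= 1 by exact: weight_le.
have l0 : 0 <= - lambda by rewrite oppr_ge0 ltW.
rewrite /weight_x /rate_x; move: (weight 1 t x) w1 => w w1; rewrite !normrM (ger0_norm l0) -mulrA ler_wpM2l//.
rewrite (gtr0_norm b0) (ger0_norm (ler0n _ 2)).
have : 2 * `|s| * `|w| <= 2 * `|s| by rewrite ler_piMr// mulr_ge0.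
have : 0 <= 2 * `|s| * `|w| by rewrite !mulr_ge0.
by move: (2 * `|s| * _) => A A0 A1; apply: le_trans A1; rewrite ler_piMl.
Qed.

(** The level sets of $\varphi$ are strictly space-like, uniformly for
    $t \le T$: in $\varphi_t - c\varphi_x$ the terms in $(1 + x + ct)^{-1}$
    cancel, and $-\lambda c\varphi(1 + ct)^{-1}$ is left. *)
Lemma rate_gap x t : 0 <= x -> t \in `[0, T] ->
  c * rate_x t x + (- lambda * c) / (1 + c * T) <= rate t x.
Proof.
move=> x0; rewrite in_itv /= => /andP[t0 tT].
have lc : 0 < - lambda * c by rewrite mulr_gt0// oppr_gt0.
have h : (1 + c * T)^-1 <= (1 + c * t)^-1.
  have b1 := base1_ge1 t0.
  rewrite lef_pV2 ?posrE; last 2 first.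
  - by have := ler_wpM2l (ltW hc) tT; lra.
  - by lra.
  by rewrite lerD2l ler_wpM2l// ltW.
rewrite /rate_x /rate.
have := ler_wpM2l (ltW lc) h.
by move: (_^-1) (_^-1) (_^-1) => A B D; nra.
Qed.

End weight.

(** * Integration in time *)

Section timeIntegration.
Context {R : realType}.
Local Notation mu := (@lebesgue_measure R).
Local Notation H := (@halfline R).
Variable T : R.
Implicit Types (F : R -> R -> R).

Let mitv (i : interval R) : measurable ([set` i] : set (measurableTypeR R)).
Proof. exact: measurable_itv. Qed.
Hint Resolve mitv : core.
Let mH := @measurable_halfline R.

Lemma measurable_Q : measurable (Q T : set (measurableTypeR R * measurableTypeR R)).
Proof. exact: measurableX. Qed.

(** Tonelli's theorem on $Q$, in the order that the energy method needs:
    first an inequality at fixed time, then integration in time. *)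
Lemma intQ_tonelli F : measurable_fun (Q T) (fun z => F z.1 z.2) ->
  (forall x t, H x -> t \in `]0, T[ -> 0 <= F x t) ->
  measurable_fun `]0, T[ (fun t => \int[mu]_(x in H) (F x t)%:E)%E /\
  intQ T F = (\int[mu]_(t in `]0%R, T[) \int[mu]_(x in H) (F x t)%:E)%E.
Proof.
move=> mF F0.
pose G (z : measurableTypeR R * measurableTypeR R) := ((fun z => (F z.1 z.2)%:E) \_ (Q T)) z.
have mG : measurable_fun setT G.
  have := mF => /measurable_EFinP.
  exact: (@measurable_restrictT _ _ _ _ _ _ measurable_Q).1.
have G0 z : (0 <= G z)%E.
  rewrite /G patchE; case: ifPn => //; rewrite inE => -[/= Hx Tt].
  by rewrite lee_fin F0.
have GE t : (\int[mu]_x G (x, t) = ((fun t => \int[mu]_(x in H) (F x t)%:E) \_ `]0%R, T[) t)%E.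
  rewrite patchE; case: ifPn => tT.
    rewrite [RHS]integral_mkcond; apply: eq_integral => x _.
    rewrite /G !patchE; case: ifPn => xH.
      have [Hx _] : Q T (x, t) by rewrite inE in xH.
      by rewrite (mem_set Hx).
    rewrite memNset// => Hx; move: xH; rewrite mem_set//; split => //.
    by rewrite inE in tT.
  rewrite -[RHS](integral0 mu setT); apply: eq_integral => x _.
  rewrite /G patchE memNset// => -[/= _ tT']; move: tT; rewrite mem_set//.
have mg : measurable_fun setT (fubini_G mu G) := @measurable_fun_fubini_tonelli_G _ _ _ _ _ mu G mG G0.
have gE : fubini_G mu G = (fun t => \int[mu]_(x in H) (F x t)%:E)%E \_ `]0%R, T[.
  by apply/funext => t; rewrite /fubini_G GE.
rewrite gE in mg; split.
  exact: (@measurable_restrictT _ _ _ _ _ _ (mitv _)).2 mg.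
have : (\int[mu \x mu]_z G z = \int[mu]_t fubini_G mu G t)%E :=
  @fubini_tonelli2 _ _ _ _ _ mu mu G mG G0.
rewrite gE => ft.
by rewrite /intQ integral_mkcond [RHS]integral_mkcond; exact: ft.
Qed.

(** For nonnegative functions the integral is the supremum of the integrals
    of the simple functions below, which is monotone without measurability. *)
Lemma ge0_le_integral_nonmeasurable (D : set R) (f g : R -> \bar R) :
  (forall x, D x -> 0 <= f x)%E -> (forall x, D x -> f x <= g x)%E ->
  (\int[mu]_(x in D) f x <= \int[mu]_(x in D) g x)%E.
Proof.
move=> f0 fg; rewrite integral_mkcond [leRHS]integral_mkcond.
rewrite !ge0_integralTE.
- apply: le_ereal_sup => y [h hf <-]; exists h => // x.
  apply: le_trans (hf x) _; rewrite !patchE; case: ifPn => //.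
  by rewrite inE; exact: fg.
- by move=> x; rewrite patchE; case: ifPn => //; rewrite inE => Dx; exact: le_trans (f0 _ Dx) (fg _ Dx).
- by move=> x; rewrite patchE; case: ifPn => //; rewrite inE; exact: f0.
Qed.

(** [E] stands for a boundary term made of traces, whose measurability in
    time is not known, so that the hypothesis cannot be integrated as it stands.
    The positive part of $A + D - B$ is measurable and below [E]; it is integrated
    instead. The integral of [B] may be infinite, so terms are moved across the
    inequality only for [D], whose positive and negative parts have the same
    finite integral. *)
Lemma integrate_inequality (A B D E : R -> R) :
  measurable_fun `]0, T[ A -> measurable_fun `]0, T[ B ->
  (forall t, t \in `]0, T[ -> 0 <= A t) -> (forall t, t \in `]0, T[ -> 0 <= B t) ->
  mu.-integrable `]0, T[ (EFin \o D) -> (\int[mu]_(t in `]0, T[) D t = 0) ->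
  (forall t, t \in `]0, T[ -> A t + D t <= B t + E t) ->
  (forall t, t \in `]0, T[ -> 0 <= E t) ->
  (\int[mu]_(t in `]0%R, T[) (A t)%:E <=
   \int[mu]_(t in `]0%R, T[) (B t)%:E + \int[mu]_(t in `]0%R, T[) (E t)%:E)%E.
Proof.
move=> mA mB A0 B0 Di D0 hle E0.
have mD : measurable_fun `]0, T[ D by apply/measurable_EFinP; exact: measurable_int Di.
pose m t := Num.max 0 (A t + D t - B t).
have mm : measurable_fun `]0, T[ m.
  apply: measurable_maxr => //.
  by apply: measurable_funB => //; exact: measurable_funD.
pose Dp t := Num.max 0 (D t). pose Dm t := Num.max 0 (- D t).
have mDp : measurable_fun `]0, T[ Dp by exact: measurable_maxr.
have mDm : measurable_fun `]0, T[ Dm by apply: measurable_maxr => //; exact: measurableT_comp.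
have DE t : D t = Dp t - Dm t.
  rewrite /Dp /Dm; case: (leP 0 (D t)) => h.
    by rewrite (max_l (_ : - D t <= 0)) ?subr0// oppr_le0.
  by rewrite (max_r (_ : 0 <= - D t)) ?sub0r ?opprK// oppr_ge0 ltW.
have Dp0 t : 0 <= Dp t by rewrite le_max lexx.
have Dm0 t : 0 <= Dm t by rewrite le_max lexx.
have m0 t : 0 <= m t by rewrite le_max lexx.
have Dpi : mu.-integrable `]0, T[ (EFin \o Dp).
  apply: le_integrable Di => //; first exact/measurable_EFinP.
  by move=> t _ /=; rewrite lee_fin ger0_norm// /Dp ge_max normr_ge0 ler_norm.
have Dmi : mu.-integrable `]0, T[ (EFin \o Dm).
  apply: le_integrable Di => //; first exact/measurable_EFinP.
  by move=> t _ /=; rewrite lee_fin ger0_norm// /Dm ge_max normr_ge0 -normrN ler_norm.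
have Deq : (\int[mu]_(t in `]0%R, T[) (Dp t)%:E = \int[mu]_(t in `]0%R, T[) (Dm t)%:E)%E.
  have e : \int[mu]_(t in `]0, T[) Dp t - \int[mu]_(t in `]0, T[) Dm t = 0.
    by rewrite -RintegralB// -[RHS]D0; apply: eq_Rintegral => t _; rewrite DE.
  rewrite -[LHS]fineK; last exact: integrable_fin_num.
  rewrite -[RHS]fineK; last exact: integrable_fin_num.
  by congr EFin; apply/eqP; rewrite -subr_eq0; apply/eqP.
have key : (\int[mu]_(t in `]0%R, T[) (A t)%:E + \int[mu]_(t in `]0%R, T[) (Dp t)%:E <=
    (\int[mu]_(t in `]0%R, T[) (B t)%:E + \int[mu]_(t in `]0%R, T[) (m t)%:E)
    + \int[mu]_(t in `]0%R, T[) (Dm t)%:E)%E.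
  rewrite -!ge0_integralD//; try (by move=> t tT; rewrite lee_fin; (exact: A0 || exact: B0 || exact: m0 || exact: Dp0 || exact: Dm0)); try exact/measurable_EFinP.
  - apply: ge0_le_integral => //.
    + by move=> t tT; rewrite adde_ge0 ?lee_fin ?A0.
    + by apply: emeasurable_funD; exact/measurable_EFinP.
    + by apply: emeasurable_funD; [apply: emeasurable_funD|]; exact/measurable_EFinP.
    + move=> t tT; rewrite -!EFinD lee_fin.
      have : A t + D t - B t <= m t by rewrite le_max lexx orbT.
      by have := DE t; lra.
  - by move=> t tT; rewrite adde_ge0// lee_fin ?B0.
  - by apply: emeasurable_funD; exact/measurable_EFinP.
have mE : (\int[mu]_(t in `]0%R, T[) (m t)%:E <= \int[mu]_(t in `]0%R, T[) (E t)%:E)%E.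
  apply: ge0_le_integral_nonmeasurable => t tT; rewrite lee_fin//.
  by rewrite ge_max E0//= lerBlDl hle.
have Dfin : (\int[mu]_(t in `]0%R, T[) (Dm t)%:E)%E \is a fin_num by exact: integrable_fin_num.
apply: le_trans (leeD2l _ mE).
by move: key; rewrite Deq leeD2rE.
Qed.

End timeIntegration.

(** * Curves in Sobolev spaces *)

Section curves.
Context {R : realType}.
Local Notation mu := (@lebesgue_measure R).
Local Notation H := (@halfline R).
Implicit Types (f g : R -> R) (u v w : R -> R -> R) (r t x : R).

Let mH := @measurable_halfline R.

Lemma L2norm_sqr f : (L2norm f `^ 2 = \int[mu]_(x in H) (f x ^+ 2)%:E)%E.
Proof.
rewrite /L2norm poweR_Lnorm ?pnatr_eq0// [RHS]integral_mkcond.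
apply: eq_integral => x _; rewrite !patchE /= patchE; case: ifPn => _ /=.
  by rewrite powR_mulrn// real_normK ?num_real.
by rewrite normr0 powR0 ?pnatr_eq0.
Qed.

(** The square of the norm is a sum of nonnegative terms, of which this is
    one. *)
Lemma sqint_le_Hk_norm (j k : nat) f : (j <= k)%N ->
  ((sqint (iter j (@wderiv R) f))%:E <= Hk_norm k f `^ 2)%E.
Proof.
move=> jk; rewrite /Hk_norm -poweRrM mulVf ?pnatr_eq0// poweRe1; last first.
  by apply: sume_ge0 => i _; exact: poweR_ge0.
have jk1 : (j < k.+1)%N by rewrite ltnS.
rewrite (bigD1 (Ordinal jk1))//=.
apply: (@le_trans _ _ (L2norm (iter j (@wderiv R) f) `^ 2)%E); last first.
  by apply: leeDl; apply: sume_ge0 => i _; exact: poweR_ge0.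
rewrite L2norm_sqr /sqint /Rintegral.
have : (0 <= \int[mu]_(x in H) (iter j (@wderiv R) f x ^+ 2)%:E)%E.
  by apply: integral_ge0 => x _; rewrite lee_fin sqr_ge0.
by case: (\int[mu]_(x in H) _)%E => [r _||] //=; rewrite leey.
Qed.

Lemma cvg_Hk_norm (F : set_system R) {FF : Filter F} (j k : nat) (h : R -> R -> R) :
  (j <= k)%N -> Hk_norm k (h r) @[r --> F] --> 0%E ->
  sqint (iter j (@wderiv R) (h r)) @[r --> F] --> 0.
Proof.
move=> jk /fine_cvgP[fin /cvgrPdist_le c].
apply/cvgrPdist_le => e e0.
have e1 : 0 < Num.min 1 e by rewrite lt_min ltr01.
move: (c _ e1) => ce.
near=> r.
have frn : Hk_norm k (h r) \is a fin_num by near: r.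
have : `|0 - fine (Hk_norm k (h r))| <= Num.min 1 e by near: r.
have n0 : (0 <= Hk_norm k (h r))%E by exact: poweR_ge0.
rewrite sub0r normrN (ger0_norm (fine_ge0 n0)) => hr.
rewrite sub0r normrN ger0_norm ?sqint_ge0//.
have := sqint_le_Hk_norm (h r) jk.
move: hr; rewrite -{2}(fineK frn); move: (fine _) (fine_ge0 n0) => a a0.
rewrite le_min => /andP[a1 ae].
rewrite poweR_EFin lee_fin powR_mulrn// => h1; apply: le_trans h1 _.
by apply: le_trans ae; rewrite expr2 -[leRHS]mulr1; exact: ler_wpM2l.
Unshelve. all: by end_near. Qed.

Variable T : R.
Hypothesis T0 : 0 < T.

Lemma exists_within_dnbhs t d : t \in `[0, T] -> 0 < d ->
  exists r, [/\ r \in `[0, T], r != t & `|r - t| < d].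
Proof.
rewrite in_itv /= => /andP[t0 tT] d0.
pose e := Num.min (d / 2) (T / 2).
have e0 : 0 < e by rewrite lt_min !divr_gt0.
have ed : e < d by rewrite gt_min ltr_pdivrMr// ltr_pMr// ltr1n.
have eT : e <= T / 2 by rewrite ge_min lexx orbT.
have [tT2|tT2] := leP t (T / 2).
  exists (t + e); rewrite in_itv /= addrAC subrr add0r gtr0_norm//; split => //.
    by apply/andP; split; lra.
  by rewrite -subr_eq0 addrAC subrr add0r gt_eqF.
exists (t - e); rewrite in_itv /= addrAC subrr add0r normrN gtr0_norm//; split => //.
  by apply/andP; split; lra.
by rewrite -subr_eq0 addrAC subrr add0r oppr_eq0 gt_eqF.
Qed.

(** Each point of $[0, T]$ is an accumulation point because $T > 0$, so the
    two limits can be compared at the same quotient. *)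
Lemma L2limit_unique t (q : R -> R -> R) (w w' : R -> R) : t \in `[0, T] ->
  (forall r, r \in `[0, T] -> inL2 (q r)) -> inL2 w -> inL2 w' ->
  sqint (fun x => q r x - w x) @[r --> within `[0, T] t^'] --> 0 ->
  sqint (fun x => q r x - w' x) @[r --> within `[0, T] t^'] --> 0 ->
  ae_eq_half w w'.
Proof.
move=> tT qL wL wL' /cvg_within_dnbhsP c1 /cvg_within_dnbhsP c2.
apply: sqint_eq0 => //.
have s0 := sqint_ge0 (fun x => w x - w' x).
apply/eqP; rewrite eq_le s0 andbT; apply/ler_addgt0Pr => e e0; rewrite add0r.
(* Twice the sum of two squared distances bounds the square of their sum,
   hence the quarter. *)
have e4 : 0 < e / 4 by rewrite divr_gt0.
have [d1 d10 h1] := c1 _ e4; have [d2 d20 h2] := c2 _ e4.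
have [|r [rT rt]] := @exists_within_dnbhs t (Num.min d1 d2) tT.
  by rewrite lt_min d10.
rewrite lt_min => /andP[rd1 rd2].
have := h1 r rT rt rd1; have := h2 r rT rt rd2.
rewrite !subr0 !ger0_norm ?sqint_ge0// => k2 k1.
have := sqint_le_lin (- 1) 1 (inL2B (qL _ rT) wL) (inL2B (qL _ rT) wL').
have -> : (fun x => -1 * (q r x - w x) + 1 * (q r x - w' x)) = (fun x => w x - w' x).
  by apply/funext => x; ring.
by move: k1 k2; lra.
Qed.

Lemma quotient_inL2 u t r : inL2 (u r) -> inL2 (u t) ->
  inL2 (fun x => (u r x - u t x) / (r - t)).
Proof.
move=> urL utL; have := inL2_lin (r - t)^-1 (- (r - t)^-1) urL utL; congr inL2.
by apply/funext => x; ring.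
Qed.

Lemma L2deriv_unique u w w' t : L2deriv T u w -> L2deriv T u w' ->
  t \in `[0, T] -> ae_eq_half (w t) (w' t).
Proof.
move=> uw uw' tT; have [uL wL c] := uw _ tT; have [_ wL' c'] := uw' _ tT.
apply: (@L2limit_unique t (fun r x => (u r x - u t x) / (r - t))) => //.
by move=> r rT; have [urL _ _] := uw _ rT; exact: quotient_inL2.
Qed.

Lemma Hk_inL2 (k : nat) f : Hk k f -> inL2 f.
Proof. by case: k => [|k] []. Qed.

Lemma curve_deriv_L2deriv (k : nat) u w : curve_deriv T k u w -> L2deriv T u w.
Proof.
move=> uw t tT; have [/Hk_inL2 uL [/Hk_inL2 wL c]] := uw _ tT; split => //.
exact: (cvg_Hk_norm (leq0n k) c).
Qed.

Lemma curve_continuous_L2continuous w : curve_continuous T 0 w -> L2continuous T w.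
Proof.
move=> hw t tT; have [[wL _] c] := hw _ tT; split => //.
exact: (cvg_Hk_norm (leqnn 0) c).
Qed.

Lemma Hk_wderiv f : Hk 1 f -> inL2 f /\ weak_deriv f (wderiv f).
Proof.
move=> [fL [g [fg _]]]; split => //.
by apply: (@getPex _ [set g | weak_deriv f g]); exists g.
Qed.

(** The weak derivative chosen in the norm of $H^1$ can be replaced by any
    other one. *)
Lemma sqint_wderiv f g : inL2 f -> weak_deriv f g -> sqint (wderiv f) = sqint g.
Proof.
move=> fL fg; have fw : weak_deriv f (wderiv f).
  by apply: (@getPex _ [set g | weak_deriv f g]); exists g.
have [gL _] := fg; have [wL _] := fw.
apply: eq_Rintegral_half.
- by apply: measurable_funX; exact: inL2_measurable.
- by apply: measurable_funX; exact: inL2_measurable.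
- by apply: ae_half_filter (weak_deriv_unique fw fg) _ => x /= h /h ->.
Qed.

Lemma L2continuous_ae w w' : L2continuous T w ->
  (forall t, t \in `[0, T] -> measurable_fun H (w' t) /\ ae_eq_half (w t) (w' t)) ->
  L2continuous T w'.
Proof.
move=> wc ww' t tT; have [wL /cvg_withinP c] := wc _ tT; have [mw' e] := ww' _ tT.
split; first exact: inL2_ae e.
apply/cvg_withinP => eps eps0; have [d d0 h] := c _ eps0; exists d => // r rT rd.
have [wrL _] := wc _ rT; have [mw'r er] := ww' _ rT.
rewrite -(ae_eq_half_sqint (inL2_measurable wrL) (inL2_measurable wL) mw'r mw' er e).
exact: h.
Qed.

(** A derivative in time only sees the curve up to equality almost
    everywhere; this carries regularity over from one representative to another. *)
Lemma L2deriv_ae u u' w : L2deriv T u w ->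
  (forall t, t \in `[0, T] -> measurable_fun H (u' t) /\ ae_eq_half (u t) (u' t)) ->
  L2deriv T u' w.
Proof.
move=> uw uu' t tT; have [uL wL /cvg_within_dnbhsP c] := uw _ tT; have [mu' e] := uu' _ tT.
have uL' := inL2_ae uL mu' e; split => //.
apply/cvg_within_dnbhsP => eps eps0; have [d d0 h] := c _ eps0; exists d => // r rT rt rd.
have [urL _ _] := uw _ rT; have [mu'r er] := uu' _ rT.
have urL' := inL2_ae urL mu'r er.
have := h r rT rt rd; congr (`|_ - _| <= _).
apply: ae_eq_half_sqint.
- exact: inL2_measurable (quotient_inL2 urL uL).
- exact: inL2_measurable.
- exact: inL2_measurable (quotient_inL2 urL' uL').
- exact: inL2_measurable.
- by apply: ae_half_filter2 er e _ => x /= er e Hx; rewrite er// e.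
- by apply: ae_half_filter er _ => x _ _.
Qed.

Lemma curve_continuous_wderiv w : curve_continuous T 1 w ->
  L2continuous T (fun t => wderiv (w t)).
Proof.
move=> hw t tT; have [/Hk_wderiv[wL wd] c] := hw _ tT.
have [dL _] := wd; split => //.
have {}c : sqint (wderiv (fun x => w r x - w t x)) @[r --> within `[0, T] (nbhs t)] --> 0.
  exact: (cvg_Hk_norm (leqnn 1) c).
move/cvg_withinP : c => c.
apply/cvg_withinP => eps eps0; have [d d0 h] := c _ eps0; exists d => // r rT rd.
have [/Hk_wderiv[wrL wrd] _] := hw _ rT.
have := h r rT rd; congr (`|_ - _| <= _).
apply: sqint_wderiv; first exact: inL2B.
have := weak_deriv_lin 1 (- 1) wrL wL wrd wd.
by congr weak_deriv; apply/funext => x; ring.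
Qed.

(** Weak differentiation is linear, so it commutes with difference quotients
    in time; convergence in $H^1$ contains the convergence of weak derivatives in
    $L^2$. *)
Lemma curve_deriv_wderiv v w vx : curve_deriv T 1 v w ->
  (forall t, t \in `[0, T] -> weak_deriv (v t) (vx t)) ->
  L2deriv T vx (fun t => wderiv (w t)).
Proof.
move=> hv dv t tT; have [/Hk_wderiv[vL _] [/Hk_wderiv[wL wd] c]] := hv _ tT.
have vd := dv _ tT; have [vxL _] := vd; have [dL _] := wd; split => //.
have {}c : sqint (wderiv (fun x => (v r x - v t x) / (r - t) - w t x))
    @[r --> within `[0, T] t^'] --> 0.
  exact: (cvg_Hk_norm (leqnn 1) c).
move/cvg_within_dnbhsP : c => c.
apply/cvg_within_dnbhsP => eps eps0; have [d d0 h] := c _ eps0; exists d => // r rT rt rd.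
have [/Hk_wderiv[vrL _] _] := hv _ rT; have vrd := dv _ rT.
have := h r rT rt rd; congr (`|_ - _| <= _).
apply: sqint_wderiv; first by apply: inL2B => //; exact: quotient_inL2.
have l1 := weak_deriv_lin (r - t)^-1 (- (r - t)^-1) vrL vL vrd vd.
have l2 := weak_deriv_lin 1 (- 1) (inL2_lin (r - t)^-1 (- (r - t)^-1) vrL vL) wL l1 wd.
by move: l2; congr weak_deriv; apply/funext => x; ring.
Qed.

(** The quotients at [t] vanish for nearby times, and the limit of the
    quotients is unique. *)
Lemma L2deriv_ae0 u w t d : L2deriv T u w -> t \in `[0, T] -> 0 < d ->
  (forall r, r \in `[0, T] -> `|r - t| < d -> ae_eq_half (u r) (cst 0)) ->
  ae_eq_half (w t) (cst 0).
Proof.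
move=> uw tT d0 u0; have [uL wL c] := uw _ tT.
have u0t : ae_eq_half (u t) (cst 0) by apply: u0; rewrite ?subrr ?normr0.
have zL : inL2 (cst 0 : R -> R).
  apply: inL2_ae uL _ u0t; exact: measurable_cst.
apply: (@L2limit_unique t (fun r x => (u r x - u t x) / (r - t))) => //.
  by move=> r rT; have [urL _ _] := uw _ rT; exact: quotient_inL2.
apply/cvg_within_dnbhsP => e e0; exists d => // r rT rt rd.
have [urL _ _] := uw _ rT.
have qL := quotient_inL2 urL uL.
rewrite (@ae_sqint_eq0 _ _ (cst 0)) ?subrr ?normr0 ?(ltW e0)//.
- exact: inL2_measurable.
- apply: ae_half_filter2 (u0 _ rT rd) u0t _ => x /= h1 h2 Hx.
  by rewrite h1// h2//= subrr mul0r.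
Qed.

Lemma energy_ae0 P u t : measurable_fun H (P t) -> inL2 (u t) ->
  ae_eq_half (u t) (cst 0) -> energy P u t = 0.
Proof.
move=> mP /inL2_measurable mut u0.
rewrite /energy (@eq_Rintegral_half _ _ (cst 0)) ?Rintegral_cst ?mul0r//.
- by apply: measurable_funM => //; exact: measurable_funM.
- by apply: ae_half_filter u0 _ => x /= h Hx; rewrite h// mulr0.
Qed.

Lemma weak_deriv_ae0 f g : inL2 f -> weak_deriv f g -> ae_eq_half f (cst 0) ->
  ae_eq_half g (cst 0).
Proof.
move=> fL fg f0.
have zL : inL2 (cst 0 : R -> R).
  apply: inL2_ae fL _ f0; exact: measurable_cst.
have zg := weak_deriv_ae fL zL f0 fg.
apply: weak_deriv_unique zg _; split => // p tp.
rewrite (_ : (fun x => cst 0 x * (p^`())%classic x) = cst 0); last by apply/funext => x; rewrite mul0r.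
rewrite (_ : (fun x => cst 0 x * p x) = cst 0); last by apply/funext => x; rewrite mul0r.
by rewrite !Rintegral_cst// !mul0r oppr0.
Qed.

End curves.

(** * The energy inequality *)

(** The smallest of the coefficients that remain in front of $v_t^2$, $v_x^2$
    and $v^2$ once the indefinite terms are absorbed. *)
Definition carleman_gain (R : realType) (c kappa : R) :=
  Num.min (kappa / 2) (Num.min (kappa * c ^+ 2) (kappa ^+ 3 / 16)).

Lemma carleman_gain_gt0 (R : realType) (c kappa : R) : 0 < c -> 0 < kappa ->
  0 < carleman_gain c kappa.
Proof. by move=> c0 k0; rewrite !lt_min divr_gt0// mulr_gt0 ?exprn_gt0//= divr_gt0// exprn_gt0. Qed.

(** The variables stand for $p = \varphi$, $\sigma = -s$, $b = v_t$,
    $g = v_x$, $q = \square v$, and [rho], [xi] for the logarithmic derivatives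
    of $\varphi$ in time and space. Since $2 c |g b| \le b^2 + c^2 g^2$, the
    mixed term is dominated by $c\xi\sigma p (b^2 + c^2 g^2)$, and the gap
    between $\varrho$ and $c\xi$ leaves $-\kappa\sigma p (b^2 + c^2 g^2)$.
    Since $\sigma p \ge 2$, the zero order terms are at most
    $-\kappa^3 \sigma^3 p^3 v^2 / 8$. By Young's inequality $q b$ costs a quarter
    of the gain in $b^2$ and $q^2/\kappa$; the product $v b$ costs another quarter
    and half of the gain in $v^2$. *)
Lemma carleman_density (R : realType) (c kappa sigma p rho xi b g q v : R) :
  0 < c -> 0 < kappa -> 2 <= sigma -> 1 <= p -> 0 <= xi -> c * xi + kappa <= rho ->
  carleman_gain c kappa * (sigma ^+ 3 * p ^+ 3 * v ^+ 2 + sigma * (b ^+ 2 + g ^+ 2)) +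
  (q * b - sigma * p * rho * (b ^+ 2 + c ^+ 2 * g ^+ 2) +
   2 * sigma * c ^+ 2 * xi * p * g * b +
   kappa ^+ 2 / 8 * sigma ^+ 2 *
     (2 * p ^+ 2 * v * b + rho * (- 2 * sigma * p ^+ 3 + 2 * p ^+ 2) * v ^+ 2)) <=
  q ^+ 2 / kappa.
Proof.
move=> c0 k0 s2 p1 xi0 gap.
have p0 : 0 < p by apply: lt_le_trans p1.
have s0 : 0 < sigma by lra.
have sp0 : 0 < sigma * p by rewrite mulr_gt0.
have sp2 : 2 <= sigma * p.
  by apply: le_trans s2 _; rewrite ler_peMr// ltW.
have kn : kappa != 0 by rewrite gt_eqF.
set a := carleman_gain c kappa.
have a0 : 0 <= a by rewrite ltW// carleman_gain_gt0.
have ab : a <= kappa / 2 by rewrite ge_min lexx.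
have ag : a <= kappa * c ^+ 2 by rewrite !ge_min lexx orbT.
have av : a <= kappa ^+ 3 / 16 by rewrite !ge_min lexx !orbT.
(* The constants are such that the difference of the two sides is the sum
   of the nonnegative differences in [h1] to [h8]. *)
have h1 : sigma * p * (2 * c ^+ 2 * xi * g * b) <= sigma * p * (c * xi * (b ^+ 2 + c ^+ 2 * g ^+ 2)).
  rewrite ler_pM2l// -subr_ge0.
  have -> : c * xi * (b ^+ 2 + c ^+ 2 * g ^+ 2) - 2 * c ^+ 2 * xi * g * b = c * xi * (b - c * g) ^+ 2 by ring.
  by rewrite mulr_ge0 ?sqr_ge0// mulr_ge0// ltW.
have E0 : 0 <= b ^+ 2 + c ^+ 2 * g ^+ 2 by rewrite addr_ge0 ?sqr_ge0// mulr_ge0 ?sqr_ge0.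
have h2 : sigma * p * ((c * xi + kappa) * (b ^+ 2 + c ^+ 2 * g ^+ 2)) <=
    sigma * p * (rho * (b ^+ 2 + c ^+ 2 * g ^+ 2)).
  by rewrite ler_pM2l// ler_wpM2r.
have h3 : rho * (- 2 * sigma * p ^+ 3 + 2 * p ^+ 2) <= - (kappa * sigma * p ^+ 3).
  have kr : kappa <= rho by apply: le_trans gap; rewrite lerDr mulr_ge0// ltW.
  have e : 2 * p ^+ 2 <= sigma * p * p ^+ 2 by rewrite ler_wpM2r// exprn_ge0// ltW.
  have e' : kappa * (sigma * p ^+ 3) <= rho * (sigma * p ^+ 3).
    by rewrite ler_wpM2r// mulr_ge0 ?exprn_ge0// ltW.
  have e'' : 0 <= rho * (sigma * p * p ^+ 2 - 2 * p ^+ 2).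
    by rewrite mulr_ge0 ?subr_ge0// (le_trans (ltW k0)).
  have ep : sigma * p * p ^+ 2 = sigma * p ^+ 3 by ring.
  by move: e''; rewrite ep; lra.
have h3' : kappa ^+ 2 / 8 * sigma ^+ 2 * (rho * (- 2 * sigma * p ^+ 3 + 2 * p ^+ 2) * v ^+ 2) <=
  kappa ^+ 2 / 8 * sigma ^+ 2 * (- (kappa * sigma * p ^+ 3) * v ^+ 2).
  rewrite ler_wpM2l ?ler_wpM2r ?sqr_ge0//.
  by rewrite mulr_ge0 ?sqr_ge0// divr_ge0// sqr_ge0.
have h4 : kappa ^+ 2 / 8 * sigma ^+ 2 * (2 * p ^+ 2 * v * b) <=
  kappa ^+ 3 / 16 * (sigma ^+ 3 * p ^+ 3 * v ^+ 2) + kappa / 4 * (sigma * p * b ^+ 2).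
  rewrite -subr_ge0.
  rewrite [leRHS](_ : _ = kappa ^+ 3 / 16 * (sigma * p) * (sigma * p * v - 2 / kappa * b) ^+ 2); last by field.
  by rewrite mulr_ge0 ?sqr_ge0// mulr_ge0 ?divr_ge0 ?exprn_ge0// ltW.
have h5 : q * b <= kappa / 4 * (sigma * p * b ^+ 2) + q ^+ 2 / kappa.
  apply: (@le_trans _ _ (kappa / 4 * b ^+ 2 + q ^+ 2 / kappa)).
    rewrite -subr_ge0 [leRHS](_ : _ = kappa^-1 * (q - kappa / 2 * b) ^+ 2); last by field.
    by rewrite mulr_ge0 ?sqr_ge0// invr_ge0 ltW.
  rewrite lerD2r ler_wpM2l ?divr_ge0 ?(ltW k0)// ler_peMl ?sqr_ge0//; lra.
have h6 : a * (sigma * b ^+ 2) <= kappa / 2 * (sigma * p * b ^+ 2).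
  apply: ler_pM => //; first by rewrite mulr_ge0 ?sqr_ge0// ltW.
  by rewrite ler_wpM2r ?sqr_ge0// ler_peMr// ltW.
have h7 : a * (sigma * g ^+ 2) <= kappa * c ^+ 2 * (sigma * p * g ^+ 2).
  apply: ler_pM => //; first by rewrite mulr_ge0 ?sqr_ge0// ltW.
  by rewrite ler_wpM2r ?sqr_ge0// ler_peMr// ltW.
have h8 : a * (sigma ^+ 3 * p ^+ 3 * v ^+ 2) <= kappa ^+ 3 / 16 * (sigma ^+ 3 * p ^+ 3 * v ^+ 2).
  by rewrite ler_wpM2r// mulr_ge0 ?sqr_ge0// mulr_ge0 ?exprn_ge0// ltW.
rewrite -subr_ge0.
have -> : q ^+ 2 / kappa - (a * (sigma ^+ 3 * p ^+ 3 * v ^+ 2 + sigma * (b ^+ 2 + g ^+ 2)) +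
  (q * b - sigma * p * rho * (b ^+ 2 + c ^+ 2 * g ^+ 2) +
   2 * sigma * c ^+ 2 * xi * p * g * b +
   kappa ^+ 2 / 8 * sigma ^+ 2 *
     (2 * p ^+ 2 * v * b + rho * (- 2 * sigma * p ^+ 3 + 2 * p ^+ 2) * v ^+ 2))) =
  (sigma * p * (c * xi * (b ^+ 2 + c ^+ 2 * g ^+ 2)) - sigma * p * (2 * c ^+ 2 * xi * g * b)) +
  (sigma * p * (rho * (b ^+ 2 + c ^+ 2 * g ^+ 2)) - sigma * p * ((c * xi + kappa) * (b ^+ 2 + c ^+ 2 * g ^+ 2))) +
  (kappa ^+ 2 / 8 * sigma ^+ 2 * (- (kappa * sigma * p ^+ 3) * v ^+ 2) -
    kappa ^+ 2 / 8 * sigma ^+ 2 * (rho * (- 2 * sigma * p ^+ 3 + 2 * p ^+ 2) * v ^+ 2)) +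
  (kappa ^+ 3 / 16 * (sigma ^+ 3 * p ^+ 3 * v ^+ 2) + kappa / 4 * (sigma * p * b ^+ 2) -
   kappa ^+ 2 / 8 * sigma ^+ 2 * (2 * p ^+ 2 * v * b)) +
  (kappa / 4 * (sigma * p * b ^+ 2) + q ^+ 2 / kappa - q * b) +
  (kappa / 2 * (sigma * p * b ^+ 2) - a * (sigma * b ^+ 2)) +
  (kappa * c ^+ 2 * (sigma * p * g ^+ 2) - a * (sigma * g ^+ 2)) +
  (kappa ^+ 3 / 16 * (sigma ^+ 3 * p ^+ 3 * v ^+ 2) - a * (sigma ^+ 3 * p ^+ 3 * v ^+ 2)).
  by field.
by do 7![apply: addr_ge0; last by rewrite subr_ge0]; rewrite subr_ge0.
Qed.

Section energyInequality.
Context {R : realType}.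
Local Notation mu := (@lebesgue_measure R).
Local Notation H := (@halfline R).
Variables (c lambda T s : R).
Hypotheses (hc : 0 < c) (hT : 0 < T) (hl : lambda < 0) (hs : 2 <= - s).
Variables v vt vtt vx vxx vtx : R -> R -> R.
Hypotheses (dv : L2deriv T v vt) (dvt : L2deriv T vt vtt) (dvx : L2deriv T vx vtx).
Hypotheses (cvtt : L2continuous T vtt) (cvtx : L2continuous T vtx).
Hypothesis wvx : forall t, t \in `[0, T] -> weak_deriv (vx t) (vxx t).
Hypothesis wvt : forall t, t \in `[0, T] -> weak_deriv (vt t) (vtx t).

Local Notation phi := (phi c lambda).
Local Notation wgt := (weight c lambda s).
Local Notation wgt_t := (weight_t c lambda s).
Local Notation wgt_x := (weight_x c lambda s).
Let kappa := (- lambda * c) / (1 + c * T).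
Let a := carleman_gain c kappa.
Let theta := kappa ^+ 2 / 8 * (- s) ^+ 2.
Let mH := @measurable_halfline R.

Let hs' : 1 <= - (2 * s). Proof. by move: hs; nra. Qed.

Lemma kappa_gt0 : 0 < kappa.
Proof.
rewrite divr_gt0 ?mulr_gt0 ?oppr_gt0//.
by rewrite addr_gt0// mulr_gt0.
Qed.

Let cvg_scale (k : R) (F : set_system R) {FF : Filter F} (f : R -> R) (l : R) :
  f @ F --> l -> (fun r => k * f r) @ F --> k * l.
Proof. by move=> h; apply: cvgM => //; exact: cvg_cst. Qed.

(** The wave energy, plus a zero order term that produces the weighted norm of
    $v$ with the power $\sigma^3$. Its coefficient [theta] is small, so that the
    product $v v_t$ in the derivative is absorbed by the gain in $v_t^2$. *)
Definition total_energy t :=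
  2^-1 * energy (wgt 0) vt t + (c ^+ 2 / 2 * energy (wgt 0) vx t +
  theta * energy (wgt 2) v t).

Definition total_energy' t :=
  2^-1 * energy' (wgt 0) (wgt_t 0) vt vtt t +
  (c ^+ 2 / 2 * energy' (wgt 0) (wgt_t 0) vx vtx t +
   theta * energy' (wgt 2) (wgt_t 2) v vt t).

Lemma total_energy_derivative t : t \in `[0, T] ->
  (total_energy r - total_energy t) / (r - t) @[r --> within `[0, T] t^'] -->
  total_energy' t.
Proof.
move=> tT.
have d1 := energy_derivative (C11_weight_carleman hc hl hs' 0) dvt tT.
have d2 := energy_derivative (C11_weight_carleman hc hl hs' 0) dvx tT.
have d3 := energy_derivative (C11_weight_carleman hc hl hs' 2) dv tT.
apply: cvg_trans (cvgD (@cvg_scale (2^-1) _ _ _ _ d1) (cvgD (@cvg_scale (c ^+ 2 / 2) _ _ _ _ d2) (@cvg_scale theta _ _ _ _ d3))).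
apply: near_eq_cvg; apply: nearW => r.
rewrite /total_energy /= !fctE.
move: (energy _ vt r) (energy _ vt t) (energy _ vx r) (energy _ vx t) (energy _ v r) (energy _ v t) (r - t)^-1 (c ^+ 2 / 2) (2^-1) theta.
by move=> *; ring.
Qed.

Lemma total_energy'_continuous t : t \in `[0, T] ->
  total_energy' r @[r --> within `[0, T] (nbhs t)] --> total_energy' t.
Proof.
move=> tT.
have d1 := energy'_continuous (C11_weight_carleman hc hl hs' 0) dvt cvtt tT.
have d2 := energy'_continuous (C11_weight_carleman hc hl hs' 0) dvx cvtx tT.
have d3 := energy'_continuous (C11_weight_carleman hc hl hs' 2) dv (L2deriv_continuous dvt) tT.
exact: (cvgD (@cvg_scale (2^-1) _ _ _ _ d1) (cvgD (@cvg_scale (c ^+ 2 / 2) _ _ _ _ d2) (@cvg_scale theta _ _ _ _ d3))).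
Qed.

Definition wave t x := vtt t x - c ^+ 2 * vxx t x.

Definition density t x := expR (2 * s * phi x t) *
  ((- s) ^+ 3 * phi x t ^+ 3 * `|v t x| ^+ 2 + (- s) * (`|vt t x| ^+ 2 + `|vx t x| ^+ 2)).

Definition source t x := expR (2 * s * phi x t) * `|wave t x| ^+ 2.

Definition boundary t := expR (2 * s * phi 0 t) *
  ((- s) ^+ 3 * phi 0 t ^+ 3 * `|trace0 (v t)| ^+ 2 +
   (- s) * phi 0 t * (`|trace0 (vt t)| ^+ 2 + `|trace0 (vx t)| ^+ 2)).

Let L2_all t : t \in `[0, T] ->
  [/\ inL2 (v t), inL2 (vt t) & inL2 (vtt t)] /\
  [/\ inL2 (vx t), inL2 (vxx t) & inL2 (vtx t)].
Proof.
move=> tT; have [? ? _] := dv tT; have [_ ? _] := dvt tT; have [? ? _] := dvx tT.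
by have [? _] := wvx tT.
Qed.

Let bounded_weight k t : t \in `[0, T] ->
  measurable_fun H (wgt k t) /\ forall x, H x -> `|wgt k t x| <= k`!%:R.
Proof.
rewrite in_itv /= => /andP[t0 _]; split; first exact: measurable_weight.
by move=> x /halfline_ge0 x0; exact: (weight_le hc hl hs' k x0 t0).
Qed.

Let weighted k t (f g : R -> R) : t \in `[0, T] -> inL2 f -> inL2 g ->
  mu.-integrable H (EFin \o (fun x => wgt k t x * f x * g x)).
Proof. by move=> tT fL gL; have [m b] := bounded_weight k tT; exact: (integrable_mul m b fL gL). Qed.

Lemma integrable_density t : t \in `[0, T] -> mu.-integrable H (EFin \o density t).
Proof.
move=> tT; have [[vL vtL vttL] [vxL vxxL vtxL]] := L2_all tT.
have i := integrable_add mH (integrable_scale ((- s) ^+ 3) mH (weighted 3 tT vL vL))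
  (integrable_scale (- s) mH (integrable_add mH (weighted 0 tT vtL vtL) (weighted 0 tT vxL vxL))).
move: i; congr (_.-integrable _ _); apply/funext => x; congr EFin.
by rewrite /= /density !real_normK ?num_real// /weight expr0; ring.
Qed.

Lemma integrable_source t : t \in `[0, T] -> mu.-integrable H (EFin \o source t).
Proof.
move=> tT; have [[vL vtL vttL] [vxL vxxL vtxL]] := L2_all tT.
have wL : inL2 (wave t).
  have := inL2_lin 1 (- c ^+ 2) vttL vxxL; congr inL2; apply/funext => x.
  by rewrite /wave; ring.
have := weighted 0 tT wL wL.
congr (_.-integrable _ _); apply/funext => x; congr EFin.
by rewrite /= /source real_normK ?num_real// /weight expr0; ring.
Qed.

(** The interior part of the derivative of [total_energy] after the term with
    $v_x v_{tx}$ has been integrated by parts: $v_{tt}$ and $-c^2 v_{xx}$ then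
    combine to the wave operator. *)
Let energy_density t x :=
  wgt 0 t x * wave t x * vt t x
  + 2^-1 * (wgt_t 0 t x * vt t x * vt t x)
  + c ^+ 2 / 2 * (wgt_t 0 t x * vx t x * vx t x)
  - c ^+ 2 * (wgt_x t x * vx t x * vt t x)
  + theta * (wgt 2 t x * vt t x * (v t x + v t x) + wgt_t 2 t x * v t x * v t x).

Lemma total_energy'E t : t \in `[0, T] ->
  mu.-integrable H (EFin \o energy_density t) /\
  total_energy' t = \int[mu]_(x in H) energy_density t x -
    c ^+ 2 * (wgt 0 t 0 * trace0 (vx t) * trace0 (vt t)).
Proof.
move=> tT; have [[vL vtL vttL] [vxL vxxL vtxL]] := L2_all tT.
have t0 : 0 <= t by move: tT; rewrite in_itv /= => /andP[].
have [m0 b0] := bounded_weight 0 tT.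
have [mx bx] : measurable_fun H (wgt_x t) /\ forall x, H x -> `|wgt_x t x| <= - lambda * (2 * `|s|) + 0`!%:R.
  split; first exact: measurable_weight_x.
  by move=> x /halfline_ge0 x0; apply: le_trans (weight_x_le hc hl hs' x0 t0) _; rewrite lerDl.
have b0' x : H x -> `|wgt 0 t x| <= - lambda * (2 * `|s|) + 0`!%:R.
  by move=> /b0 h; apply: le_trans h _; rewrite lerDr mulr_ge0 ?oppr_ge0 ?mulr_ge0// ltW.
have ibp := weighted_integration_by_parts vxL (wvx tT) vtL (wvt tT) (primitive_weight lambda s hc t0) m0 mx b0' bx.
have wt k (f : R -> R) : inL2 f -> mu.-integrable H (EFin \o (fun x => wgt_t k t x * f x * f x)).
  move=> fL; have [_ m b b' _] := C11_weight_carleman hc hl hs' k tT.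
  exact: (integrable_mul m b' fL fL).
have i1 := weighted 0 tT vttL vtL.
have i2 := weighted 0 tT vxxL vtL.
have i3 := weighted 0 tT vxL vtxL.
have i4 : mu.-integrable H (EFin \o (fun x => wgt_x t x * vx t x * vt t x)) := integrable_mul mx bx vxL vtL.
have i5 := wt 0 _ vtL.
have i6 := wt 0 _ vxL.
have i7 := weighted 2 tT vtL (inL2D vL vL).
have i8 := wt 2 _ vL.
have j : mu.-integrable H (EFin \o energy_density t).
  have wvI : mu.-integrable H (EFin \o (fun x => wgt 0 t x * wave t x * vt t x)).
    have := integrable_sub mH i1 (integrable_scale (c ^+ 2) mH i2).
    congr (_.-integrable _ _); apply/funext => x; congr EFin.
    by rewrite /wave; ring.
  exact: (integrable_add mH (integrable_sub mH (integrable_add mH (integrable_add mH wvI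
     (integrable_scale (2^-1) mH i5)) (integrable_scale (c ^+ 2 / 2) mH i6)) (integrable_scale (c ^+ 2) mH i4))
     (integrable_scale theta mH (integrable_add mH i7 i8))).
split => //.
rewrite /total_energy' /energy'.
have i1' : mu.-integrable H (EFin \o (fun x => wgt 0 t x * vtt t x * (vt t x + vt t x))) := weighted 0 tT vttL (inL2D vtL vtL).
have e1 : \int[mu]_(x in H) (wgt 0 t x * vtt t x * (vt t x + vt t x)) = 2 * \int[mu]_(x in H) (wgt 0 t x * vtt t x * vt t x).
  by rewrite -RintegralZl//; apply: eq_Rintegral => x _; ring.
have e3 : \int[mu]_(x in H) (wgt 0 t x * vtx t x * (vx t x + vx t x)) = 2 * \int[mu]_(x in H) (wgt 0 t x * vx t x * vtx t x).
  by rewrite -RintegralZl//; apply: eq_Rintegral => x _; ring.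
rewrite e1 e3.
have -> : \int[mu]_(x in H) energy_density t x =
  \int[mu]_(x in H) (wgt 0 t x * vtt t x * vt t x) -
  c ^+ 2 * \int[mu]_(x in H) (wgt 0 t x * vxx t x * vt t x) +
  2^-1 * \int[mu]_(x in H) (wgt_t 0 t x * vt t x * vt t x) +
  c ^+ 2 / 2 * \int[mu]_(x in H) (wgt_t 0 t x * vx t x * vx t x) -
  c ^+ 2 * \int[mu]_(x in H) (wgt_x t x * vx t x * vt t x) +
  theta * (\int[mu]_(x in H) (wgt 2 t x * vt t x * (v t x + v t x)) +
           \int[mu]_(x in H) (wgt_t 2 t x * v t x * v t x)).
  have k1 := integrable_sub mH i1 (integrable_scale (c ^+ 2) mH i2).
  have k2 := integrable_add mH k1 (integrable_scale (2^-1) mH i5).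
  have k3 := integrable_add mH k2 (integrable_scale (c ^+ 2 / 2) mH i6).
  have k4 := integrable_sub mH k3 (integrable_scale (c ^+ 2) mH i4).
  have k5 := integrable_add mH i7 i8.
  rewrite -[X in theta * X](RintegralD mH i7 i8) -(RintegralZl theta mH k5).
  rewrite -(RintegralZl (c ^+ 2) mH i4) -(RintegralZl (c ^+ 2 / 2) mH i6) -(RintegralZl (2^-1) mH i5) -(RintegralZl (c ^+ 2) mH i2).
  rewrite -(RintegralB mH i1 (integrable_scale (c ^+ 2) mH i2)).
  rewrite -(RintegralD mH k1 (integrable_scale (2^-1) mH i5)).
  rewrite -(RintegralD mH k2 (integrable_scale (c ^+ 2 / 2) mH i6)).
  rewrite -(RintegralB mH k3 (integrable_scale (c ^+ 2) mH i4)).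
  rewrite -(RintegralD mH k4 (integrable_scale theta mH k5)).
  by apply: eq_Rintegral => x _; rewrite /energy_density /wave; ring.
move: ibp; set J := wgt 0 t 0 * _ * _; rewrite -mulrA.
move: (\int[mu]_(x in H) (wgt 0 t x * vtt t x * vt t x)) => I1.
move: (\int[mu]_(x in H) (wgt 0 t x * vxx t x * vt t x)) => I2.
move: (\int[mu]_(x in H) (wgt 0 t x * vx t x * vtx t x)) => I3.
move: (\int[mu]_(x in H) (wgt_x t x * vx t x * vt t x)) => I4.
move: (\int[mu]_(x in H) (wgt_t 0 t x * vt t x * vt t x)) => I5.
move: (\int[mu]_(x in H) (wgt_t 0 t x * vx t x * vx t x)) => I6.
move: (\int[mu]_(x in H) (wgt 2 t x * vt t x * (v t x + v t x))) => I7.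
move: (\int[mu]_(x in H) (wgt_t 2 t x * v t x * v t x)) => I8.
move=> h.
have -> : I4 = - J - I2 - I3 by rewrite -h; ring.
by move: theta => th; field.
Qed.

(** The interior terms are compared pointwise. The boundary term
    $-c^2 W v_t v_x$ is bounded by $c^2 W (v_t^2 + v_x^2)/2$, and
    $\sigma\varphi \ge 1$. *)
Lemma energy_inequality t : t \in `[0, T] ->
  a * \int[mu]_(x in H) density t x + total_energy' t <=
  kappa^-1 * \int[mu]_(x in H) source t x + c ^+ 2 / 2 * boundary t.
Proof.
move=> tT; have [j ->] := total_energy'E tT.
have t0 : 0 <= t by move: tT; rewrite in_itv /= => /andP[].
have iA := integrable_density tT; have iB := integrable_source tT.
have k0 := kappa_gt0.
have main : a * \int[mu]_(x in H) density t x + \int[mu]_(x in H) energy_density t x <=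
    kappa^-1 * \int[mu]_(x in H) source t x.
  rewrite -(RintegralZl a mH iA) -(RintegralZl kappa^-1 mH iB).
  rewrite -(RintegralD mH (integrable_scale a mH iA) j).
  apply: le_Rintegral => //.
  - exact: (integrable_add mH (integrable_scale a mH iA) j).
  - exact: integrable_scale.
  - move=> x /halfline_ge0 x0.
    have gap := rate_gap hc hl x0 tT; rewrite -/kappa in gap.
    have xi0 : 0 <= rate_x c lambda t x.
      have b2 := base2_ge1 hc x0 t0.
      by rewrite mulr_ge0 ?oppr_ge0 ?(ltW hl)// invr_ge0 (le_trans ler01).
        have := carleman_density (vt t x) (vx t x) (wave t x) (v t x) hc k0 hs (phi_ge1 hc hl x0 t0) xi0 gap.
    rewrite -/a /density /energy_density /source /weight_t /weight_x /weight !real_normK ?num_real//.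
    rewrite /theta expr0 expr1.
    move: (expR_ge0 (2 * s * phi x t)).
    move: (rate c lambda t x) (rate_x c lambda t x) (wave t x) (v t x) (vt t x) (vx t x) (phi x t) (expR (2 * s * phi x t)) a kappa (lt0r_neq0 k0) => rho xi q f b g p W A k kn W0.
    rewrite -subr_ge0 => /(mulr_ge0 W0) h.
    rewrite -subr_ge0; apply: le_trans h _; rewrite le_eqVlt; apply/orP; left; apply/eqP.
    by field.
have p1 := phi_ge1 hc hl (lexx 0) t0.
have bd : - (c ^+ 2 * (wgt 0 t 0 * trace0 (vx t) * trace0 (vt t))) <= c ^+ 2 / 2 * boundary t.
  rewrite /boundary /weight expr0 mulr1 !real_normK ?num_real//.
  move: (expR_ge0 (2 * s * phi 0 t)) p1.
  move: (phi 0 t) (expR (2 * s * phi 0 t)) (trace0 (v t)) (trace0 (vt t)) (trace0 (vx t)) => p W f b g W0 p1.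
  have s0 : 0 <= - s by apply: le_trans hs.
  have sp1 : 1 <= - s * p.
    by rewrite -[1]mulr1; apply: ler_pM => //; apply: le_trans hs; rewrite ler1n.
  have p0 : 0 <= p by lra.
  have f0 : 0 <= (- s) ^+ 3 * p ^+ 3 * f ^+ 2.
    by rewrite mulr_ge0 ?sqr_ge0// mulr_ge0 ?exprn_ge0.
  have bg : - (2 * (g * b)) <= - s * p * (b ^+ 2 + g ^+ 2).
    apply: (@le_trans _ _ (b ^+ 2 + g ^+ 2)).
      by have := sqr_ge0 (b + g); nra.
    by rewrite ler_peMl// addr_ge0 ?sqr_ge0.
  have e : 0 <= c ^+ 2 / 2 * W * ((- s) ^+ 3 * p ^+ 3 * f ^+ 2 + (- s * p * (b ^+ 2 + g ^+ 2) - (- (2 * (g * b))))).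
    apply: mulr_ge0; last by apply: addr_ge0; rewrite ?subr_ge0.
    by rewrite mulr_ge0// divr_ge0// sqr_ge0.
  rewrite -subr_ge0; apply: le_trans e _; rewrite le_eqVlt; apply/orP; left; apply/eqP.
  by field.
by move: main bd; lra.
Qed.

Hypothesis v0 : vanishes_near_ends T v.
Hypothesis dvx0 : forall t, t \in `[0, T] -> weak_deriv (v t) (vx t).

(** Near an end point $v$ vanishes, hence so do $v_t$ and $v_x$ at it, almost
    everywhere in space. *)
Lemma total_energy_end t : t = 0 \/ t = T -> total_energy t = 0.
Proof.
move=> t0T; have tT : t \in `[0, T].
  by rewrite in_itv /=; case: t0T => ->; rewrite lexx ?(ltW hT).
have [d d0 vd] := v0.
have near r : r \in `[0, T] -> `|r - t| < d -> ae_eq_half (v r) (cst 0).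
  move=> rT rd; apply: vd => //; case: t0T rd => ->.
    by rewrite subr0 => /(le_lt_trans (ler_norm _)); left.
  by rewrite distrC => /(le_lt_trans (ler_norm _)) h; right; rewrite ltrBlDl -ltrBlDr.
have [[vL vtL vttL] [vxL vxxL vtxL]] := L2_all tT.
have e0 : ae_eq_half (v t) (cst 0) by apply: near => //; rewrite subrr normr0.
have e1 : ae_eq_half (vt t) (cst 0) := L2deriv_ae0 hT dv tT d0 near.
have e2 : ae_eq_half (vx t) (cst 0) := weak_deriv_ae0 vL (dvx0 tT) e0.
have [m0 _] := bounded_weight 0 tT; have [m2 _] := bounded_weight 2 tT.
by rewrite /total_energy !energy_ae0// !mulr0 !addr0.
Qed.

Lemma integral_total_energy' : mu.-integrable `]0, T[ (EFin \o total_energy') /\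
  \int[mu]_(t in `]0, T[) total_energy' t = 0.
Proof.
have [i e] := FTC_within hT total_energy_derivative total_energy'_continuous.
have i2 : mu.-integrable `[0, T[ (EFin \o total_energy').
  apply: integrableS i => //; exact: subset_itv_co_cc.
have i1 : mu.-integrable `]0, T[ (EFin \o total_energy').
  apply: integrableS i => //; exact: subset_itv_oo_cc.
split => //; rewrite Rintegral_itv_obnd_cbnd// Rintegral_itv_bndo_bndc// e.
by rewrite !total_energy_end ?subrr//; [left|right].
Qed.

Hypotheses (mv : measurableQ T v) (mvt : measurableQ T vt) (mvtt : measurableQ T vtt)
  (mvx : measurableQ T vx) (mvxx : measurableQ T vxx).

Let mphi : measurable_fun (Q T) (fun z : R * R => phi z.1 z.2).
Proof.
have m1 : measurable_fun (Q T) (fst : R * R -> R) by apply: measurable_funTS; exact: measurable_fst.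
have m2 : measurable_fun (Q T) (snd : R * R -> R) by apply: measurable_funTS; exact: measurable_snd.
have m3 : measurable_fun (Q T) (fun z : R * R => c * z.2) by exact: measurable_funM.
apply: (measurableT_comp (@measurable_expR R)); apply: measurable_funM => //.
apply: measurable_funB.
  apply: (measurableT_comp (@oppr_measurable R setT)).
  by apply: (measurableT_comp (@measurable_ln R)); exact: measurable_funD.
by apply: (measurableT_comp (@measurable_ln R)); apply: measurable_funD => //; exact: measurable_funD.
Qed.

Let mweight : measurable_fun (Q T) (fun z : R * R => expR (2 * s * phi z.1 z.2)).
Proof. by apply: (measurableT_comp (@measurable_expR R)); exact: measurable_funM. Qed.

Let mnormX (f : R * R -> R) : measurable_fun (Q T) f ->
  measurable_fun (Q T) (fun z => `|f z| ^+ 2).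
Proof. by move=> mf; apply: measurable_funX; exact: measurableT_comp. Qed.

(** The energy inequality is integrated over $(0, T)$, where the derivative of
    the energy has integral zero. *)
Theorem energy_estimate :
  (intQ T (fun x t => density t x) <=
   ((kappa^-1 + c ^+ 2 / 2) / a)%:E * intQ T (fun x t => source t x) +
   ((kappa^-1 + c ^+ 2 / 2) / a)%:E * \int[mu]_(t in `]0%R, T[) (boundary t)%:E)%E.
Proof.
have k0 := kappa_gt0.
have a0 : 0 < a by exact: carleman_gain_gt0.
pose K := kappa^-1 + c ^+ 2 / 2.
have ik0 : 0 < kappa^-1 by rewrite invr_gt0.
have c20 : 0 <= c ^+ 2 / 2 by rewrite divr_ge0// sqr_ge0.
have K0 : 0 < K by rewrite ltr_pwDl.
have oc t : t \in `]0, T[ -> t \in `[0, T] by exact: subset_itv_oo_cc.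
have s0 : 0 <= - s by apply: le_trans hs.
have phi0 x t : 0 <= x -> t \in `]0, T[ -> 0 <= phi x t.
  move=> x0 /oc; rewrite in_itv /= => /andP[t0 _].
  exact: le_trans (phi_ge1 hc hl x0 t0).
have mA : measurable_fun (Q T) (fun z => density z.2 z.1).
  apply: measurable_funM => //; apply: measurable_funD.
    by apply: measurable_funM; [apply: measurable_funM => //; exact: measurable_funX|exact: mnormX].
  by apply: measurable_funM => //; apply: measurable_funD; exact: mnormX.
have mB : measurable_fun (Q T) (fun z => source z.2 z.1).
  apply: measurable_funM => //; apply: mnormX; apply: measurable_funB => //.
  exact: measurable_funM.
have A0 x t : H x -> t \in `]0, T[ -> 0 <= density t x.
  move=> /halfline_ge0 x0 tT; have p0 := phi0 x t x0 tT.
  by rewrite /density mulr_ge0 ?expR_ge0// addr_ge0// mulr_ge0 ?sqr_ge0 ?addr_ge0 ?sqr_ge0//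
    mulr_ge0// exprn_ge0.
have B0 x t : H x -> t \in `]0, T[ -> 0 <= source t x.
  by move=> _ _; rewrite /source mulr_ge0 ?expR_ge0// sqr_ge0.
have E0 t : t \in `]0, T[ -> 0 <= boundary t.
  move=> tT; have p0 := phi0 0 t (lexx 0) tT.
  rewrite /boundary mulr_ge0 ?expR_ge0// addr_ge0// mulr_ge0 ?addr_ge0 ?sqr_ge0//.
    by rewrite mulr_ge0// exprn_ge0.
  by rewrite mulr_ge0.
have [mIA eA] := intQ_tonelli mA A0; have [mIB eB] := intQ_tonelli mB B0.
have [Di D0] := integral_total_energy'.
have fA t : t \in `]0, T[ -> (\int[mu]_(x in H) (density t x)%:E = (\int[mu]_(x in H) density t x)%R%:E)%E.
  by move=> /oc tT; rewrite /Rintegral fineK//; apply: integrable_fin_num => //; exact: integrable_density.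
have fB t : t \in `]0, T[ -> (\int[mu]_(x in H) (source t x)%:E = (\int[mu]_(x in H) source t x)%R%:E)%E.
  by move=> /oc tT; rewrite /Rintegral fineK//; apply: integrable_fin_num => //; exact: integrable_source.
have eA' : intQ T (fun x t => density t x) = (\int[mu]_(t in `]0%R, T[) (\int[mu]_(x in H) density t x)%R%:E)%E.
  by rewrite eA; apply: eq_integral => t; rewrite inE; exact: fA.
have eB' : intQ T (fun x t => source t x) = (\int[mu]_(t in `]0%R, T[) (\int[mu]_(x in H) source t x)%R%:E)%E.
  by rewrite eB; apply: eq_integral => t; rewrite inE; exact: fB.
have mI (F : R -> \bar R) : measurable_fun `]0, T[ F -> measurable_fun `]0, T[ (fun t => fine (F t)).
  by move=> mF; apply: (measurableT_comp (@fine_measurable R setT measurableT)).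
have mA' : measurable_fun `]0, T[ (fun t => \int[mu]_(x in H) density t x) := mI _ mIA.
have mB' : measurable_fun `]0, T[ (fun t => \int[mu]_(x in H) source t x) := mI _ mIB.
have IA0 t : t \in `]0, T[ -> 0 <= \int[mu]_(x in H) density t x.
  by move=> tT; apply: Rintegral_ge0 => x Hx; exact: A0.
have IB0 t : t \in `]0, T[ -> 0 <= \int[mu]_(x in H) source t x.
  by move=> tT; apply: Rintegral_ge0 => x Hx; exact: B0.
have aK0 : 0 < a / K by rewrite divr_gt0.
have mitv : measurable (`]0, T[ : set (measurableTypeR R)) by exact: measurable_itv.
have key : (\int[mu]_(t in `]0%R, T[) (a / K * \int[mu]_(x in H) density t x)%R%:E <=
   \int[mu]_(t in `]0%R, T[) (\int[mu]_(x in H) source t x)%R%:E +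
   \int[mu]_(t in `]0%R, T[) (boundary t)%:E)%E.
  apply: (@integrate_inequality _ _ _ _ (fun t => K^-1 * total_energy' t)) => //.
  - exact: measurable_funM.
  - by move=> t tT; rewrite mulr_ge0 ?IA0// ltW.
  - exact: integrable_scale.
  - by rewrite RintegralZl// D0 mulr0.
  - move=> t tT; have := energy_inequality (oc _ tT).
    move: (E0 _ tT) (IB0 _ tT).
    move: (\int[mu]_(x in H) density t x) (\int[mu]_(x in H) source t x) (total_energy' t) (boundary t).
    move=> I J D E E00 J0 h.
    rewrite -(ler_pM2l K0) [leLHS](_ : _ = a * I + D); last by field; rewrite gt_eqF.
    apply: le_trans h _; rewrite /K mulrDr lerD// ler_wpM2r// ?lerDl ?lerDr//.
    exact: ltW.
rewrite eA' eB' -ge0_muleDr; last 2 first.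
- by apply: integral_ge0 => t tT; rewrite lee_fin IB0.
- by apply: integral_ge0 => t tT; rewrite lee_fin E0.
have -> : K / a = (a / K)^-1 by rewrite invf_div.
rewrite lee_pdivlMl//; apply: le_trans key.
rewrite le_eqVlt; apply/orP; left; apply/eqP.
under [RHS]eq_integral do rewrite EFinM.
rewrite ge0_integralZl//.
- exact/measurable_EFinP.
- by rewrite lee_fin ltW.
Qed.

End energyInequality.

(** * The Carleman estimate *)

Theorem corollary3p2 (R : realType) (c T lambda beta : R)
    (hc : 0 < c) (hT : 0 < T)
    (hlambda : - (1 / 3) < lambda < 0)
    (hbeta : 0 < beta < 1 - (4 * lambda + 2) /
               Num.sqrt ((2 * lambda + 3) * (8 * lambda + 3))) :
  exists C S0 : R, [/\ 0 < C, 1 <= S0 &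
    forall v vt vtt vx vxx : R -> R -> R,
      (* v in C([0,T];H^2), C^1([0,T];H^1) and C^2([0,T];L^2) *)
      curve_C T 0 2 v -> curve_C T 1 1 v -> curve_C T 2 0 v ->
      vanishes_near_ends T v ->
      (* vt, vtt, vx, vxx are the derivatives of v *)
      curve_deriv T 0 v vt -> curve_deriv T 0 vt vtt ->
      (forall t, t \in `[0, T] -> weak_deriv (v t) (vx t)) ->
      (forall t, t \in `[0, T] -> weak_deriv (vx t) (vxx t)) ->
      (* the representatives are functions on Q, measurable in (x, t) *)
      measurableQ T v -> measurableQ T vt -> measurableQ T vtt ->
      measurableQ T vx -> measurableQ T vxx ->
      forall s : R, s <= - S0 ->
      (intQ T (fun x t =>
         expR (2 * s * phi c lambda x t) *
         ((- s) ^+ 3 * phi c lambda x t ^+ 3 * `|v t x| ^+ 2 +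
          (- s) * (`|vt t x| ^+ 2 + `|vx t x| ^+ 2)))%R
       <=
       C%:E * intQ T (fun x t =>
         expR (2 * s * phi c lambda x t) *
         `|vtt t x - c ^+ 2 * vxx t x| ^+ 2)%R
       +
       C%:E * \int[@lebesgue_measure R]_(t in `]0%R, T[)
         (expR (2 * s * phi c lambda 0 t) *
          ((- s) ^+ 3 * phi c lambda 0 t ^+ 3 * `|trace0 (v t)| ^+ 2 +
           (- s) * phi c lambda 0 t *
             (`|trace0 (vt t)| ^+ 2 + `|trace0 (vx t)| ^+ 2)))%R%:E)%E].
Proof.
have /andP[_ hl] := hlambda.
pose kappa := (- lambda * c) / (1 + c * T).
have k0 : 0 < kappa := kappa_gt0 hc hT hl.
exists ((kappa^-1 + c ^+ 2 / 2) / carleman_gain c kappa), 2; split.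
- rewrite divr_gt0 ?carleman_gain_gt0// addr_gt0 ?invr_gt0// divr_gt0// exprn_gt0//.
- by rewrite ler1n.
move=> v vt vtt vx vxx _ [_ [w [vw [cw _]]]] [_ [w1 [vw1 [_ [w2 [w12 [cw2 _]]]]]]] v0 dv dvt wv wvx
  mv mvt mvtt mvx mvxx s hs.
have {}dv := curve_deriv_L2deriv dv; have {}dvt := curve_deriv_L2deriv dvt.
have vtL t : t \in `[0, T] -> inL2 (vt t) by move=> /dv[].
have vttL t : t \in `[0, T] -> inL2 (vtt t) by move=> /dvt[].
(* The three memberships of [v] provide three time derivatives of [v]. They
   are equal almost everywhere, so [vtt] is continuous in time and the time
   derivative of [vx] is a weak derivative of [vt]. *)
have w1E t : t \in `[0, T] -> ae_eq_half (w1 t) (vt t).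
  exact: (L2deriv_unique hT (curve_deriv_L2deriv vw1) dv).
have wE t : t \in `[0, T] -> ae_eq_half (w t) (vt t).
  exact: (L2deriv_unique hT (curve_deriv_L2deriv vw) dv).
have vtw2 : L2deriv T vt w2.
  apply: L2deriv_ae (curve_deriv_L2deriv w12) _ => t tT; split; last exact: w1E.
  exact: inL2_measurable (vtL _ tT).
have cvtt : L2continuous T vtt.
  apply: L2continuous_ae (curve_continuous_L2continuous cw2) _ => t tT; split.
    exact: inL2_measurable (vttL _ tT).
  exact: (L2deriv_unique hT vtw2 dvt).
have wvt t : t \in `[0, T] -> weak_deriv (vt t) (wderiv (w t)).
  move=> tT; have [/Hk_wderiv[wL wd] _] := cw _ tT.
  exact: (weak_deriv_ae wL (vtL _ tT) (wE _ tT) wd).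
have hs2 : 2 <= - s by rewrite lerNr.
exact: (energy_estimate hc hT hl hs2 dv dvt (curve_deriv_wderiv vw wv) cvtt
  (curve_continuous_wderiv cw) wvx wvt v0 wv mv mvt mvtt mvx mvxx).
Qed.
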